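(* Let $\alpha,\beta\in\mathbb{C}$ (with $\alpha$ taken to be $0$ if $\alpha\in\mathbb{Z}$). The $\mathrm{Vir}$-module $V'_{\alpha,\beta}\otimes L(-\frac{22}{5},0)$ is irreducible if and only if $(\alpha,\beta)\neq(0,\frac65)$. Moreover, $$\left(V'_{0,\frac65}\otimes L(-\tfrac{22}{5},0)\right)/U_0\cong L(-\tfrac{22}{5},-\tfrac15),$$ where $U_0=U(\mathrm{Vir})(v_0\otimes v)$ and $v$ is the highest weight vector of $L(-\frac{22}{5},0)$.
   Context: $\mathrm{Vir}$ is the complex Lie algebra with basis $\{C,L_i:i\in\mathbb{Z}\}$, $C$ central, $[L_n,L_m]=(n-m)L_{m+n}+\delta_{m,-n}\frac{n^3-n}{12}C$, and $U(\mathrm{Vir})$ is its universal enveloping algebra. The Verma module $V(c,h)$ is the universal $\mathrm{Vir}$-module generated by a vector $v$ with $Cv=cv$, $L_0v=hv$, $L_nv=0$ for $n>0$; $L(c,h)$ is its unique irreducible quotient, with highest weight vector still denoted $v$. For $\alpha,\beta\in\mathbb{C}$, $V_{\alpha,\beta}=\bigoplus_{m\in\mathbb{Z}}\mathbb{C}v_m$ with $L_nv_m=-(m+\alpha+\beta+n\beta)v_{m+n}$, $Cv_m=0$. Since $V_{\alpha,\beta}\cong V_{\alpha+k,\beta}$ for $k\in\mathbb{Z}$, by convention $\alpha$ is taken to be $0$ whenever $\alpha\in\mathbb{Z}$. Put $V'_{0,0}=V_{0,0}/\mathbb{C}v_0$, $V'_{0,1}=\bigoplus_{m\neq-1}\mathbb{C}v_m\subset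 V_{0,1}$, and $V'_{\alpha,\beta}=V_{\alpha,\beta}$ for all other pairs. The tensor product has the action $L_n(v_k\otimes x)=(L_nv_k)\otimes x+v_k\otimes(L_nx)$, and $C$ acts as $c$. *)

(* Defs.v *)
From HB Require Import structures.
From mathcomp Require Import all_boot all_order all_algebra.
From mathcomp Require Import generic_quotient ring_quotient.
From mathcomp Require Import boolp classical_sets reals.
From mathcomp Require Import freeg complex.
From mathcomp Require Import ring zify.

Set Implicit Arguments.
Unset Strict Implicit.
Unset Printing Implicit Defensive.

Import GRing.Theory.

Local Open Scope ring_scope.
Local Open Scope quotient_scope.

Section LinearProp.
Variables (K : fieldType) (V W : lmodType K) (f : V -> W).
Hypothesis lf : linear f.

Let F : {linear V -> W} := HB.pack f (GRing.isLinear.Build K V W *:%R f lf).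

Lemma lin0 : f 0 = 0. Proof. exact: (linear0 F). Qed.
Lemma linD x y : f (x + y) = f x + f y. Proof. exact: (linearD F). Qed.
Lemma linN x : f (- x) = - f x. Proof. exact: (linearN F). Qed.
Lemma linB x y : f (x - y) = f x - f y. Proof. exact: (linearB F). Qed.
Lemma linZ a x : f (a *: x) = a *: f x. Proof. by have := lf a x 0; rewrite lin0 !addr0. Qed.

End LinearProp.

Section Span.
Variables (K : fieldType) (V : lmodType K) (A : set V).

Definition span : {pred V} := [pred x | `[< exists s : seq (K * V),
  (forall p, p \in s -> A p.2) /\ x = \sum_(p <- s) p.1 *: p.2 >]].

Lemma span_closed : submod_closed span.
Proof.
split; first by apply/asboolP; exists [::]; split => //; rewrite big_nil.
move=> a x y /asboolP[s [sA ->]] /asboolP[t [tA ->]]; apply/asboolP.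
exists ([seq (a * p.1, p.2) | p <- s] ++ t); split.
  move=> p; rewrite mem_cat => /orP[/mapP[q qs ->]|]; last exact: tA.
  exact: (sA q qs).
rewrite big_cat big_map scaler_sumr /=; congr (_ + _).
by apply: eq_bigr => p _; rewrite scalerA.
Qed.

HB.instance Definition _ := GRing.isSubmodClosed.Build K V span
  (GRing.submod_closed_semi span_closed).

Lemma sub_span x : A x -> x \in span.
Proof.
move=> Ax; apply/asboolP; exists [:: (1, x)]; split; last first.
  by rewrite big_seq1 scale1r.
by move=> p; rewrite inE => /eqP ->.
Qed.

Lemma span_min (P : V -> Prop) : P 0 ->
  (forall a x y, P x -> P y -> P (a *: x + y)) ->
  (forall x, A x -> P x) -> forall x, x \in span -> P x.
Proof.
move=> P0 PD PA x /asboolP[s [sA ->]].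
elim: s sA => [|p s IHs] sA; first by rewrite big_nil.
rewrite big_cons; apply: PD; first by apply/PA/sA; rewrite inE eqxx.
by apply: IHs => q qs; apply: sA; rewrite inE qs orbT.
Qed.

End Span.

Section LmodQuot.
Variables (K : fieldType) (V : lmodType K) (S : submodClosed V).

Definition zmod_of : {pred V} := S.
Fact zmod_of_closed : zmod_closed zmod_of.
Proof. exact: GRing.submod_closedB (submodClosedP S). Qed.
HB.instance Definition _ := GRing.isZmodClosed.Build V zmod_of zmod_of_closed.

Definition lmod_quot : Type := Quotient.quot zmod_of.
HB.instance Definition _ := GRing.Zmodule.on lmod_quot.

Definition lquot (x : V) : lmod_quot := \pi_(Quotient.quot zmod_of) x.

Lemma eq_lquot x y : lquot x = lquot y <-> x - y \in S.
Proof.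
rewrite (Quotient.idealrBE zmod_of); split=> [?|/eqP //]; exact/eqP.
Qed.

Lemma lquot_ind (P : lmod_quot -> Prop) :
  (forall x, P (lquot x)) -> forall q, P q.
Proof. by move=> Ppi q; have := Ppi (repr q); rewrite /lquot reprK. Qed.

Definition lquot_scale (a : K) (q : lmod_quot) : lmod_quot :=
  lquot (a *: repr (q : Quotient.quot zmod_of)).

Lemma lquot_scaleE a x : lquot_scale a (lquot x) = lquot (a *: x).
Proof.
apply/eq_lquot; rewrite -scalerBr rpredZ //.
by apply/eq_lquot; rewrite /lquot reprK.
Qed.

Lemma lquot_is_additive : zmod_morphism lquot.
Proof. exact: (raddfB (\pi_(Quotient.quot zmod_of))). Qed.
HB.instance Definition _ := GRing.isZmodMorphism.Build V lmod_quot lquot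
  lquot_is_additive.

Fact lquot_scaleA a b q :
  lquot_scale a (lquot_scale b q) = lquot_scale (a * b) q.
Proof. by elim/lquot_ind: q => x; rewrite !lquot_scaleE scalerA. Qed.
Fact lquot_scale1 : left_id 1 lquot_scale.
Proof. by elim/lquot_ind => x; rewrite lquot_scaleE scale1r. Qed.
Fact lquot_scaleDr : right_distributive lquot_scale +%R.
Proof.
move=> a; elim/lquot_ind=> x; elim/lquot_ind=> y.
by rewrite -raddfD !lquot_scaleE scalerDr raddfD.
Qed.
Fact lquot_scaleDl q : {morph lquot_scale^~ q : a b / a + b}.
Proof.
by elim/lquot_ind: q => x a b; rewrite !lquot_scaleE scalerDl raddfD.
Qed.
HB.instance Definition _ := GRing.Zmodule_isLmodule.Build K lmod_quot
  lquot_scaleA lquot_scale1 lquot_scaleDr lquot_scaleDl.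

Lemma lquot_is_scalable : scalable lquot.
Proof. by move=> a x; rewrite -lquot_scaleE. Qed.
HB.instance Definition _ := GRing.isScalable.Build K V lmod_quot *:%R lquot
  lquot_is_scalable.

Lemma lquot_linear : linear lquot.
Proof. exact: linearP. Qed.

(* [lquot_lift f] is the map induced by [f]; it is meaningful when [f] is
   linear and vanishes on [S]. *)
Definition lquot_lift (T : Type) (f : V -> T) (q : lmod_quot) : T :=
  f (repr (q : Quotient.quot zmod_of)).

Lemma lquot_liftE (W : lmodType K) (f : V -> W) : linear f ->
  (forall x, x \in S -> f x = 0) -> forall x, lquot_lift f (lquot x) = f x.
Proof.
move=> flin f0 x; apply/eqP; rewrite -subr_eq0 /lquot_lift -(linB flin); apply/eqP/f0.
by apply/eq_lquot; rewrite /lquot reprK.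
Qed.

Lemma lquot_lift_linear (W : lmodType K) (f : V -> W) : linear f ->
  (forall x, x \in S -> f x = 0) -> linear (lquot_lift f).
Proof.
move=> flin f0 a; elim/lquot_ind=> x; elim/lquot_ind=> y.
by rewrite -lquot_linear !lquot_liftE // flin.
Qed.

End LmodQuot.

Section LmodSub.
Variables (K : fieldType) (V : lmodType K) (S : submodClosed V).

Definition lmod_sub : Type := {x : V | x \in S}.
HB.instance Definition _ := SubChoice.on lmod_sub.
Fact lmod_sub_closed : subsemimod_closed S.
Proof.
split; first by split; [exact: rpred0 | exact: rpredD].
by move=> a x Sx; rewrite rpredZ.
Qed.
HB.instance Definition _ := GRing.SubChoice_isSubLmodule.Build K V
  (fun x => x \in S) lmod_sub lmod_sub_closed.

Definition lmod_incl (x : lmod_sub) : V := sval x.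

Lemma lmod_incl_linear : linear lmod_incl.
Proof. exact: (linearP (val : lmod_sub -> V)). Qed.

Lemma lmod_incl_inj : injective lmod_incl.
Proof. exact: val_inj. Qed.

Lemma lmod_incl_in x : lmod_incl x \in S.
Proof. exact: valP. Qed.

End LmodSub.

Section Freeg.
Variables (K : fieldType) (I : choiceType) (W : lmodType K).

Lemma fglift_linear (f : I -> W) : linear (fglift f : {freeg I / K} -> W).
Proof.
pose F := GRing.isZmodMorphism.Build _ _ (fglift f) (lift_is_additive f).
pose fF : {additive {freeg I / K} -> W} := HB.pack (fglift f) F.
move=> a x y; rewrite -[fglift f]/(fF : _ -> _) raddfD; congr (_ + _).
rewrite [a *: x]/(fgscale a x) /fgscale raddf_sum.
rewrite -[in RHS](freeg_sumE x) raddf_sum scaler_sumr.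
by apply: eq_bigr => i _; rewrite /= !liftU scalerA.
Qed.

Lemma freeg_lin_ind (P : {freeg I / K} -> Prop) : P 0 ->
  (forall a i x, P x -> P (a *: << i >> + x)) -> forall x, P x.
Proof.
move=> P0 PS; elim/freeg_ind_dom0 => // a i x _ _ /(PS a i).
suff -> : << a *g i >> = a *: << i >> :> {freeg I / K} by [].
by apply/eqP/freeg_eqP => j; rewrite coeffZ !coeffU mul1r.
Qed.

Lemma freeg_linear_eq (f g : {freeg I / K} -> W) : linear f -> linear g ->
  (forall i, f << i >> = g << i >>) -> f =1 g.
Proof.
move=> lf lg fg;
elim/freeg_lin_ind => [|a i x IH]; first by rewrite !lin0.
by rewrite lf lg fg IH.
Qed.

End Freeg.

Section Biext.
Variables (K : fieldType) (I J : choiceType) (W : lmodType K).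
Variable b : I -> J -> W.

Definition biext (x : {freeg I / K}) (y : {freeg J / K}) : W :=
  fglift (fun i => fglift (b i) y) x.

Lemma biextE i j : biext << i >> << j >> = b i j.
Proof. by rewrite /biext !liftU !scale1r. Qed.

Lemma biext_linl y : linear (biext^~ y).
Proof. exact: fglift_linear. Qed.

Lemma biext_linr x : linear (biext x).
Proof.
move=> a y z; pose g u := a *: biext u y + biext u z.
apply: (@freeg_linear_eq _ _ _ (biext^~ (a *: y + z)) g).
- exact: biext_linl.
- move=> c u v; rewrite /g !biext_linl !scalerDr !scalerA.
  by rewrite [c * a]mulrC addrACA.
- by move=> i; rewrite /g /biext !liftU !scale1r fglift_linear.
Qed.

End Biext.

Section Tensor.
Variables (K : fieldType) (V W : lmodType K).

Variant tensor_rel : set {freeg (V * W) / K} :=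
| TensorRelL a x y z : tensor_rel
    (<< (a *: x + y, z) >> - (a *: << (x, z) >> + << (y, z) >>))
| TensorRelR a x y z : tensor_rel
    (<< (x, a *: y + z) >> - (a *: << (x, y) >> + << (x, z) >>)).

Definition tensor : Type := lmod_quot (span tensor_rel).
HB.instance Definition _ := GRing.Lmodule.on tensor.

Definition tens (x : V) (y : W) : tensor :=
  lquot (span tensor_rel) << (x, y) >>.

Lemma tens_linl y : linear (tens^~ y).
Proof.
move=> a x z; rewrite /tens -(lquot_linear (span tensor_rel)).
exact/eq_lquot/sub_span/TensorRelL.
Qed.

Lemma tens_linr x : linear (tens x).
Proof.
move=> a y z; rewrite /tens -(lquot_linear (span tensor_rel)).
exact/eq_lquot/sub_span/TensorRelR.
Qed.

Lemma tensor_ind (P : tensor -> Prop) : P 0 ->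
  (forall a x y t, P t -> P (a *: tens x y + t)) -> forall t, P t.
Proof.
move=> P0 PS; elim/lquot_ind; elim/freeg_lin_ind => [|a [x y] t Pt].
  by rewrite raddf0.
by rewrite lquot_linear; apply: PS.
Qed.

(* [tensor_lift f] is the map induced by [f]; it is meaningful when [f] is
   bilinear. *)
Definition tensor_lift (U : lmodType K) (f : V -> W -> U) : tensor -> U :=
  lquot_lift (fglift (fun p => f p.1 p.2)).

Section Lift.
Variables (U : lmodType K) (f : V -> W -> U).
Hypotheses (fl : forall y, linear (f^~ y)) (fr : forall x, linear (f x)).

Let f0 x : x \in span tensor_rel -> fglift (fun p => f p.1 p.2) x = 0.
Proof.
have gl := fglift_linear (fun p => f p.1 p.2).
move: x; apply: span_min.
- exact: lin0.
- by move=> a u v xE yE; rewrite gl xE yE scaler0 addr0.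
- by move=> _ [] a u v w; rewrite linB // gl !liftU !scale1r /= (fl, fr) subrr.
Qed.

Lemma tensor_liftE x y : tensor_lift f (tens x y) = f x y.
Proof.
by rewrite /tensor_lift lquot_liftE ?liftU ?scale1r //; apply: fglift_linear.
Qed.

Lemma tensor_lift_linear : linear (tensor_lift f).
Proof. by apply: lquot_lift_linear f0; apply: fglift_linear. Qed.

End Lift.
End Tensor.

HB.mixin Record isLieAlgebra (K : fieldType) g of GRing.Lmodule K g := {
  bracket : g -> g -> g;
  bracket_linl : forall y, linear (bracket^~ y);
  bracket_linr : forall x, linear (bracket x);
  bracketxx : forall x, bracket x x = 0;
  bracket_jacobi : forall x y z, bracket x (bracket y z) +
    bracket y (bracket z x) + bracket z (bracket x y) = 0
}.

#[short(type="lieAlgType")]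
HB.structure Definition LieAlgebra (K : fieldType) :=
  {g of GRing.Lmodule K g & isLieAlgebra K g}.

HB.mixin Record isLieModule (K : fieldType) (g : lieAlgType K) M
    of GRing.Lmodule K M := {
  act : g -> M -> M;
  act_linl : forall m, linear (act^~ m);
  act_linr : forall x, linear (act x);
  act_bracket : forall x y m,
    act (bracket x y) m = act x (act y m) - act y (act x m)
}.

#[short(type="lieModType")]
HB.structure Definition LieModule (K : fieldType) (g : lieAlgType K) :=
  {M of GRing.Lmodule K M & isLieModule K g M}.

HB.mixin Record isActStable (K : fieldType) (g : lieAlgType K)
    (M : lieModType g) (S : M -> bool) := {
  act_stable : forall (x : g) (m : M), m \in S -> act x m \in S
}.

#[short(type="lieSubmod")]
HB.structure Definition LieSubmod (K : fieldType) (g : lieAlgType K)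
    (M : lieModType g) :=
  {S of Algebra.isAddClosed M S & GRing.isScaleClosed K M S & isActStable K g M S}.

Section LieModuleTheory.
Variables (K : fieldType) (g : lieAlgType K).

Section Quot.
Variables (M : lieModType g) (S : lieSubmod M).

Definition lie_quot : Type := lmod_quot S.
HB.instance Definition _ := GRing.Lmodule.on lie_quot.

Definition lie_proj (m : M) : lie_quot := lquot S m.

Lemma lie_proj_linear : linear lie_proj.
Proof. exact: lquot_linear. Qed.

Lemma eq_lie_proj m n : lie_proj m = lie_proj n <-> m - n \in S.
Proof. exact: eq_lquot. Qed.

Lemma lie_quot_ind (P : lie_quot -> Prop) :
  (forall m, P (lie_proj m)) -> forall q, P q.
Proof. exact: lquot_ind. Qed.

Definition lie_quot_act (x : g) : lie_quot -> lie_quot :=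
  lquot_lift (fun m => lie_proj (act x m)).

Let act_lin x : linear (fun m => lie_proj (act x m)).
Proof. by move=> a m n; rewrite act_linr lie_proj_linear. Qed.

Let act_kill x m : m \in S -> lie_proj (act x m) = 0.
Proof.
move=> Sm; rewrite -(lin0 lie_proj_linear); apply/eq_lie_proj.
by rewrite subr0 act_stable.
Qed.

Lemma lie_quot_actE x m : lie_quot_act x (lie_proj m) = lie_proj (act x m).
Proof. by apply: lquot_liftE; [exact: act_lin | exact: act_kill]. Qed.

Fact lie_quot_linr x : linear (lie_quot_act x).
Proof. by apply: lquot_lift_linear; [exact: act_lin | exact: act_kill]. Qed.
Fact lie_quot_linl q : linear (lie_quot_act^~ q).
Proof.
elim/lquot_ind: q => m a x y; rewrite !lie_quot_actE act_linl.
exact: lquot_linear.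
Qed.
Fact lie_quot_bracket x y q : lie_quot_act (bracket x y) q =
  lie_quot_act x (lie_quot_act y q) - lie_quot_act y (lie_quot_act x q).
Proof.
elim/lie_quot_ind: q => m.
by rewrite !lie_quot_actE act_bracket (linB lie_proj_linear).
Qed.
HB.instance Definition _ := isLieModule.Build K g lie_quot
  lie_quot_linl lie_quot_linr lie_quot_bracket.

End Quot.

Section Sub.
Variables (M : lieModType g) (S : lieSubmod M).

Definition lie_sub : Type := lmod_sub S.
HB.instance Definition _ := GRing.Lmodule.on lie_sub.

Definition lie_incl (m : lie_sub) : M := lmod_incl m.

Lemma lie_incl_linear : linear lie_incl.
Proof. exact: lmod_incl_linear. Qed.

Lemma lie_incl_inj : injective lie_incl.
Proof. exact: lmod_incl_inj. Qed.

Lemma lie_incl_in m : lie_incl m \in S.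
Proof. exact: lmod_incl_in. Qed.

Definition lie_sub_act (x : g) (m : lie_sub) : lie_sub :=
  exist _ (act x (lie_incl m)) (act_stable (s := S) x _ (lie_incl_in m)).

Lemma lie_sub_actE x m : lie_incl (lie_sub_act x m) = act x (lie_incl m).
Proof. by []. Qed.

Fact lie_sub_linl m : linear (lie_sub_act^~ m).
Proof.
move=> a x y; apply: lie_incl_inj.
by rewrite lie_incl_linear !lie_sub_actE act_linl.
Qed.
Fact lie_sub_linr x : linear (lie_sub_act x).
Proof.
move=> a m n; apply: lie_incl_inj.
by rewrite lie_incl_linear !lie_sub_actE lie_incl_linear act_linr.
Qed.
Fact lie_sub_bracket x y m : lie_sub_act (bracket x y) m =
  lie_sub_act x (lie_sub_act y m) - lie_sub_act y (lie_sub_act x m).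
Proof.
apply: lie_incl_inj.
by rewrite (linB lie_incl_linear) !lie_sub_actE act_bracket.
Qed.
HB.instance Definition _ := isLieModule.Build K g lie_sub
  lie_sub_linl lie_sub_linr lie_sub_bracket.

End Sub.

Section TensorModule.
Variables M N : lieModType g.

Definition lie_tensor : Type := tensor M N.
HB.instance Definition _ := GRing.Lmodule.on lie_tensor.

Definition tensor_act (x : g) : lie_tensor -> lie_tensor :=
  tensor_lift (fun (m : M) (n : N) => tens (act x m) n + tens m (act x n)).

Let fl (x : g) (n : N) : linear (fun m : M => tens (act x m) n + tens m (act x n)).
Proof.
by move=> a m m'; rewrite act_linr !tens_linl scalerDr addrACA.
Qed.
Let fr (x : g) (m : M) : linear (fun n : N => tens (act x m) n + tens m (act x n)).
Proof.
by move=> a n n'; rewrite act_linr !tens_linr scalerDr addrACA.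
Qed.

Lemma tensor_actE x (m : M) (n : N) : tensor_act x (tens m n) =
  tens (act x m) n + tens m (act x n).
Proof. by apply: tensor_liftE; [exact: fl | exact: fr]. Qed.

Fact tensor_act_linr x : linear (tensor_act x).
Proof. by apply: tensor_lift_linear; [exact: fl | exact: fr]. Qed.

Let act0 x : tensor_act x 0 = 0.
Proof. exact: lin0 (tensor_act_linr x). Qed.

Fact tensor_act_linl t : linear (tensor_act^~ t).
Proof.
elim/tensor_ind: t => [|b m n t IH] a x y.
  by rewrite !act0 scaler0 addr0.
rewrite !tensor_act_linr IH !tensor_actE !act_linl tens_linl tens_linr.
rewrite [X in b *: X]addrACA -scalerDr [LHS]addrC [b *: (_ + _)]scalerDr.
by rewrite scalerA mulrC -scalerA addrACA -scalerDr ![_ + b *: _]addrC.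
Qed.
Fact tensor_act_bracket x y t : tensor_act (bracket x y) t =
  tensor_act x (tensor_act y t) - tensor_act y (tensor_act x t).
Proof.
elim/tensor_ind: t => [|b m n t IH]; first by rewrite !act0 subr0.
rewrite !tensor_act_linr IH !tensor_actE !(linD (tensor_act_linr _)).
rewrite !tensor_actE !act_bracket.
rewrite !(linB (tens_linl _)) !(linB (tens_linr _)).
rewrite [in RHS]opprD [RHS]addrACA -scalerBr; congr (_ *: _ + _).
set A := tens (act x (act y m)) n; set B := tens (act y (act x m)) n.
set C := tens m (act x (act y n)); set D := tens m (act y (act x n)).
set E := tens (act y m) (act x n); set F := tens (act x m) (act y n).
rewrite [A + E + _](AC (2*2) (1*4*(2*3))) [B + F + _](AC (2*2) (1*4*(3*2))).
by rewrite [in RHS]opprD [RHS]addrACA subrr addr0 [in RHS]opprD [RHS]addrACA.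
Qed.
HB.instance Definition _ := isLieModule.Build K g lie_tensor
  tensor_act_linl tensor_act_linr tensor_act_bracket.

End TensorModule.

(* The tensor algebra of [g] is presented as the span of the words in elements
   of [g] modulo multilinearity. *)
Variant enveloping_rel : set {freeg (seq g) / K} :=
| EnvelopingLinear u v a x y : enveloping_rel
    (<< u ++ (a *: x + y) :: v >> -
       (a *: << u ++ x :: v >> + << u ++ y :: v >>))
| EnvelopingBracket u v x y : enveloping_rel
    (<< u ++ [:: x, y & v] >> - << u ++ [:: y, x & v] >> -
       << u ++ bracket x y :: v >>).

Definition enveloping : Type := lmod_quot (span enveloping_rel).
HB.instance Definition _ := GRing.Lmodule.on enveloping.

Definition env_word (w : seq g) : enveloping :=
  lquot (span enveloping_rel) << w >>.

Definition env_act (x : g) : enveloping -> enveloping :=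
  lquot_lift (fglift (fun w => env_word (x :: w))).

Lemma env_ind (P : enveloping -> Prop) : P 0 ->
  (forall a w u, P u -> P (a *: env_word w + u)) -> forall u, P u.
Proof.
move=> P0 PS; elim/lquot_ind; elim/freeg_lin_ind => [|a w t Pt].
  by rewrite raddf0.
by rewrite lquot_linear; apply: PS.
Qed.

Lemma env_word_linear u v : linear (fun x => env_word (u ++ x :: v)).
Proof.
move=> a x y; rewrite /env_word -(lquot_linear (span enveloping_rel)).
exact/eq_lquot/sub_span/EnvelopingLinear.
Qed.

Lemma env_word_bracket u v x y : env_word (u ++ bracket x y :: v) =
  env_word (u ++ [:: x, y & v]) - env_word (u ++ [:: y, x & v]).
Proof.
rewrite /env_word -(linB (lquot_linear (span enveloping_rel))).
exact/esym/eq_lquot/sub_span/EnvelopingBracket.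
Qed.

Lemma env_lift_kill (W : lmodType K) (f : seq g -> W) :
  (forall u v, linear (fun x => f (u ++ x :: v))) ->
  (forall u v x y, f (u ++ bracket x y :: v) =
     f (u ++ [:: x, y & v]) - f (u ++ [:: y, x & v])) ->
  forall t, t \in span enveloping_rel -> fglift f t = 0.
Proof.
move=> flin fbr; have lf := fglift_linear f; apply: span_min.
- exact: lin0.
- by move=> a s t sE tE; rewrite lf sE tE scaler0 addr0.
- move=> _ [u v a x y|u v x y].
    by rewrite (linB lf) lf !liftU !scale1r flin subrr.
  by rewrite !(linB lf) !liftU !scale1r fbr subrr.
Qed.

Let env_act_kill x t : t \in span enveloping_rel ->
  fglift (fun w => env_word (x :: w)) t = 0.
Proof.
move: t; apply: env_lift_kill => u v; first exact: (env_word_linear (x :: u)).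
by move=> y z; apply: (env_word_bracket (x :: u)).
Qed.

Lemma env_act_word x w : env_act x (env_word w) = env_word (x :: w).
Proof.
rewrite /env_act lquot_liftE ?liftU ?scale1r //; first exact: fglift_linear.
exact: env_act_kill.
Qed.

Fact env_act_linr x : linear (env_act x).
Proof.
by apply: lquot_lift_linear; [exact: fglift_linear | exact: env_act_kill].
Qed.

Fact env_act_linl u : linear (env_act^~ u).
Proof.
elim/env_ind: u => [|b w u IH] a x y.
  by rewrite !(lin0 (env_act_linr _)) scaler0 addr0.
rewrite !env_act_linr IH !env_act_word (env_word_linear [::]).
by rewrite [in RHS]scalerDr scalerDr !scalerA [b * a]mulrC addrACA.
Qed.

Fact env_act_bracket x y u : env_act (bracket x y) u =
  env_act x (env_act y u) - env_act y (env_act x u).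
Proof.
elim/env_ind: u => [|b w u IH]; first by rewrite !(lin0 (env_act_linr _)) subr0.
rewrite !env_act_linr IH !env_act_word (env_word_bracket [::]).
by rewrite scalerBr [in RHS]opprD [RHS]addrACA.
Qed.

HB.instance Definition _ := isLieModule.Build K g enveloping
  env_act_linl env_act_linr env_act_bracket.

Section Eval.
Variable M : lieModType g.

Definition env_eval (u : enveloping) (m : M) : M :=
  lquot_lift (fglift (fun w => foldr act m w)) u.

Let env_eval_kill m t : t \in span enveloping_rel ->
  fglift (fun w => foldr (@act K g M) m w) t = 0.
Proof.
move: t; apply: env_lift_kill => u v.
  move=> a x y; rewrite !foldr_cat /= act_linl.
  by elim: u => //= z u ->; rewrite act_linr.
move=> x y; rewrite !foldr_cat /= act_bracket.
by elim: u => //= z u ->; rewrite (linB (act_linr z)).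
Qed.

Lemma env_eval_word w m : env_eval (env_word w) m = foldr act m w.
Proof.
rewrite /env_eval lquot_liftE ?liftU ?scale1r //; first exact: fglift_linear.
exact: env_eval_kill.
Qed.

Lemma env_eval_linl m : linear (env_eval^~ m).
Proof.
by apply: lquot_lift_linear; [exact: fglift_linear | exact: env_eval_kill].
Qed.

Lemma env_eval_act x u m : env_eval (act x u) m = act x (env_eval u m).
Proof.
elim/env_ind: u => [|a w u IH].
  rewrite (lin0 (act_linr x)) !(lin0 (env_eval_linl m)).
  by rewrite (lin0 (act_linr x)).
rewrite act_linr !env_eval_linl IH act_linr; congr (_ *: _ + _).
by rewrite [act x _]env_act_word !env_eval_word.
Qed.

Definition submod_gen (A : set M) : {pred M} :=
  span [set n | exists u m, A m /\ n = env_eval u m].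

Section Gen.
Variable A : set M.

HB.instance Definition _ := GRing.isSubmodClosed.Build K M (submod_gen A)
  (GRing.submod_closed_semi (span_closed _)).

Fact submod_gen_stable (x : g) (m : M) :
  m \in submod_gen A -> act x m \in submod_gen A.
Proof.
move: m; apply: span_min; first by rewrite (lin0 (act_linr x)) rpred0.
  by move=> a m n mA nA; rewrite act_linr rpredD // rpredZ.
move=> _ [u [m [Am ->]]]; apply: sub_span; exists (act x u), m.
by rewrite env_eval_act.
Qed.
HB.instance Definition _ := isActStable.Build K g M (submod_gen A)
  submod_gen_stable.

Lemma submod_gen_sub m : A m -> m \in submod_gen A.
Proof.
by move=> Am; apply: sub_span; exists (env_word [::]), m; rewrite env_eval_word.
Qed.

End Gen.

Definition lie_irreducible : Prop := (exists m : M, m != 0) /\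
  forall S : lieSubmod M,
    (forall m : M, m \in S -> m = 0) \/ (forall m : M, m \in S).

(* The union of the proper submodules need not be closed under addition: the
   submodule it generates is the sum of all of them. *)
Definition proper_sum : {pred M} :=
  submod_gen [set m | exists2 S : lieSubmod M, exists n : M, n \notin S
                                             & m \in S].
Arguments proper_sum : clear implicits.
HB.instance Definition _ := LieSubmod.on proper_sum.

End Eval.

Definition lie_iso (M N : lieModType g) : Prop := exists f : M -> N,
  [/\ linear f, bijective f & forall (x : g) (m : M), f (act x m) = act x (f m)].

End LieModuleTheory.

Arguments lie_irreducible {K g} M.
Arguments proper_sum {K g} M.

Definition virasoro (K : fieldType) : Type := {freeg (option int) / K}.
HB.instance Definition _ (K : fieldType) := GRing.Lmodule.on (virasoro K).

Section Virasoro.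
Variable K : fieldType.
Local Notation Vir := (virasoro K).

Definition virL (n : int) : Vir := << Some n >>.
Definition virC : Vir := << None >>.

Definition vir_br (i j : option int) : Vir :=
  match i, j with
  | Some n, Some m => (n - m)%:~R *: virL (n + m) +
      (if m == - n then (n ^+ 3 - n)%:~R / 12%:R else 0) *: virC
  | _, _ => 0
  end.

Definition vir_bracket : Vir -> Vir -> Vir := biext vir_br.

Fact vir_linl y : linear (vir_bracket^~ y).
Proof. exact: biext_linl. Qed.
Fact vir_linr x : linear (vir_bracket x).
Proof. exact: biext_linr. Qed.

Let vir_ind (P : Vir -> Prop) : P 0 ->
  (forall a i x, P x -> P (a *: (<< i >> : Vir) + x)) -> forall x, P x.
Proof. exact: freeg_lin_ind. Qed.

Let br0 x : vir_bracket x 0 = 0. Proof. exact: lin0 (vir_linr x). Qed.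
Let b0r x : vir_bracket 0 x = 0. Proof. exact: lin0 (vir_linl x). Qed.
Let brE i j : vir_bracket << i >> << j >> = vir_br i j.
Proof. exact: biextE. Qed.

Fact vir_antisym x y : vir_bracket x y = - vir_bracket y x.
Proof.
elim/vir_ind: x y => [|a i x IHx] y; first by rewrite br0 b0r oppr0.
rewrite vir_linl vir_linr IHx opprD -scalerN; congr (_ *: _ + _).
elim/vir_ind: y => [|b j y IHy]; first by rewrite br0 b0r oppr0.
rewrite vir_linl vir_linr IHy opprD -scalerN !brE; congr (_ *: _ + _).
case: i j {IHx IHy} => [n|] [m|] //=; rewrite ?oppr0 // opprD -!scaleNr [m + n]addrC.
congr (_ *: _ + _ *: _); first by rewrite -rmorphN opprB.
rewrite [n == - m]eq_sym eqr_oppLR; case: eqP => [->|_]; last by rewrite oppr0.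
by rewrite -mulNr -rmorphN /=; congr (_%:~R / _); ring.
Qed.

Fact vir_bracketxx x : vir_bracket x x = 0.
Proof.
elim/vir_ind: x => [|a i x IH]; first exact: br0.
rewrite vir_linl !vir_linr IH [vir_bracket x << i >>]vir_antisym.
have -> : vir_bracket << i >> << i >> = 0.
  rewrite brE; case: i => [n|] //=; rewrite subrr scale0r add0r.
  case: eqP => [nE|_]; last by rewrite scale0r.
  have -> : n = 0 by lia.
  by rewrite expr0n subrr mul0r scale0r.
by rewrite scaler0 add0r addr0 scalerN subrr.
Qed.

Let jac x y z := vir_bracket x (vir_bracket y z) +
  vir_bracket y (vir_bracket z x) + vir_bracket z (vir_bracket x y).

Let jac_cycle x y z : jac x y z = jac y z x.
Proof. by rewrite /jac -addrA addrC. Qed.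

Let jac_ind y z : (forall i, jac << i >> y z = 0) -> forall x, jac x y z = 0.
Proof.
move=> j0; elim/vir_ind => [|a i x IH].
  by rewrite /jac !(br0, b0r) !addr0.
have -> : jac (a *: << i >> + x) y z = a *: jac << i >> y z + jac x y z.
  rewrite /jac !(vir_linl, vir_linr) !scalerDr.
  by rewrite [RHS]addrACA [X in _ = X + _]addrACA.
by rewrite j0 scaler0 add0r.
Qed.

Let jac_basis i j k : jac << i >> << j >> << k >> = 0.
Proof.
have bC x : vir_bracket x virC = 0.
  elim/vir_ind: x => [|a [l|] x IH]; first exact: b0r.
    by rewrite vir_linl IH brE scaler0 addr0.
  by rewrite vir_linl IH brE scaler0 addr0.
have brs n m l : vir_bracket << Some n >> (vir_br (Some m) (Some l)) =
    ((m - l) * (n - (m + l)))%:~R *: virL (n + (m + l)) +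
    (if n + m + l == 0 then ((m - l) * (n ^+ 3 - n))%:~R / 12%:R else 0) *: virC.
  rewrite /= vir_linr (linZ (vir_linr _)) bC scaler0 addr0 brE /=.
  rewrite scalerDr !scalerA -intrM; congr (_ *: _ + _ *: _).
  have -> : (m + l == - n) = (n + m + l == 0) by apply/eqP/eqP; lia.
  by case: ifP => _; rewrite ?mulr0 // intrM mulrA.
have Cb x : vir_bracket virC x = 0 by rewrite vir_antisym bC oppr0.
have brN a b : vir_bracket << a >> (vir_br b None) = 0 by case: b.
have brN' a b : vir_bracket << a >> (vir_br None b) = 0 by rewrite br0.
have NbrE b : vir_bracket << None >> b = 0 by exact: Cb.
rewrite /jac !brE; case: i => [n|]; last first.
  by rewrite NbrE brN brN' !addr0.
case: j => [m|]; last by rewrite NbrE brN brN' !addr0.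
case: k => [l|]; last by rewrite NbrE brN brN' !addr0.
rewrite !brs.
have -> : m + (l + n) = n + (m + l) by ring.
have -> : l + (n + m) = n + (m + l) by ring.
have -> : m + l + n = n + m + l by ring.
have -> : l + n + m = n + m + l by ring.
have ac (p q r s t u : Vir) : p + q + (r + s) + (t + u) = p + r + t + (q + s + u).
  by rewrite [RHS]addrACA [X in _ = X + _]addrACA.
rewrite ac -!scalerDl -!intrD.
set a := (X in X%:~R *: _); have -> : a = 0 by rewrite /a; ring.
rewrite scale0r add0r; case: eqP => [E|_]; last by rewrite !addr0 scale0r.
rewrite -!mulrDl -!intrD; set b := (X in X%:~R / _).
have lE : l = - n - m by lia.
have -> : b = 0 by rewrite /b lE; ring.
by rewrite mul0r scale0r.
Qed.

Fact vir_jacobi x y z : vir_bracket x (vir_bracket y z) +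
  vir_bracket y (vir_bracket z x) + vir_bracket z (vir_bracket x y) = 0.
Proof.
rewrite -/(jac x y z); move: x; apply: jac_ind => i; rewrite jac_cycle; apply: jac_ind => j.
by rewrite jac_cycle; apply: jac_ind => k; rewrite jac_cycle jac_basis.
Qed.

HB.instance Definition _ := isLieAlgebra.Build K Vir
  vir_linl vir_linr vir_bracketxx vir_jacobi.

Lemma virLL (n m : int) : bracket (virL n) (virL m) =
  (n - m)%:~R *: virL (n + m) +
    (if m == - n then (n ^+ 3 - n)%:~R / 12%:R else 0) *: virC.
Proof. exact: brE. Qed.

Lemma virCx (x : Vir) : bracket virC x = 0.
Proof.
rewrite [LHS]vir_antisym; elim/vir_ind: x => [|a [l|] x IH].
- by rewrite b0r oppr0.
- by rewrite vir_linl opprD IH addr0 brE scaler0 oppr0.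
- by rewrite vir_linl opprD IH addr0 brE scaler0 oppr0.
Qed.

(* [V(c,h)] is the quotient of [U(Vir)] by the left ideal generated by
   [C - c], [L_0 - h] and the [L_n] with [n > 0]. *)
Variant verma_rel (c h : K) : set (enveloping Vir) :=
| VermaC : verma_rel c h (env_word [:: virC] - c *: env_word [::])
| VermaL0 : verma_rel c h (env_word [:: virL 0] - h *: env_word [::])
| VermaL n : (0 < n)%R -> verma_rel c h (env_word [:: virL n]).

Definition verma (c h : K) : lieModType Vir :=
  lie_quot (submod_gen (verma_rel c h)).

Definition verma_hw (c h : K) : verma c h := lie_proj _ (env_word [::]).

(* The proper submodules of [V(c,h)] have a proper sum, which is therefore its
   largest proper submodule. *)
Definition Lirr (c h : K) : lieModType Vir := lie_quot (proper_sum (verma c h)).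

Definition Lirr_hw (c h : K) : Lirr c h := lie_proj _ (verma_hw c h).

(* The underlying space of [V_{alpha,beta}] does not depend on the parameters,
   but its module structure does, so they are recorded in its type. *)
Definition inter (alpha beta : K) : Type := {freeg int / K}.
HB.instance Definition _ alpha beta :=
  GRing.Lmodule.on (inter alpha beta).

Section Intermediate.
Variables alpha beta : K.
Local Notation V := (inter alpha beta).


Definition inter_v (m : int) : V := << m >>.

Definition inter_br (i : option int) (m : int) : V :=
  if i is Some n
  then - (m%:~R + alpha + beta + n%:~R * beta) *: inter_v (m + n) else 0.

Definition inter_act : Vir -> V -> V := biext inter_br.

Fact inter_linl m : linear (inter_act^~ m).
Proof. exact: biext_linl. Qed.
Fact inter_linr x : linear (inter_act x).
Proof. exact: biext_linr. Qed.

Let inter_ind (P : V -> Prop) : P 0 ->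
  (forall a m x, P x -> P (a *: inter_v m + x)) -> forall x, P x.
Proof. exact: freeg_lin_ind. Qed.

Let actE i m : inter_act << i >> (inter_v m) = inter_br i m.
Proof. exact: biextE. Qed.

Let act0r m : inter_act 0 m = 0. Proof. exact: lin0 (inter_linl m). Qed.
Let actr0 x : inter_act x 0 = 0. Proof. exact: lin0 (inter_linr x). Qed.

Let act_basis i j m : inter_act (vir_br i j) (inter_v m) =
  inter_act << i >> (inter_br j m) - inter_act << j >> (inter_br i m).
Proof.
have CE x : inter_act virC x = 0.
  by elim/inter_ind: x => [|a k x IH]; rewrite ?actr0 // inter_linr IH actE
    scaler0 addr0.
have NE x : inter_act << None >> x = 0 by exact: CE.
case: i => [n|]; last by rewrite NE act0r actr0 subr0.
case: j => [k|]; last by rewrite NE act0r actr0 subr0.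
rewrite /vir_br inter_linl (linZ (inter_linl _)) CE scaler0 addr0 actE.
rewrite /inter_br !(linZ (inter_linr _)) !actE /inter_br !scalerA.
have -> : m + k + n = m + (n + k) by ring.
have -> : m + n + k = m + (n + k) by ring.
by rewrite -scalerBl; congr (_ *: _); rewrite !intrD; ring.
Qed.

Let act_gen x y m : inter_act (vir_bracket x y) (inter_v m) =
  inter_act x (inter_act y (inter_v m)) - inter_act y (inter_act x (inter_v m)).
Proof.
elim/vir_ind: x y => [|a i x IHx] y; first by rewrite b0r !act0r actr0 subr0.
rewrite vir_linl !inter_linl inter_linr IHx.
rewrite [in RHS]opprD [RHS]addrACA -scalerBr; congr (_ *: _ + _).
elim/vir_ind: y => [|b j y IHy]; first by rewrite br0 !act0r actr0 subr0.
rewrite vir_linr !inter_linl inter_linr IHy.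
rewrite [in RHS]opprD [RHS]addrACA -scalerBr; congr (_ *: _ + _).
by rewrite brE act_basis !actE.
Qed.

Fact inter_bracket x y m : inter_act (bracket x y) m =
  inter_act x (inter_act y m) - inter_act y (inter_act x m).
Proof.
elim/inter_ind: m => [|a k m IH]; first by rewrite !actr0 subr0.
rewrite !inter_linr IH.
rewrite [in RHS]opprD [RHS]addrACA -scalerBr; congr (_ *: _ + _).
exact: act_gen.
Qed.
HB.instance Definition _ := isLieModule.Build K Vir V
  inter_linl inter_linr inter_bracket.

Lemma act_interE (i : option int) (m : int) :
  act (<< i >> : Vir) (inter_v m) = inter_br i m.
Proof. exact: actE. Qed.

Lemma inter_span_stable (A : set V) :
  (forall i v, A v -> act (<< i >> : Vir) v \in span A) ->
  forall (x : Vir) (v : V), v \in span A -> act x v \in span A.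
Proof.
move=> stA x; elim/vir_ind: x => [|a i x IH] v vA.
  by rewrite (lin0 (act_linl v)) rpred0.
rewrite act_linl rpredD ?IH // rpredZ //; move: v vA.
apply: span_min; first by rewrite (lin0 (act_linr _)) rpred0.
  by move=> b u v uA vA; rewrite act_linr rpredD // rpredZ.
exact: stA.
Qed.

End Intermediate.

Definition inter00_line : {pred inter 0 0} := span [set inter_v 0 0 0].
HB.instance Definition _ := GRing.SubmodClosed.on inter00_line.

Fact inter00_line_stable (x : Vir) (m : inter 0 0) :
  m \in inter00_line -> act x m \in inter00_line.
Proof.
apply: inter_span_stable => -[n|] _ ->; rewrite act_interE /= ?rpred0 //.
by rewrite !addr0 mulr0 addr0 oppr0 scale0r rpred0.
Qed.
HB.instance Definition _ := isActStable.Build K Vir (inter 0 0) inter00_line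
  inter00_line_stable.

Definition inter01_sub : {pred inter 0 1} :=
  span [set v | exists2 m : int, m != -1 & v = inter_v 0 1 m].
HB.instance Definition _ := GRing.SubmodClosed.on inter01_sub.

Fact inter01_sub_stable (x : Vir) (m : inter 0 1) :
  m \in inter01_sub -> act x m \in inter01_sub.
Proof.
apply: inter_span_stable => -[n|] _ [k _ ->]; rewrite act_interE /= ?rpred0 //.
have [kn|kn] := eqVneq (k + n) (-1); last first.
  by apply/rpredZ/sub_span; exists (k + n).
have -> : n = - 1 - k by rewrite -kn; ring.
rewrite rmorphB rmorphN /= (_ : _ + 0 + 1 + _ = 0) ?oppr0 ?scale0r ?rpred0 //.
by ring.
Qed.
HB.instance Definition _ := isActStable.Build K Vir (inter 0 1) inter01_sub
  inter01_sub_stable.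

Section Vprime.
Variables alpha beta : K.

Definition Vprime_case (is00 is01 : bool) : lieModType Vir :=
  if is00 return lieModType Vir then lie_quot inter00_line
  else if is01 return lieModType Vir then lie_sub inter01_sub
  else inter alpha beta.

Definition Vprime : lieModType Vir :=
  Vprime_case ((alpha == 0) && (beta == 0)) ((alpha == 0) && (beta == 1)).

Definition Vprime_case_v (m : int) (is00 is01 : bool) : Vprime_case is00 is01 :=
  match is00, is01 with
  | true, _ => lie_proj inter00_line (inter_v 0 0 m)
  | false, true => insubd (0 : lmod_sub inter01_sub) (inter_v 0 1 m)
  | false, false => inter_v alpha beta m
  end.

(* The (class of the) vector [v_m]; it is [0] for [m = -1] in [V'_{0,1}], where
   there is no such vector. *)
Definition Vprime_v (m : int) : Vprime := Vprime_case_v m _ _.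

End Vprime.
End Virasoro.

(* Main.v *)
(** Put c = -22/5, h = -1/5 and write L(c,h) for the irreducible module.  Two
    null vectors are used: (L_(-2)^2 - 3/5 L_(-4)) v = 0 in L(c,0) and
    (L_(-1)^2 - 2/5 L_(-2)) phi = 0 in L(c,h).

    A nonzero submodule of the tensor product contains v_m (x) v for all large
      m:
    applying L_n with n large only moves the first factor, which separates the
    terms of an element by their index.  For alpha not an integer L_(-1) then
    reaches every m; for alpha = 0 it stops at m = 0, and the null vector of
    L(c,0) gives (1 - beta)(6/5 - beta) v_(-1) (x) v modulo the v_m (x) v with
    m >= 0.

    In the exceptional case, Hom(V_(0,6/5), L(c,h)) contains the primary field
    sending v_(-1-k) to L_(-1)^k phi / k! and the v_m with m >= 0 to 0.  It is
    annihilated by the L_n with n >= 0, so it defines a map from the Verma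
    module V(c,0).  The null vector of L(c,h) forces the degree d of a singular
    vector with nonzero image to satisfy d (d + 1/5) = 0, so the map factors
    through L(c,0); this shows that U_0 is proper.  For the irreducibility of
    the quotient Q by U_0, let S_n be the modes of the field of the null vector
    of L(c,0).  They satisfy [L_m, S_n] = (3 m - n) S_(m+n),
      and the null vectors
    of Q at levels 2 and 3 give inductively S_n q = 0 for its highest weight
    vector q, hence S_n = 0 on Q.  On a singular vector S_0 is L_0 (L_0 + 1/5),
    and the weights of Q lie in -1/5 + N, so every singular vector is a
    multiple of q.

    Verma modules are shown to be nonzero by letting Vir act on the enveloping
    algebra of its negative part, which avoids the Poincare-Birkhoff-Witt
    theorem. *)
From Pilot Require Import Defs.
From HB Require Import structures.
From mathcomp Require Import all_boot all_order all_algebra.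
From mathcomp Require Import boolp classical_sets functions reals complex freeg.
From mathcomp Require Import ring zify.

Set Implicit Arguments.
Unset Strict Implicit.
Unset Printing Implicit Defensive.

Import GRing.Theory Num.Theory Order.TTheory.
(* [vector] also defines [span] and [sub_span]. *)
Import Pilot.Defs.

Local Open Scope ring_scope.

(** * Equalities of linear combinations by reflection *)

Section LinearCombination.
Variables (K : fieldType) (V : lmodType K).

Inductive lterm : Type :=
  | LVar of nat | LZero | LAdd of lterm & lterm | LOpp of lterm
  | LScale of K & lterm | LMuln of lterm & nat.

Fixpoint leval (env : seq V) (t : lterm) : V :=
  match t with
  | LVar i => env`_i
  | LZero => 0
  | LAdd s t => leval env s + leval env t
  | LOpp t => - leval env t
  | LScale a t => a *: leval env t
  | LMuln t n => leval env t *+ n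
  end.

Fixpoint lunit (i j : nat) : K :=
  match i, j with
  | 0%N, 0%N => 1
  | i'.+1, j'.+1 => lunit i' j'
  | _, _ => 0
  end.

Lemma lunitE i j : lunit i j = (i == j)%:R.
Proof. by elim: i j => [|i IH] [|j] //=; rewrite IH. Qed.

Fixpoint lcoef (t : lterm) (j : nat) : K :=
  match t with
  | LVar i => lunit i j
  | LZero => 0
  | LAdd s t => lcoef s j + lcoef t j
  | LOpp t => - lcoef t j
  | LScale a t => a * lcoef t j
  | LMuln t n => lcoef t j *+ n
  end.

Lemma leval_sum env t :
  leval env t = \sum_(j < size env) lcoef t j *: env`_j.
Proof.
elim: t => [i||s IHs t IHt|t IHt|a t IHt|t IHt n] /=.
- under eq_bigr => j _ do rewrite lunitE.
  case: (ltnP i (size env)) => [lti|gei].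
    rewrite (bigD1 (Ordinal lti)) //= eqxx scale1r big1 ?addr0 // => j.
    by rewrite -val_eqE /= eq_sym => /negPf ->; rewrite scale0r.
  rewrite nth_default // big1 // => j _.
  by rewrite gtn_eqF ?scale0r // (leq_trans (ltn_ord j)).
- by rewrite big1 // => j _; rewrite scale0r.
- by rewrite IHs IHt -big_split; apply: eq_bigr => j _; rewrite scalerDl.
- by rewrite IHt -sumrN; apply: eq_bigr => j _; rewrite scaleNr.
- by rewrite IHt scaler_sumr; apply: eq_bigr => j _; rewrite scalerA.
- by rewrite IHt -sumrMnl; apply: eq_bigr => j _; rewrite scalerMnl.
Qed.

(** The hypothesis is a fold over a concrete list, so that [cbn] unfolds it into one scalar equation
    per atom. *)
Lemma leval_eq env s t :
  foldr (fun j P => lcoef s j = lcoef t j /\ P) True (iota 0 (size env)) ->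
  leval env s = leval env t.
Proof.
move=> est; rewrite !leval_sum; apply: eq_bigr => j _; congr (_ *: _).
have: (j : nat) \in iota 0 (size env) by rewrite mem_iota /=.
elim: (iota _ _) est => //= k r IHr [ek er].
by rewrite inE => /predU1P[->|/IHr]; [|apply].
Qed.

End LinearCombination.

Ltac lin_find x env :=
  lazymatch env with
  | ?y :: ?r => match constr:(tt) with
      | _ => let _ := match constr:(tt) with _ => unify x y end in constr:(0%N)
      | _ => let i := lin_find x r in constr:(i.+1)
      end
  end.

Ltac lin_mem x env :=
  lazymatch env with
  | nil => constr:(false)
  | ?y :: ?r => match constr:(tt) with
      | _ => let _ := match constr:(tt) with _ => unify x y end in constr:(true)
      | _ => lin_mem x r
      end
  end.

Ltac lin_atoms x env :=
  lazymatch x with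
  | (?a + ?b)%R => let env1 := lin_atoms a env in lin_atoms b env1
  | (- ?a)%R => lin_atoms a env
  | (_ *: ?a)%R => lin_atoms a env
  | (?a *+ _)%R => lin_atoms a env
  | 0%R => env
  | _ => lazymatch lin_mem x env with
      | true => env
      | false => constr:(x :: env)
      end
  end.

Ltac lin_reify K x env :=
  lazymatch x with
  | (?a + ?b)%R => let s := lin_reify K a env in let t := lin_reify K b env in
      constr:(@LAdd K s t)
  | (- ?a)%R => let s := lin_reify K a env in constr:(@LOpp K s)
  | (?c *: ?a)%R => let s := lin_reify K a env in constr:(@LScale K c s)
  | (?a *+ ?n)%R => let s := lin_reify K a env in constr:(@LMuln K s n)
  | 0%R => constr:(@LZero K)
  | _ => let i := lin_find x env in constr:(@LVar K i)
  end.

(* Reduces an equality of linear combinations to the equalities of the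
   coefficients of its atoms, compared up to unification. *)
Ltac lincomb K :=
  lazymatch goal with
  | |- @eq ?V ?x ?y =>
      let env0 := lin_atoms x (@nil V) in
      let env := lin_atoms y env0 in
      let s := lin_reify K x env in
      let t := lin_reify K y env in
      apply: (@leval_eq _ _ env s t);
      cbn [foldr iota size lcoef lunit]; repeat split
  end.

(** * Virasoro modules *)

Section VirModule.
Variable K : numFieldType.
Local Notation Vir := (virasoro K).

Definition has_charge (c : K) (M : lieModType Vir) : Prop :=
  forall x : M, act (virC K) x = c *: x.

Definition cocycle (c : K) (n m : int) : K :=
  if m == - n then (n ^+ 3 - n)%:~R / 12%:R * c else 0.

Section Action.
Variables (M : lieModType Vir).
Implicit Types (x y : M) (z : Vir).

Lemma actD z x y : act z (x + y) = act z x + act z y.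
Proof. exact: linD (act_linr z) _ _. Qed.
Lemma actN z x : act z (- x) = - act z x.
Proof. exact: linN (act_linr z) _. Qed.
Lemma actB z x y : act z (x - y) = act z x - act z y.
Proof. exact: linB (act_linr z) _ _. Qed.
Lemma act0 z : act z (0 : M) = 0.
Proof. exact: lin0 (act_linr z). Qed.
Lemma actZ z a x : act z (a *: x) = a *: act z x.
Proof. exact: linZ (act_linr z) _ _. Qed.

Variable c : K.
Hypothesis Mc : has_charge c M.

Lemma act_LL n m x : act (virL K n) (act (virL K m) x) =
  act (virL K m) (act (virL K n) x) + (n - m)%:~R *: act (virL K (n + m)) x +
  cocycle c n m *: x.
Proof.
have := act_bracket (virL K n) (virL K m) x.
rewrite virLL act_linl (linZ (act_linl _)) Mc scalerA.
move=> /eqP; rewrite eq_sym subr_eq => /eqP ->; rewrite /cocycle.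
by case: eqP => _; lincomb K; ring.
Qed.

End Action.

Definition actE := (actD, actB, actN, actZ, act0).

Lemma cocycle0 c n m : m != - n -> cocycle c n m = 0.
Proof. by rewrite /cocycle => /negPf ->. Qed.

Lemma vir_ind (P : Vir -> Prop) : P 0 ->
  (forall a y z, P y -> P z -> P (a *: y + z)) ->
  P (virC K) -> (forall n, P (virL K n)) -> forall z, P z.
Proof.
move=> P0 PD PC PL; elim/freeg_lin_ind => // a [n|] x Px; apply: PD => //;
  exact: PL.
Qed.

Definition vir_rel (c : K) (M : lmodType K) (rho : int -> M -> M) : Prop :=
  forall n m x, rho n (rho m x) - rho m (rho n x) =
    (n - m)%:~R *: rho (n + m) x + cocycle c n m *: x.

(** The proofs are arguments of this copy of [M], so that the module structure is found from the
    type alone. Operators satisfying the Virasoro relations thus suffice to give a module. *)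
Definition vir_rep (c : K) (M : lmodType K) (rho : int -> M -> M)
  (_ : forall n, linear (rho n)) (_ : vir_rel c rho) : Type := M.

Section VirRep.
Variables (c : K) (M : lmodType K) (rho : int -> M -> M).
Hypotheses (rho_lin : forall n, linear (rho n)) (rho_rel : vir_rel c rho).
Local Notation rep := (vir_rep rho_lin rho_rel).
HB.instance Definition _ := GRing.Lmodule.copy rep M.

Definition vir_rep_basis (i : option int) (x : rep) : rep :=
  if i is Some n then rho n x else c *: (x : M).

Definition vir_rep_act (z : Vir) (x : rep) : rep :=
  fglift (vir_rep_basis^~ x) z.

Let basis_lin i : linear (vir_rep_basis i).
Proof.
case: i => [n|] a x y; first exact: rho_lin.
by rewrite /= scalerDr !scalerA mulrC.
Qed.

Let actb i x : vir_rep_act << i >> x = vir_rep_basis i x.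
Proof. by rewrite /vir_rep_act liftU scale1r. Qed.

Fact vir_rep_linl x : linear (vir_rep_act^~ x).
Proof. exact: fglift_linear. Qed.

Fact vir_rep_linr z : linear (vir_rep_act z).
Proof.
move=> a x y; pose g u := a *: vir_rep_act u x + vir_rep_act u y.
apply: (freeg_linear_eq (vir_rep_linl _) (g := g)).
- by move=> b u w; rewrite /g !vir_rep_linl; lincomb K; ring.
- by move=> i; rewrite /g !actb basis_lin.
Qed.

Fact vir_rep_bracket y z x : vir_rep_act (bracket y z) x =
  vir_rep_act y (vir_rep_act z x) - vir_rep_act z (vir_rep_act y x).
Proof.
pose g (u z : Vir) : rep := vir_rep_act u (vir_rep_act z x) - vir_rep_act z
  (vir_rep_act u x).
suff: (fun u : {freeg (option int) / K} => vir_rep_act (bracket (u : Vir) z) x)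
    =1 g^~ z by exact.
apply: freeg_linear_eq.
- by move=> b u w; rewrite bracket_linl vir_rep_linl.
- by move=> b u w; rewrite /g !vir_rep_linl vir_rep_linr; lincomb K; ring.
move=> i.
suff: (fun u : {freeg (option int) / K} =>
    vir_rep_act (bracket (<< i >> : Vir) (u : Vir)) x) =1 g << i >> by exact.
apply: freeg_linear_eq.
- by move=> b u w; rewrite bracket_linr vir_rep_linl.
- by move=> b u w; rewrite /g !vir_rep_linl vir_rep_linr; lincomb K; ring.
have CE w : vir_rep_act (virC K) w = c *: w by rewrite actb.
have gC u : g u (virC K) = 0.
  by rewrite /g !CE (linZ (vir_rep_linr u)) subrr.
have Cg u : g (virC K) u = 0 by rewrite /g !CE (linZ (vir_rep_linr u)) subrr.
move=> j; case: i => [n|]; last first.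
  by rewrite Cg virCx (lin0 (vir_rep_linl x)).
case: j => [m|]; last first.
  rewrite gC.
  have -> : bracket (<< Some n >> : Vir) << None >> = 0.
    exact: (biextE (@vir_br K) (Some n) None).
  by rewrite (lin0 (vir_rep_linl x)).
rewrite (virLL K n m) vir_rep_linl (linZ (vir_rep_linl x)) CE /g !actb /=.
rewrite rho_rel /cocycle scalerA; congr (_ + _ *: _).
by case: ifP => _ //; rewrite mul0r.
Qed.

HB.instance Definition _ := isLieModule.Build K Vir rep
  vir_rep_linl vir_rep_linr vir_rep_bracket.

Lemma vir_rep_L n (x : rep) : act (virL K n) x = rho n x.
Proof. exact: actb. Qed.

Lemma vir_rep_charge : has_charge c rep.
Proof. by move=> x; exact: actb. Qed.

End VirRep.
End VirModule.

(** * A model of the Verma module on words in negative modes *)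

Section VermaModel.
Variables (K : numFieldType) (c h : K).

(** This is the 2-cocycle identity, the central part of the Jacobi identity for L_n, L_m, L_l. *)
Lemma cocycle_id (n m l : int) :
  (n - l)%:~R * cocycle c (n + l) m + (m - l)%:~R * cocycle c n (m + l) =
  (n - m)%:~R * cocycle c (n + m) l.
Proof.
have [e|ne] := eqVneq l (- (n + m)); last first.
  rewrite !cocycle0 ?mulr0 ?addr0 //; apply: contraNneq ne; lia.
rewrite /cocycle e eqxx.
have -> : m == - (n - (n + m)) by apply/eqP; lia.
have -> : m - (n + m) == - n by apply/eqP; lia.
rewrite !(rmorphB, rmorphD, rmorphN, rmorphXn, rmorphM) /=; by field.
Qed.

Lemma cocycleN (n m : int) : cocycle c n m = - cocycle c m n.
Proof.
rewrite /cocycle; have -> : (n == - m) = (m == - n) by apply/eqP/eqP; lia.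
case: eqP => [->|_]; last by rewrite oppr0.
by rewrite !(rmorphB, rmorphD, rmorphN, rmorphXn) /=; field.
Qed.

(* A word in the letters [a : nat] stands for a product of the
   [L_(- a - 1)], so that [nminus] is the enveloping algebra of the
   negative part. *)
Variant nminus_rel : set {freeg (seq nat) / K} :=
| NminusRel u v a b : nminus_rel
    (<< u ++ [:: a, b & v] >> -
      (<< u ++ [:: b, a & v] >> + (b%:R - a%:R) *: << u ++ (a + b).+1 :: v >>)).

Definition nminus : Type := lmod_quot (span nminus_rel).
HB.instance Definition _ := GRing.Lmodule.on nminus.

Definition nword (w : seq nat) : nminus := lquot (span nminus_rel) << w >>.

Lemma nminus_ind (P : nminus -> Prop) : P 0 ->
  (forall a w x, P x -> P (a *: nword w + x)) -> forall x, P x.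
Proof.
move=> P0 PS; elim/lquot_ind; elim/freeg_lin_ind => [|a w t Pt].
  by rewrite raddf0.
by rewrite lquot_linear; apply: PS.
Qed.

Lemma nword_rel u v a b : nword (u ++ [:: a, b & v]) =
  nword (u ++ [:: b, a & v]) + (b%:R - a%:R) *: nword (u ++ (a + b).+1 :: v).
Proof.
rewrite /nword [RHS]addrC -(lquot_linear (span nminus_rel)).
by apply/eq_lquot/sub_span; rewrite [_ *: _ + _]addrC; exact: NminusRel.
Qed.

Section Lift.
Variables (W : lmodType K) (f : seq nat -> W).
Hypothesis f_rel : forall u v a b, f (u ++ [:: a, b & v]) =
  f (u ++ [:: b, a & v]) + (b%:R - a%:R) *: f (u ++ (a + b).+1 :: v).

Definition nlift : nminus -> W := lquot_lift (fglift f).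

Let kill t : t \in span nminus_rel -> fglift f t = 0.
Proof.
have lf := fglift_linear f; move: t; apply: span_min.
- exact: lin0.
- by move=> a u v uE vE; rewrite lf uE vE scaler0 addr0.
- move=> _ [u v a b]; rewrite (linB lf) (linD lf) (linZ lf) !liftU !scale1r.
  by rewrite f_rel subrr.
Qed.

Lemma nlift_linear : linear nlift.
Proof. exact: lquot_lift_linear (fglift_linear f) kill. Qed.

Lemma nliftE w : nlift (nword w) = f w.
Proof.
by rewrite /nlift lquot_liftE ?liftU ?scale1r //; exact: fglift_linear.
Qed.
End Lift.

Definition nmul (a : nat) : nminus -> nminus := nlift (fun w => nword (a :: w)).

Let nmul_rel a u v p q : nword (a :: u ++ [:: p, q & v]) =
  nword (a :: u ++ [:: q, p & v]) +
    (q%:R - p%:R) *: nword (a :: u ++ (p + q).+1 :: v).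
Proof. exact: nword_rel (a :: u) v p q. Qed.

Lemma nmulE a w : nmul a (nword w) = nword (a :: w).
Proof. exact: nliftE (nmul_rel a) w. Qed.

Lemma nmul_linear a : linear (nmul a).
Proof. exact: nlift_linear (nmul_rel a). Qed.

Lemma nmulC a b x :
  nmul a (nmul b x) = nmul b (nmul a x) + (b%:R - a%:R) *: nmul (a + b).+1 x.
Proof.
elim/nminus_ind: x => [|p w x IH].
  by rewrite !(lin0 (nmul_linear _)) scaler0 addr0.
rewrite !nmul_linear IH !nmulE (nword_rel [::]) /=.
by lincomb K; ring.
Qed.

(** The value is L_n applied to the word [w], found by commuting L_n through the letters up to the
    highest weight vector. The sign of [n] is tested first because a negative mode is itself a
    letter. *)
Fixpoint nact (w : seq nat) (n : int) : nminus :=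
  if n is Negz a then nword (a :: w) else
  if w is b :: w' then
    nmul b (nact w' n) + (n - Negz b)%:~R *: nact w' (n + Negz b) +
      cocycle c n (Negz b) *: nword w'
  else if n == 0 then h *: nword [::] else 0.

Let subNegz (a b : nat) : (Negz a - Negz b)%:~R = b%:R - a%:R :> K.
Proof.
by rewrite (_ : Negz a - Negz b = b%:Z - a%:Z) ?rmorphB //; lia.
Qed.

(** For n >= 0 this is the definition; for n < 0 it is the defining relation of [nminus], the
    central term being zero. *)
Lemma nact_cons b w n : nact (b :: w) n =
  nmul b (nact w n) + (n - Negz b)%:~R *: nact w (n + Negz b) +
    cocycle c n (Negz b) *: nword w.
Proof.
case: n => [//|a] /=.
rewrite cocycle0 ?scale0r ?addr0; last by apply/eqP; lia.
rewrite (_ : Negz a + Negz b = Negz (a + b).+1); last by lia.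
have -> : nact w (Negz (a + b).+1) = nword ((a + b).+1 :: w) by case: w.
have -> : nact w (Negz a) = nword (a :: w) by case: w.
by rewrite nmulE subNegz (nword_rel [::]).
Qed.

(** This makes the action well defined on [nminus]. When the exchanged letters come first it is the
    Jacobi identity, with central part [cocycle_id]; letters in front are removed by induction. *)
Lemma nact_rel n u v a b : nact (u ++ [:: a, b & v]) n =
  nact (u ++ [:: b, a & v]) n + (b%:R - a%:R) *: nact (u ++ (a + b).+1 :: v) n.
Proof.
elim: u n => [|d u IH] n.
  rewrite !cat0s !nact_cons !(linD (nmul_linear _)) !(linZ (nmul_linear _)).
  rewrite nmulC !nmulE.
  have -> : n + Negz b + Negz a = n + Negz a + Negz b by lia.
  have -> : n + Negz (a + b).+1 = n + Negz a + Negz b by lia.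
  have := cocycle_id n (Negz a) (Negz b).
  have -> : Negz a + Negz b = Negz (a + b).+1 by lia.
  move=> cid; rewrite -!subNegz.
  lincomb K; rewrite ?NegzE in cid *; try ring.
  by rewrite !(mulr0, mulr1, add0r, addr0) -cid.
rewrite !cat_cons !nact_cons !IH nword_rel !(linD (nmul_linear _)).
rewrite !(linZ (nmul_linear _)).
by lincomb K; ring.
Qed.

Definition vact (n : int) : nminus -> nminus := nlift (nact^~ n).

Lemma vact_linear n : linear (vact n).
Proof. exact: nlift_linear (nact_rel n). Qed.

Lemma vactE n w : vact n (nword w) = nact w n.
Proof. exact: nliftE (nact_rel n) w. Qed.

Lemma vact_neg a x : vact (Negz a) x = nmul a x.
Proof.
elim/nminus_ind: x => [|p w x IH].
  by rewrite (lin0 (nmul_linear _)) (lin0 (vact_linear _)).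
by rewrite nmul_linear vact_linear IH vactE nmulE; case: w.
Qed.

Lemma vact_nmul n b x : vact n (nmul b x) =
  nmul b (vact n x) + (n - Negz b)%:~R *: vact (n + Negz b) x +
    cocycle c n (Negz b) *: x.
Proof.
elim/nminus_ind: x => [|p w x IH].
  rewrite !(lin0 (nmul_linear _), lin0 (vact_linear _)).
  by rewrite !scaler0 !addr0.
rewrite !(nmul_linear, vact_linear) IH nmulE !vactE nact_cons.
by lincomb K; ring.
Qed.

(** Induction on the word, the step being again the Jacobi identity. On the empty word nonnegative
    modes act by scalars, and a negative mode is a left multiplication, for which the relation is
    [vact_nmul]. *)
Lemma vact_vir_rel : vir_rel c vact.
Proof.
have negP b m x : vact (Negz b) (vact m x) - vact m (vact (Negz b) x) =
    (Negz b - m)%:~R *: vact (Negz b + m) x + cocycle c (Negz b) m *: x.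
  rewrite !vact_neg vact_nmul [Negz b + m]addrC [cocycle c (Negz b) m]cocycleN.
  rewrite -vact_neg; lincomb K; ring.
have antisym n m x : vact m (vact n x) - vact n (vact m x) =
      (m - n)%:~R *: vact (m + n) x + cocycle c m n *: x ->
    vact n (vact m x) - vact m (vact n x) =
      (n - m)%:~R *: vact (n + m) x + cocycle c n m *: x.
  move=> e; rewrite -opprB e [m + n]addrC [cocycle c m n]cocycleN.
  by lincomb K; ring.
have vE (k : nat) :
    vact k (nword [::]) = ((k == 0)%:R * h) *: nword [::].
  by rewrite vactE /= eqz_nat; case: eqP; rewrite ?mul1r // mul0r scale0r.
have pos0 (n m : nat) : vact n (vact m (nword [::])) -
    vact m (vact n (nword [::])) =
    (n%:Z - m%:Z)%:~R *: vact (n%:Z + m%:Z) (nword [::]) +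
    cocycle c n m *: nword [::].
  rewrite -PoszD !vE !(linZ (vact_linear _)) !vE !scalerA.
  have -> : cocycle c n m = 0.
    rewrite /cocycle; case: eqP => // e; have -> : n = 0%N by lia.
    by rewrite expr0n subrr !mul0r.
  by case: n => [|n]; case: m => [|m]; lincomb K; rewrite /=; ring.
suff key w : forall n m, vact n (vact m (nword w)) - vact m (vact n (nword w)) =
    (n - m)%:~R *: vact (n + m) (nword w) + cocycle c n m *: nword w.
  move=> n m x; elim/nminus_ind: x => [|a w x IH].
    by rewrite !(lin0 (vact_linear _)) !scaler0 subrr addr0.
  rewrite !vact_linear opprD addrACA IH -scalerBr key.
  by lincomb K; ring.
elim: w => [|b w IH] n m.
  case: n => [n|n]; last exact: negP.
  case: m => [m|m]; first exact: pos0.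
  exact/antisym/negP.
rewrite -nmulE; set y := nword w in IH *.
rewrite !vact_nmul !(linD (vact_linear _)) !(linZ (vact_linear _)) !vact_nmul.
have {}IH p q : vact p (vact q y) = vact q (vact p y) +
    ((p - q)%:~R *: vact (p + q) y + cocycle c p q *: y).
  by rewrite -IH addrC subrK.
rewrite [vact n (vact m y)]IH [vact n (vact (m + _) y)]IH.
rewrite [vact (n + _) (vact m y)]IH !(linD (nmul_linear _)) !(linZ (nmul_linear
  _)).
have -> : n + (m + Negz b) = n + m + Negz b by ring.
have -> : n + Negz b + m = n + m + Negz b by ring.
have := cocycle_id n m (Negz b) => cid.
lincomb K; try ring.
by rewrite !(mulr0, mulr1, add0r, addr0, oppr0) cid.
Qed.

Definition vmodel : lieModType (virasoro K) := vir_rep vact_linear vact_vir_rel.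

Definition vmodel_hw : vmodel := nword [::].

Lemma vmodel_L0 : act (virL K 0) vmodel_hw = h *: vmodel_hw.
Proof. by rewrite vir_rep_L vactE. Qed.

Lemma vmodel_Lpos n : 0 < n -> act (virL K n) vmodel_hw = 0.
Proof.
by case: n => [n|//]; rewrite vir_rep_L vactE /= lt0r => /andP[/negPf -> _].
Qed.

Let eps_rel (u v : seq nat) (a b : nat) :
  ((u ++ [:: a, b & v] == [::])%:R : K^o) = (u ++ [:: b, a & v] == [::])%:R +
    (b%:R - a%:R) *: ((u ++ (a + b).+1 :: v == [::])%:R : K^o).
Proof. by case: u => [|d u]; rewrite /= scaler0 addr0. Qed.

(** The coefficient of the empty word is well defined because the relations of [nminus] involve
    nonempty words only. Its value 1 on [vmodel_hw] shows that the highest weight vector is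
    nonzero. *)
Definition vmodel_eps : vmodel -> K^o :=
  nlift (fun w => (w == [::])%:R : K^o).

Lemma vmodel_eps_linear : linear vmodel_eps.
Proof. exact: nlift_linear eps_rel. Qed.

Lemma vmodel_eps_hw : vmodel_eps vmodel_hw = 1.
Proof. exact: nliftE eps_rel [::]. Qed.

Lemma vmodel_eps_neg n x : n < 0 -> vmodel_eps (act (virL K n) x) = 0.
Proof.
case: n => // n _; rewrite vir_rep_L.
elim/nminus_ind: x => [|a w x IH].
  by rewrite (lin0 (vact_linear _)) (lin0 vmodel_eps_linear).
rewrite vact_linear vmodel_eps_linear IH addr0 vact_neg nmulE.
by rewrite /vmodel_eps (nliftE eps_rel) /= scaler0.
Qed.

End VermaModel.

(** * Cyclic vectors, homomorphisms and quotients of Lie modules *)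

Section Envelope.
Variables (K : fieldType) (g : lieAlgType K).

Lemma submod_gen_min (M : lieModType g) (A : set M) (P : M -> Prop) : P 0 ->
  (forall a x y, P x -> P y -> P (a *: x + y)) ->
  (forall z x, P x -> P (act z x)) ->
  (forall x, A x -> P x) -> forall x, x \in submod_gen A -> P x.
Proof.
move=> P0 PD Pa PA; apply: (span_min P0 PD) => _ [u [m [/PA Pm ->]]].
elim/env_ind: u => [|a w u IH]; first by rewrite (lin0 (env_eval_linl m)).
rewrite env_eval_linl; apply: PD => //; rewrite env_eval_word.
by elim: w => //= z w; apply: Pa.
Qed.

Definition subspace (M : lmodType K) (P : M -> Prop) : Prop :=
  P 0 /\ forall a x y, P x -> P y -> P (a *: x + y).

Lemma subspace_sub (M : lmodType K) (S : submodClosed M) :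
  subspace (fun x => x \in S).
Proof. by split; [exact: rpred0|move=> a x y xS yS; rewrite rpredD ?rpredZ].
  Qed.

Lemma subspaceZ (M : lmodType K) (P : M -> Prop) : subspace P ->
  forall a x, P x -> P (a *: x).
Proof. by move=> [P0 PD] a x Px; rewrite -[_ *: _]addr0; apply: PD. Qed.

Lemma subspaceD (M : lmodType K) (P : M -> Prop) : subspace P ->
  forall x y, P x -> P y -> P (x + y).
Proof. by move=> [_ PD] x y Px Py; rewrite -[x]scale1r; apply: PD. Qed.

(** Generation is stated as an induction principle over predicates, so that it applies directly to a
    property without first building a submodule from it. *)
Definition cyclic_vector (M : lieModType g) (v : M) : Prop :=
  forall P, subspace P -> P v -> (forall z x, P x -> P (act z x)) ->
  forall x, P x.

Definition lie_hom (M N : lieModType g) (f : M -> N) : Prop :=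
  linear f /\ forall z x, f (act z x) = act z (f x).

Lemma env_cyclic : cyclic_vector (env_word [::] : enveloping g).
Proof.
move=> P [P0 PD] Pv Pa; apply: env_ind => // a w u Pu; apply: PD => //.
by elim: w => //= z w Pw; rewrite -env_act_word; apply: Pa.
Qed.

Lemma tens_act (M N : lieModType g) z (x : M) (y : N) :
  act z (tens x y : lie_tensor M N) = tens (act z x) y + tens x (act z y).
Proof. exact: tensor_actE. Qed.

Section Quotient.
Variables (M : lieModType g) (S : lieSubmod M).
Local Notation Q := (lie_quot S).

Lemma lie_proj_act z m : lie_proj S (act z m) = act z (lie_proj S m : Q).
Proof. by rewrite -lie_quot_actE. Qed.

Lemma lie_proj_eq0 m : lie_proj S m = 0 :> Q <-> m \in S.
Proof. by rewrite -(lin0 (lie_proj_linear S)) eq_lie_proj subr0. Qed.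

Lemma lie_proj_eigen z m a : act z m - a *: m \in S ->
  act z (lie_proj S m : Q) = a *: (lie_proj S m : Q).
Proof.
by move=> /eq_lie_proj; rewrite lie_proj_act (linZ (lie_proj_linear S)).
Qed.

Lemma lie_quot_cyclic v : cyclic_vector v -> cyclic_vector (lie_proj S v : Q).
Proof.
move=> cv P [P0 PD] Pv Pa; apply: lie_quot_ind.
apply: (cv (fun m => P (lie_proj S m))) => // [|z m Pm]; first split.
- by rewrite (lin0 (lie_proj_linear S)).
- by move=> a x y Px Py; rewrite lie_proj_linear; apply: PD.
by rewrite lie_proj_act; apply: Pa.
Qed.

Lemma lie_quot_lift (N : lieModType g) (f : M -> N) : lie_hom f ->
  (forall m, m \in S -> f m = 0) ->
  exists2 h : Q -> N, lie_hom h & forall m, h (lie_proj S m) = f m.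
Proof.
move=> [fl fa] f0; have hE := lquot_liftE fl f0.
exists (lquot_lift f); last exact: hE; split.
  exact: lquot_lift_linear fl f0.
move=> z; apply: lie_quot_ind => m.
by rewrite -lie_proj_act [LHS]hE fa; congr (act z _); rewrite -[LHS]hE.
Qed.

End Quotient.

End Envelope.

(** * Universal property of Verma modules *)

Section HighestWeight.
Variable K : numFieldType.
Local Notation Vir := (virasoro K).
Local Notation L n := (act (virL K n)).

Definition singular (c h : K) (M : lieModType Vir) (v : M) : Prop :=
  [/\ has_charge c M, L 0 v = h *: v & forall n, 0 < n -> L n v = 0].

(** Since C is central, the vectors on which it acts by [c] form a submodule. *)
Lemma cyclic_charge (c : K) (M : lieModType Vir) (v : M) : cyclic_vector v ->
  act (virC K) v = c *: v -> has_charge c M.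
Proof.
move=> cv Cv; apply: cv => // [|z x IH]; first split.
- by rewrite act0 scaler0.
- by move=> a x y cx cy; rewrite actD actZ cx cy; lincomb K; ring.
have := act_bracket (virC K) z x; rewrite virCx (lin0 (act_linl x)).
by move/eqP; rewrite eq_sym subr_eq0 IH actZ => /eqP.
Qed.

Lemma subspace_act (c : K) (M : lieModType Vir) (P : M -> Prop) :
  has_charge c M -> subspace P -> (forall n x, P x -> P (L n x)) ->
  forall z x, P x -> P (act z x).
Proof.
move=> Mc sP PL z x Px; have [P0 PD] := sP; elim/vir_ind: z => //.
- by rewrite (lin0 (act_linl x)).
- by move=> a y z Py Pz; rewrite act_linl; apply: PD.
- by rewrite Mc; apply: subspaceZ.
- by move=> n; apply: PL.
Qed.

Section Verma.
Variables c h : K.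
Local Notation v := (verma_hw c h).

Let word1 z : act z (env_word [::]) = env_word [:: z] :> enveloping Vir.
Proof. exact: env_act_word. Qed.

Lemma verma_cyclic : cyclic_vector v.
Proof. exact: lie_quot_cyclic (@env_cyclic _ _). Qed.

Lemma verma_singular : singular c h v.
Proof.
split.
- apply: (cyclic_charge verma_cyclic); apply: lie_proj_eigen.
  by rewrite word1; apply: submod_gen_sub; exact: VermaC.
- apply: lie_proj_eigen.
  by rewrite word1; apply: submod_gen_sub; exact: VermaL0.
move=> n n0; rewrite -[RHS](scale0r v); apply: lie_proj_eigen.
by rewrite scale0r subr0 word1; apply: submod_gen_sub; exact: VermaL.
Qed.

Lemma verma_lift (M : lieModType Vir) (m : M) : singular c h m ->
  exists2 f : verma c h -> M, lie_hom f & f v = m.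
Proof.
move=> [Mc m0 mp].
have eh : lie_hom (fun u : enveloping Vir => env_eval u m).
  by split=> [|z u]; [exact: env_eval_linl | exact: env_eval_act].
have [el _] := eh.
have kill u : u \in submod_gen (@verma_rel K c h) -> env_eval u m = 0.
  move: u; apply: submod_gen_min; first exact: (lin0 el).
  - by move=> a x y x0 y0; rewrite el x0 y0 scaler0 addr0.
  - by move=> z x x0; rewrite env_eval_act x0 act0.
  move=> _ []; last by move=> n n0; rewrite env_eval_word /= mp.
  - by rewrite (linB el) (linZ el) !env_eval_word /= Mc subrr.
  - by rewrite (linB el) (linZ el) !env_eval_word /= m0 subrr.
have [f fh fE] := lie_quot_lift eh kill.
by exists f; rewrite // /verma_hw fE env_eval_word.
Qed.

End Verma.
End HighestWeight.

(** * Highest weight modules *)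

Section Filtration.
Variable K : numFieldType.
Local Notation Vir := (virasoro K).
Local Notation L n := (act (virL K n)).
Variables (c h : K) (M : lieModType Vir) (v : M).
Hypotheses (v_sing : singular c h v) (v_cyc : cyclic_vector v).

Let Mc : has_charge c M. Proof. by case: v_sing. Qed.
Let LL := act_LL Mc.

Definition neg_word (w : seq nat) : M := foldr (fun a x => L (Negz a) x) v w.

Definition word_deg (w : seq nat) : nat := \sum_(a <- w) a.+1.

(** A filtration stands in for the grading by weight, which spares a direct sum decomposition. The
    bound is an integer, so that L_n lowers it by exactly n and a negative bound forces 0. *)
Definition deg_le (e : int) : M -> Prop := fun x =>
  x \in span [set y : M | exists2 w, (word_deg w)%:Z <= e & y = neg_word w].

Lemma deg_le_subspace e : subspace (deg_le e).
Proof. exact: subspace_sub. Qed.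

Lemma deg_le_word w e : (word_deg w)%:Z <= e -> deg_le e (neg_word w).
Proof. by move=> we; apply: sub_span; exists w. Qed.

Lemma deg_le_ind e (P : M -> Prop) : subspace P ->
  (forall w, (word_deg w)%:Z <= e -> P (neg_word w)) ->
  forall x, deg_le e x -> P x.
Proof. by move=> [P0 PD] Pw; apply: span_min => // _ [w we ->]; exact: Pw. Qed.

Lemma deg_leW e e' x : e <= e' -> deg_le e x -> deg_le e' x.
Proof.
move=> ee'; apply: deg_le_ind; first exact: deg_le_subspace.
by move=> w we; apply/deg_le_word/(le_trans we).
Qed.

Lemma deg_le_lt0 e x : e < 0 -> deg_le e x -> x = 0.
Proof.
move=> e0; move: x; apply: deg_le_ind => [|w we]; last by lia.
by split=> // a x y -> ->; rewrite scaler0 addr0.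
Qed.

Lemma deg_le_L0 e n : subspace (fun x => deg_le (e - n) (L n x)).
Proof.
have [G0 GD] := deg_le_subspace (e - n).
by split=> [|a x y Gx Gy]; rewrite ?act0 // actD actZ; apply: GD.
Qed.

Lemma deg_le_L_word w n : deg_le ((word_deg w)%:Z - n) (L n (neg_word w)).
Proof.
elim: w n => [|a w IH] n.
  rewrite /word_deg big_nil sub0r; case: n => [[|n]|n].
  - have [_ v0 _] := v_sing; rewrite [L 0 _]v0.
    apply: (subspaceZ (deg_le_subspace _)).
    by apply: (@deg_le_word [::]); rewrite /word_deg big_nil.
  - by have [_ _ ->] := v_sing => //; have [] := deg_le_subspace (- n.+1%:Z).
  - apply: (@deg_le_word [:: n]); rewrite /word_deg big_seq1; lia.
have negL b e x : deg_le e x -> deg_le (e + b.+1%:Z) (L (Negz b) x).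
  move: x; apply: deg_le_ind => [|w' w'e].
    have := deg_le_L0 e (Negz b); rewrite (_ : e - Negz b = e + b.+1%:Z) //;
      lia.
  by apply: (@deg_le_word (b :: w')); rewrite /word_deg big_cons -/(word_deg
    w'); lia.
rewrite [neg_word _]/= LL /word_deg big_cons -/(word_deg w).
have sG := deg_le_subspace ((a.+1 + word_deg w)%N%:Z - n).
apply: subspaceD => //; first apply: subspaceD => //.
- have := negL a _ _ (IH n).
  by rewrite (_ : (word_deg w)%:Z - n + a.+1 = (a.+1 + word_deg w)%N%:Z - n) //;
    lia.
- apply: subspaceZ => //; have := IH (n + Negz a).
  by rewrite (_ : _ - (n + Negz a) = (a.+1 + word_deg w)%N%:Z - n) //; lia.
have [e|ne] := eqVneq (Negz a) (- n); last first.
  by rewrite cocycle0 // scale0r; have [] := sG.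
apply: subspaceZ => //; apply: deg_le_word; lia.
Qed.

Lemma deg_le_L e n x : deg_le e x -> deg_le (e - n) (L n x).
Proof.
move: x; apply: deg_le_ind; first exact: deg_le_L0.
by move=> w we; apply: deg_leW (deg_le_L_word w n); lia.
Qed.

Lemma neg_word_L0 w : L 0 (neg_word w) = (h + (word_deg w)%:R) *: neg_word w.
Proof.
elim: w => [|a w IH].
  by rewrite /word_deg big_nil addr0; case: v_sing.
rewrite [neg_word _]/= LL IH cocycle0; last by apply/eqP; lia.
rewrite actZ !add0r /word_deg big_cons -/(word_deg w) natrD NegzE opprK.
by lincomb K; ring.
Qed.

(** On a word of degree d the operator L_0 - (h + e) is multiplication by d - e, which kills the top
    degree e. *)
Lemma deg_le_shift e x :
  deg_le e x -> deg_le (e - 1) (L 0 x - (h + e%:~R) *: x).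
Proof.
have sG := deg_le_subspace (e - 1).
move: x; apply: deg_le_ind => [|w we].
  split=> [|a x y Gx Gy]; first by rewrite act0 scaler0 subrr; case: sG.
  have := sG.2 a _ _ Gx Gy; congr (deg_le _ _); rewrite actD actZ.
  by lincomb K; ring.
rewrite neg_word_L0 -scalerBl.
have [we'|we'] := leP ((word_deg w)%:Z) (e - 1).
  by apply: (subspaceZ sG); exact: deg_le_word.
have -> : e = (word_deg w)%:Z by lia.
by rewrite -pmulrn subrr scale0r; exact: (deg_le_subspace _).1.
Qed.

Lemma deg_le0 x : deg_le 0 x -> exists a, x = a *: v.
Proof.
move: x; apply: deg_le_ind => [|w].
  split=> [|a x y [b ->] [d ->]]; first by exists 0; rewrite scale0r.
  by exists (a * b + d); lincomb K; ring.
rewrite /word_deg; case: w => [|a w]; last by rewrite big_cons; lia.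
by exists 1; rewrite scale1r.
Qed.

Lemma generates : forall P : M -> Prop, subspace P -> P v ->
  (forall n x, P x -> P (L n x)) -> forall x, P x.
Proof. by move=> P sP Pv PL; apply: v_cyc => //; apply: subspace_act PL. Qed.

Lemma deg_le_exhaust x : exists D : nat, deg_le D x.
Proof.
move: x; apply: generates.
- split=> [|a x y [D Dx] [E Ey]]; first by exists 0%N;
    case: (deg_le_subspace 0).
  exists (D + E)%N; apply: (deg_le_subspace _).2.
    by apply: deg_leW Dx; lia.
  by apply: deg_leW Ey; lia.
- by exists 0%N; apply: (@deg_le_word [::]); rewrite /word_deg big_nil.
move=> n x [D /(deg_le_L n) Dx]; exists (D + `|n|)%N; apply: deg_leW Dx; lia.
Qed.

Lemma neg_word_ind (P : M -> Prop) : subspace P -> P v ->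
  (forall a x, P x -> P (L (Negz a) x)) -> forall x, P x.
Proof.
move=> sP Pv PL x; have [D] := deg_le_exhaust x.
move: x; apply: deg_le_ind => // w _; elim: w => //= a w; exact: PL.
Qed.

(** A mode L_n with n above the degree bound of x makes that bound negative. This is what makes
    infinite sums of modes finite on each vector. *)
Lemma locally_nilpotent (x : M) :
  exists N : nat, forall n : int, N%:Z <= n -> L n x = 0.
Proof.
have [D Dx] := deg_le_exhaust x; exists D.+1 => n Nn.
by apply: deg_le_lt0 (deg_le_L n Dx); lia.
Qed.

(** Positive modes lower the degree bound, so applying them as long as the result is nonzero must
    stop. *)
Lemma exists_singular (P : M -> Prop) x :
  (forall (n : int) y, 0 < n -> P y -> P (L n y)) -> P x -> x != 0 ->
  exists2 y, P y /\ y != 0 & forall n : int, 0 < n -> L n y = 0.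
Proof.
move=> PL; have [D Dx] := deg_le_exhaust x.
have [N] : exists N, (N > D)%N by exists D.+1.
elim: N D x Dx => // N IH D x Dx DN Px x0.
have [|] := pselect (exists2 n : nat, (0 < n)%N & L n x != 0) => [[n n0 nx]|nx].
  have Dn := deg_le_L n Dx.
  have [Dlt|Dge] := ltnP D n.
    by case/eqP: nx; apply: deg_le_lt0 Dn; lia.
  apply: (IH (D - n)%N (L n x)) => //; last by apply: PL.
    by rewrite (_ : (D - n)%N%:Z = D%:Z - n%:Z) //; lia.
  lia.
exists x => // n; case: n => [n n0|//]; apply/eqP; apply: contrapT => /negP xn.
by apply: nx; exists n.
Qed.

Lemma deg_le_eigen mu (e : int) x :
  L 0 x = mu *: x -> mu != h + e%:~R -> deg_le e x -> deg_le (e - 1) x.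
Proof.
move=> x0 ne /deg_le_shift; rewrite x0 -scalerBl.
move=> /(subspaceZ (deg_le_subspace _) (mu - (h + e%:~R))^-1).
by rewrite scalerA mulVf ?scale1r // subr_eq0.
Qed.

End Filtration.

(** * The coefficient of the highest weight vector as a functional, and irreducibility *)

Section TopFunctional.
Variable K : numFieldType.
Local Notation Vir := (virasoro K).
Local Notation L n := (act (virL K n)).

Definition top_functional (M : lieModType Vir) (v : M) (e : M -> K^o) : Prop :=
  [/\ linear e, e v = 1 & forall (n : int) x, n < 0 -> e (L n x) = 0].

(** This encodes irreducibility of a highest weight module. [P] is any set stable under positive
    modes, so a pair of vectors such as 0 and a singular one can be tested. *)
Definition nondegenerate (M : lieModType Vir) (e : M -> K^o) : Prop :=
  forall P : M -> Prop, (forall (n : int) x, 0 < n -> P x -> P (L n x)) ->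
    (forall x, P x -> e x = 0) -> forall x, P x -> x = 0.

Section Module.
Variables (c h : K) (M : lieModType Vir) (v : M) (e : M -> K^o).
Hypotheses (v_sing : singular c h v) (v_cyc : cyclic_vector v).
Hypothesis e_top : top_functional v e.

Let Mc : has_charge c M. Proof. by case: v_sing. Qed.
Let LL := act_LL Mc.
Let el : linear e. Proof. by case: e_top. Qed.
Let eneg (n : int) x : n < 0 -> e (L n x) = 0. Proof. by case: e_top => _ _;
  apply. Qed.

(** L_0 preserves the span of the images of negative modes, on which [e] vanishes, and acts by h on
    [v]. *)
Lemma top_L0 x : e (L 0 x) = h * e x.
Proof.
move: x; apply: (neg_word_ind v_sing v_cyc) => [||a x _].
- split=> [|a x y hx hy].
    by rewrite act0 (lin0 el) mulr0.
  by rewrite actD actZ !el hx hy mulrDr; congr (_ + _); exact: mulrCA.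
- by have [_ -> _] := v_sing; rewrite (linZ el).
rewrite LL !(linD el) !(linZ el) add0r !eneg // cocycle0; last by apply/eqP;
  lia.
by rewrite mulr0 scaler0 scale0r !addr0.
Qed.

(** At degree bound D + 1 the operator L_0 - (h + D + 1) lowers the bound and multiplies the value
    of [e] by -(D + 1), which is nonzero. Iterating reaches a nonzero multiple of [v]. *)
Lemma top_submod (P : M -> Prop) x : subspace P -> (forall y, P y ->
  P (L 0 y)) ->
  P x -> e x != 0 -> P v.
Proof.
move=> sP PL; have [D] := deg_le_exhaust v_sing v_cyc x.
elim: D x => [|D IH] x Dx Px ex.
  have [a xE] := deg_le0 Dx; move: Px; rewrite xE => /(subspaceZ sP a^-1).
  rewrite scalerA mulVf ?scale1r //; apply: contraNneq ex => a0.
  by rewrite xE a0 scale0r (lin0 el).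
have Dx' := deg_le_shift v_sing Dx.
apply: (IH (L 0 x - (h + D.+1%:~R) *: x)).
- by move: Dx'; rewrite (_ : D.+1%:Z - 1 = D) //; lia.
- rewrite -scaleNr addrC; apply: sP.2 => //; exact: PL.
rewrite (linB el) (linZ el) top_L0 -mulrBl mulf_neq0 //.
by rewrite opprD addNKr oppr_eq0 intr_eq0.
Qed.

Definition radical (x : M) : Prop := forall w : seq Vir, e (foldr act x w) = 0.

Lemma radical_subspace : subspace radical.
Proof.
split=> [w|a x y Rx Ry w].
  by rewrite (_ : foldr _ _ _ = 0) ?(lin0 el) //; elim: w => //= z w ->;
    rewrite act0.
rewrite (_ : foldr _ _ _ = a *: foldr act x w + foldr act y w).
  by rewrite el Rx Ry scaler0 addr0.
by elim: w => //= z w ->; rewrite actD actZ.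
Qed.

Lemma radical_act z x : radical x -> radical (act z x).
Proof. by move=> Rx w; have := Rx (rcons w z); rewrite foldr_rcons. Qed.

Lemma radical_submod x : x \in submod_gen radical -> radical x.
Proof.
move: x; apply: submod_gen_min => //; [|exact: radical_subspace.2 | exact:
  radical_act].
exact: radical_subspace.1.
Qed.

(** A submodule with an element on which [e] is nonzero contains [v], hence everything, so proper
    submodules lie in the radical. Conversely the radical is a submodule missing [v], since
    [e v = 1]. *)
Lemma proper_sumE x : x \in proper_sum M <-> radical x.
Proof.
split=> [|Rx].
  move: x; apply: submod_gen_min; [exact: radical_subspace.1
    | exact: radical_subspace.2 | exact: radical_act |] => x [S [n nS] xS] w.
  have {}xS : foldr act x w \in S by elim: w => //= z w; exact: act_stable.
  apply/eqP; apply: contraNT nS => ex.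
  have vS : v \in S.
    by apply: top_submod (subspace_sub S) _ xS ex => y; exact: act_stable.
  by apply: v_cyc (subspace_sub S) vS _ n => z y; exact: act_stable.
apply: submod_gen_sub; exists (submod_gen radical : lieSubmod M);
  last exact: submod_gen_sub.
exists v; apply/negP => /radical_submod /(_ [::]) /=.
by have [_ -> _] := e_top; apply/eqP; exact: oner_neq0.
Qed.

(** Each commutator met while moving [z] to the right merges two letters into one, leaving a word of
    length [k], on which [e] vanishes by hypothesis. *)
Let commute z x k : (forall w, size w = k -> e (foldr act x w) = 0) ->
  forall p w, (size p + size w)%N = k ->
  e (foldr act (act z (foldr act x w)) p) = e (foldr act (act z x) (p ++ w)).
Proof.
move=> e0 p w; elim: w p => [|a w IH] p /= pw; first by rewrite cats0.
have -> : act z (act a (foldr act x w)) = act a (act z (foldr act x w)) +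
    foldr act x (bracket z a :: w).
  by rewrite /= act_bracket addrC subrK.
have fD y y' : foldr act (y + y') p = foldr act y p + foldr act y' p :> M.
  by elim: (p) => //= b q ->; rewrite actD.
rewrite fD (linD el) -foldr_cat [X in _ + X]e0 ?addr0; last first.
  by rewrite size_cat.
by rewrite -foldr_rcons IH ?size_rcons ?addSnnS // cat_rcons.
Qed.

(** Positive modes suffice to test the radical, by induction on the word: a leading negative mode is
    killed by [e], C and L_0 give scalars, and a positive mode is commuted to the right end and
    absorbed by [P]. *)
Lemma radicalP (P : M -> Prop) : (forall (n : int) x, 0 < n -> P x ->
  P (L n x)) ->
  (forall x, P x -> e x = 0) -> forall x, P x -> radical x.
Proof.
move=> PL Pe x Px w; move: {2}(size w) (erefl (size w)) => k.
elim: k w x Px => [|k IH] [|z w] x Px //= => [_|[wk]]; first exact: Pe.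
move: z; apply: vir_ind => [|a y z y0 z0||n].
- by rewrite (lin0 (act_linl _)) (lin0 el).
- by rewrite act_linl el y0 z0 scaler0 addr0.
- by rewrite Mc (linZ el) IH // scaler0.
case: (ltrgtP n 0) => [n0|n0|->]; first exact: eneg.
  have -> := commute (virL K n) (fun w => IH w x Px) (p := [::]) wk.
  by apply: IH => //; exact: PL.
by rewrite top_L0 IH // mulr0.
Qed.

End Module.

Lemma verma_top c h : exists e, top_functional (verma_hw c h) e.
Proof.
have sm : singular c h (vmodel_hw c h).
  split; [exact: vir_rep_charge|exact: vmodel_L0|exact: vmodel_Lpos].
have [f [fl fa] fv] := verma_lift sm.
exists (fun x => vmodel_eps (f x)); split.
- by move=> a x y; rewrite fl vmodel_eps_linear.
- by rewrite fv vmodel_eps_hw.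
- by move=> n x n0; rewrite fa vmodel_eps_neg.
Qed.

Lemma lie_quot_singular c h (M : lieModType Vir) (S : lieSubmod M) (v : M) :
  singular c h v -> singular c h (lie_proj S v : lie_quot S).
Proof.
move=> [Mc v0 vp]; split.
- apply: lie_quot_ind => m; apply: lie_proj_eigen.
  by rewrite Mc subrr rpred0.
- by apply: lie_proj_eigen; rewrite v0 subrr rpred0.
by move=> n n0; rewrite -lie_proj_act vp // (lin0 (lie_proj_linear S)).
Qed.

Definition irr_hw c h (M : lieModType Vir) (v : M) (e : M -> K^o) : Prop :=
  [/\ singular c h v, cyclic_vector v, top_functional v e & nondegenerate e].

Lemma irr_hw_quot c h (M : lieModType Vir) (v : M) (e : M -> K^o) :
  singular c h v -> cyclic_vector v -> top_functional v e ->
  exists e', irr_hw c h (lie_proj (proper_sum M) v : lie_quot (proper_sum M))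
    e'.
Proof.
move=> v_sing v_cyc e_top; have [el ev en] := e_top.
have radE := proper_sumE v_sing v_cyc e_top.
have kill m : m \in proper_sum M -> e m = 0.
  by move=> /radE /(_ [::]).
pose e' : lie_quot (proper_sum M) -> K^o := lquot_lift e.
have eE m : e' (lie_proj _ m) = e m by exact: lquot_liftE.
have el' : linear e' by exact: lquot_lift_linear.
exists e'; split.
- exact: lie_quot_singular.
- exact: lie_quot_cyclic.
- split=> //; first by rewrite eE.
  by move=> n q n0; elim/lie_quot_ind: q => m; rewrite -lie_proj_act eE en.
move=> P PL Pe q; elim/lie_quot_ind: q => m Pm; apply/lie_proj_eq0/radE.
apply: (radicalP v_sing v_cyc e_top (P := fun m => P (lie_proj _ m))) Pm =>
  [n x n0 Px|x Px].
  by rewrite lie_proj_act; exact: PL.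
by rewrite -eE; exact: Pe.
Qed.

Lemma Lirr_irr_hw c h : exists e, irr_hw c h (Lirr_hw c h) e.
Proof.
have [e e_top] := verma_top c h.
exact: irr_hw_quot (verma_singular c h) (@verma_cyclic K c h) e_top.
Qed.

Section IrrHw.
Variables (c h : K) (M : lieModType Vir) (v : M) (e : M -> K^o).
Hypothesis M_irr : irr_hw c h v e.

Let v_sing : singular c h v. Proof. by case: M_irr. Qed.
Let v_cyc : cyclic_vector v. Proof. by case: M_irr. Qed.
Let e_top : top_functional v e. Proof. by case: M_irr. Qed.

Lemma irr_hw_neq0 : v != 0.
Proof.
have [el ev _] := e_top; apply: contra_eq_neq ev => ->.
by rewrite (lin0 el) eq_sym oner_neq0.
Qed.

(** A nonzero element of [P] yields a singular one, and irreducibility makes every singular vector a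
    multiple of [v]. *)
Lemma irr_hw_pos (P : M -> Prop) x : subspace P ->
  (forall (n : int) y, 0 < n -> P y -> P (L n y)) -> P x -> x != 0 -> P v.
Proof.
move=> sP PL Px x0.
have [{Px x0}x [{}Px x0] xp] := exists_singular v_sing v_cyc PL Px x0.
have [el ev en] := e_top; have [Mc v0 vp] := v_sing.
have xE : x - e x *: v = 0.
  have [_ _ _ nd] := M_irr.
  (* Both [x] and [v] are singular, so this set is stable under positive modes, and [e] vanishes on
     it because [e v = 1]. *)
  apply: (nd (fun y => y = 0 \/ y = x - e x *: v)); last by right.
    move=> n y n0 [->|->]; left; first by rewrite act0.
    by rewrite actB actZ xp // vp // scaler0 subrr.
  move=> y [->|->]; first exact: (lin0 el).
  by rewrite (linB el) (linZ el) ev -[_ *: _]/(e x * 1) mulr1 subrr.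
move/eqP: xE; rewrite subr_eq0 => /eqP xE.
have ex : e x != 0 by apply: contraNneq x0 => ex; rewrite xE ex scale0r.
have := subspaceZ sP (e x)^-1 Px; rewrite {2}xE scalerA mulVf ?scale1r //.
Qed.

End IrrHw.
End TopFunctional.

(** * Central charge -22/5 *)

Section LowLevels.
Variable K : numFieldType.
Local Notation Vir := (virasoro K).
Local Notation L n := (act (virL K n)).

Section Charge.
Variables (c : K) (M : lieModType Vir).
Hypothesis Mc : has_charge c M.

Lemma act_LLE (n m k : int) (a b : K) : n + m = k -> (n - m)%:~R = a ->
  cocycle c n m = b -> forall x : M,
  L n (L m x) = L m (L n x) + a *: L k x + b *: x.
Proof. by move=> <- <- <- x; exact: act_LL. Qed.

(** [L_n, L_1] = (n - 1) L_(n+1) produces all higher modes from L_1 and L_2. *)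
Lemma pos_generated (x : M) : L 1 x = 0 -> L 2 x = 0 ->
  forall n : int, 0 < n -> L n x = 0.
Proof.
move=> x1 x2 [[//|n] _|//]; elim: n => [//|[//|n] IH].
have n3 : n.+2%:Z + 1 = n.+3 by lia.
have := act_LL Mc n.+2 1 x; rewrite IH x1 !act0 n3 cocycle0; last by apply/eqP;
  lia.
rewrite scale0r add0r addr0 => /esym/eqP; rewrite scaler_eq0 intr_eq0.
by case/orP => [/eqP|/eqP //]; lia.
Qed.

End Charge.

Lemma irr_hw_eq0 c h (M : lieModType Vir) (v : M) e : irr_hw c h v e ->
  forall x, L 1 x = 0 -> L 2 x = 0 -> e x = 0 -> x = 0.
Proof.
move=> [[Mc _ _] _ [el _ _] nd] x x1 x2 ex.
apply: (nd (fun y => y = 0 \/ y = x)); last by right.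
  by move=> n y n0 [->|->]; left; rewrite ?act0 // (pos_generated Mc).
by move=> y [] ->; rewrite ?(lin0 el).
Qed.

Section Vacuum.
Variables (M : lieModType Vir) (v : M) (e : M -> K^o).
Hypothesis M_irr : irr_hw (- (22 / 5)) 0 v e.

Let Mc : has_charge (- (22 / 5)) M. Proof. by case: M_irr => -[]. Qed.
Let v0 : L 0 v = 0. Proof. by case: M_irr => -[_ -> _] _ _ _; rewrite scale0r.
  Qed.
Let vp (n : int) : 0 < n -> L n v = 0. Proof. by case: M_irr => -[_ _ vp] _ _ _;
  exact: vp. Qed.
Let el : linear e. Proof. by case: M_irr => _ _ []. Qed.
Let eneg (n : int) x : n < 0 -> e (L n x) = 0.
Proof. by case: M_irr => _ _ [_ _ en] _; exact: en. Qed.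

Let v1 : L 1 v = 0. Proof. exact: vp. Qed.
Let v2 : L 2 v = 0. Proof. exact: vp. Qed.

Lemma vacuum_translation : L (-1) v = 0.
Proof.
apply: (irr_hw_eq0 M_irr); last exact: eneg.
  rewrite (act_LLE Mc (k := 0) (a := 2) (b := 0)) //.
    by rewrite v0 vp // act0 scaler0 scale0r !addr0.
  by rewrite /cocycle /= expr1n subrr !mul0r.
rewrite (act_LLE Mc (k := 1) (a := 3) (b := 0)) //.
by rewrite !vp // act0 scaler0 scale0r !addr0.
Qed.

(** The difference is singular: L_1 gives 3 - (3/5) 5 times L_(-3) v, and L_2 gives (8 + c) - (3/5)
    6 times L_(-2) v, which vanishes for c = -22/5. *)
Lemma vacuum_null : L (-2) (L (-2) v) = 3 / 5 *: L (-4) v.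
Proof.
have C1 := act_LLE Mc (n := 1) (m := -2) (k := -1) (a := 3) (b :=
  0) erefl erefl erefl.
have C2 := act_LLE Mc (n := 1) (m := -4) (k := -3) (a := 5) (b :=
  0) erefl erefl erefl.
have C3 := act_LLE Mc (n := -1) (m := -2) (k := -3) (a := 1) (b :=
  0) erefl erefl erefl.
have cE : cocycle (- (22 / 5)) 2 (-2) = - (11 / 5) :> K.
  by rewrite /cocycle /= (_ : (2 ^+ 3 - 2)%:~R = 6 :> K) //; field.
have C4 := act_LLE Mc (n := 2) (m := -2) (k := 0) (a := 4) erefl erefl cE.
have C5 := act_LLE Mc (n := 2) (m := -4) (k := -2) (a := 6) (b :=
  0) erefl erefl erefl.
have C6 := act_LLE Mc (n := 0) (m := -2) (k := -2) (a := 2) (b :=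
  0) erefl erefl erefl.
apply/eqP; rewrite -subr_eq0; apply/eqP; apply: (irr_hw_eq0 M_irr).
- rewrite !actE !(C1, C2, C3, actE) vacuum_translation v1 !act0.
  by lincomb K; field.
- rewrite !actE !(C4, C5, C6, actE) v0 v2 !act0.
  by lincomb K; field.
by rewrite (linB el) (linZ el) !eneg // scaler0 subr0.
Qed.

End Vacuum.

(** This is the transpose under [e] of the null vector L_(-1)^2 - (2/5) L_(-2). Negative modes are
    moved to the front, where [e] kills them. L_(-1) leaves 4 h + 2 = 6/5, L_(-2) leaves 6 h =
    (2/5)(4 h + c/2), and deeper modes leave nothing. *)
Lemma level_two_null (M : lieModType Vir) (v : M) (e : M -> K^o) :
  irr_hw (- (22 / 5)) (- (1 / 5)) v e ->
  forall x, e (L 1 (L 1 x)) = 2 / 5 * e (L 2 x).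
Proof.
move=> M_irr; have [v_sing v_cyc e_top _] := M_irr.
have [Mc v0 vp] := v_sing; have [el ev en] := e_top.
have e0 := top_L0 v_sing v_cyc e_top.
apply: (neg_word_ind v_sing v_cyc) => [||a x _].
- split=> [|b x y ex ey]; first by rewrite !act0 (lin0 el) mulr0.
  rewrite !actE !el ex ey mulrDr; congr (_ + _); exact: mulrCA.
- by rewrite !vp // act0 (lin0 el) mulr0.
have eN a' y : e (L (Negz a') y) = 0 by exact: en.
case: a => [|[|a]].
- have C0 : forall y : M, _ := act_LLE Mc (n := 1) (m := 0) (k := 1) (a :=
    1) (b := 0) erefl erefl erefl.
  rewrite (act_LLE Mc (n := 1) (m := Negz 0) (k := 0) (a := 2) (b := 0)) //;
    last first.
    by rewrite /cocycle /= expr1n subrr !mul0r.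
  rewrite (act_LLE Mc (n := 2) (m := Negz 0) (k := 1) (a := 3) (b := 0)) //.
  rewrite !actE (act_LLE Mc (n := 1) (m := Negz 0) (k := 0) (a := 2) (b :=
    0)) //; last first.
    by rewrite /cocycle /= expr1n subrr !mul0r.
  rewrite !C0 !(linD el, linZ el) !e0 !eN; set z := e _.
  by rewrite -![_ *: _]/(_ * _); field.
- have cE : cocycle (- (22 / 5)) 2 (Negz 1) = - (11 / 5) :> K.
    by rewrite /cocycle /= (_ : (2 ^+ 3 - 2)%:~R = 6 :> K) //; field.
  have C2 := act_LLE Mc (n := 1) (m := Negz 1) (k := Negz 0) (a := 3) (b :=
    0) erefl erefl erefl.
  have C3 : forall y : M, _ := act_LLE Mc (n := 1) (m := Negz 0) (k := 0) (a :=
    2) (b := cocycle _ 1 (Negz 0)) erefl erefl erefl.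
  have C4 : forall y : M, _ := act_LLE Mc (n := 2) (m := Negz 1) (k := 0) (a :=
    4) erefl erefl cE.
  have cE' : cocycle (- (22 / 5)) 1 (Negz 0) = 0 :> K.
    by rewrite /cocycle /= expr1n subrr !mul0r.
  rewrite !(C2, C4, actE) !(C2, C3, actE) cE' !(linD el, linZ el) !e0 !eN;
    set z := e _.
  by rewrite -![_ *: _]/(_ * _); field.
have E1 b : 1 + Negz b.+1 = Negz b by lia.
have E2 : 2 + Negz a.+2 = Negz a by lia.
have C1 b : forall y : M, _ := act_LLE Mc (E1 b) erefl (cocycle0 _ (isT : Negz
  b.+1 != -1)).
have C2 : forall y : M, _ := act_LLE Mc E2 erefl (cocycle0 _ (isT : Negz a.+2 !=
  -2)).
rewrite !(C1, C2, actE) !(linD el, linZ el) !eN.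
by rewrite -![_ *: _]/(_ * _); ring.
Qed.

End LowLevels.

(** * The primary field in Hom(V_(0,6/5), L(c,h)) and the map it induces *)

Section Fusion.
Variable K : numFieldType.
Local Notation Vir := (virasoro K).
Local Notation L n := (act (virL K n)).
Local Notation c := (- (22 / 5) : K).
Local Notation h := (- (1 / 5) : K).
Local Notation beta := (6 / 5 : K).

Variables (M : lieModType Vir) (phi : M) (e : M -> K^o).
Hypothesis M_irr : irr_hw c h phi e.

Let phi_sing : singular c h phi. Proof. by case: M_irr. Qed.
Let Mc : has_charge c M. Proof. by case: phi_sing. Qed.
Let phi0 : L 0 phi = h *: phi. Proof. by case: phi_sing. Qed.
Let phip (n : int) : 0 < n -> L n phi = 0. Proof. by case: phi_sing => _ _;
  apply. Qed.
Let el : linear e. Proof. by case: M_irr => _ _ []. Qed.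

Let fctE' : (forall (f g : int -> M) m, (f + g) m = f m + g m) *
  (forall (f : int -> M) m, (- f) m = - f m) *
  (forall a (f : int -> M) m, (a *: f) m = a *: f m).
Proof. by []. Qed.

(* The action on [Hom(V_(0,6/5), M)], a linear map being given by the images
   of the basis vectors [v_m]. *)
Definition hom_act (n : int) (f : int -> M) : int -> M := fun m =>
  L n (f m) + (m%:~R + beta + n%:~R * beta) *: f (m + n).

Fact hom_act_linear n : linear (hom_act n).
Proof.
move=> a f g; apply: funext => m; rewrite /hom_act /=.
rewrite !fctE' actD actZ; lincomb K; ring.
Qed.

Fact hom_act_rel : vir_rel c hom_act.
Proof.
move=> n k f; apply: funext => m.
rewrite /hom_act !fctE' !(actD, actZ) (act_LL Mc n k).
have -> : m + k + n = m + n + k by ring.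
have -> : m + (n + k) = m + n + k by ring.
by lincomb K; field.
Qed.

Local Notation hom_mod := (vir_rep hom_act_linear hom_act_rel).

Fixpoint descendant (k : nat) : M :=
  if k is k'.+1 then k%:R^-1 *: L (-1) (descendant k') else phi.

Let descS k : L (-1) (descendant k) = k.+1%:R *: descendant k.+1.
Proof. by rewrite /= scalerA mulfV ?scale1r // pnatr_eq0. Qed.

Let desc0 k : L 0 (descendant k) = (k%:R - 1 / 5) *: descendant k.
Proof.
elim: k => [|k IH]; first by rewrite phi0 sub0r.
rewrite [descendant _]/= actZ (act_LLE Mc (k := -1) (a := 1) (b := 0)) //.
rewrite IH actZ scale0r addr0 -!scalerDl !scalerA -!natr1.
by congr (_ *: _); ring.
Qed.

Let desc1 k : L 1 (descendant k.+1) = (k%:R - 2 / 5) *: descendant k.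
Proof.
have C := act_LLE Mc (n := 1) (m := -1) (k := 0) (a := 2)
  (b := cocycle c 1 (-1)) erefl erefl erefl.
have cE : cocycle c 1 (-1) = 0 by rewrite /cocycle /= expr1n subrr !mul0r.
elim: k => [|k IH]; rewrite [descendant _.+1]/= actZ C cE scale0r addr0.
  by rewrite phi0 phip // act0 invr1; lincomb K; field.
rewrite -/(descendant k.+1) IH actZ descS desc0.
have k2 : k.+2%:R != 0 :> K by rewrite pnatr_eq0.
by rewrite -!natr1 in k2 *; lincomb K; field.
Qed.

Let desc2 k : L 2 (descendant k.+2) = (k%:R - 3 / 5) *: descendant k.
Proof.
have C := act_LLE Mc (n := 2) (m := -1) (k := 1) (a := 3) (b := 0)
  erefl erefl erefl.
have d1 : L 2 (descendant 1) = 0.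
  by rewrite [descendant _]/= actZ C !phip // act0 scaler0 scale0r !addr0
    scaler0.
elim: k => [|k IH]; rewrite [descendant _.+2]/= actZ C scale0r addr0
  -/(descendant _.+1) desc1.
  by rewrite d1 act0; lincomb K; field.
rewrite IH actZ descS.
have k3 : k.+3%:R != 0 :> K by rewrite pnatr_eq0.
by rewrite -!natr1 in k3 *; lincomb K; field.
Qed.

Definition primary : int -> M := fun m => if m is Negz k then descendant k else
  0.

(** L_n maps the (k + n)-th descendant to ((n + 1) h + k) times the k-th, so the total coefficient
    is (n + 1)(h + beta - 1), and beta = 1 - h. It is enough to check n = 0, 1, 2. *)
Lemma primary_singular : singular c 0 (primary : hom_mod).
Proof.
have H : has_charge c hom_mod by exact: vir_rep_charge.
have E n : L n (primary : hom_mod) = hom_act n primary by exact: vir_rep_L.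
split=> //; last apply: (pos_generated H).
- rewrite E scale0r; apply: funext => -[m|k]; rewrite /hom_act addr0.
    by rewrite /= act0 scaler0 addr0.
  by rewrite /= desc0 -scalerDl [X in X *: _](_ : _ = 0) ?scale0r // NegzE;
    field.
- rewrite E; apply: funext => -[m|[|k]]; rewrite /hom_act.
  + by rewrite /= act0 scaler0 addr0.
  + by rewrite /= phip // scaler0 addr0.
  rewrite (_ : Negz k.+1 + 1 = Negz k); last by lia.
  rewrite ![primary _]/= -/(descendant k.+1) desc1.
  by rewrite -scalerDl [X in X *: _](_ : _ = 0) ?scale0r // NegzE; field.
rewrite E; apply: funext => -[m|[|[|k]]]; rewrite /hom_act.
- by rewrite /= act0 scaler0 addr0.
- by rewrite /= phip // scaler0 addr0.
- rewrite /= invr1 scale1r scaler0 addr0.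
  rewrite (act_LLE Mc (k := 1) (a := 3) (b := 0)) //.
  by rewrite !phip // act0 scaler0 scale0r !addr0.
rewrite (_ : Negz k.+2 + 2 = Negz k); last by lia.
rewrite ![primary _]/= -/(descendant k.+1) -/(descendant k.+2) desc2.
by rewrite -scalerDl [X in X *: _](_ : _ = 0) ?scale0r // NegzE; field.
Qed.

(** Induction on the degree bound of [r]. Since [G] kills L_n r for n > 0 and L_0 r - (D + 1) r,
    which have smaller bounds, [G r] is annihilated by positive modes and has weight D + 1; these
    are [gp] and [g0]. *)
Lemma fusion_kill (G : verma c 0 -> hom_mod) : lie_hom G ->
  forall r, r \in proper_sum (verma c 0) -> G r = 0.
Proof.
move=> [Gl Ga] r rR.
have [e0 e0_top] := verma_top c (0 : K).
have v_sing := verma_singular c (0 : K); have v_cyc := @verma_cyclic K c 0.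
have [D Dr] := deg_le_exhaust v_sing v_cyc r.
elim: D r rR Dr => [|D IH] r rR Dr.
  have [a rE] := deg_le0 Dr.
  have := proper_sumE v_sing v_cyc e0_top r; rewrite rR =>
    -[/(_ isT [::]) /= er _].
  have [e0l e0v _] := e0_top; move: er; rewrite rE (linZ e0l) e0v.
  by rewrite -[_ *: _]/(a * 1) mulr1 => ->; rewrite scale0r (lin0 Gl).
have gp n m : 0 < n -> L n (G r m) = - (m%:~R + beta + n%:~R * beta) *: G r (m +
  n).
  move=> n0; have : G (L n r) = 0.
    apply: IH; first exact: act_stable.
    by apply: deg_leW (deg_le_L v_sing n Dr); lia.
  rewrite Ga vir_rep_L => /(congr1 (fun f : int -> M => f m)) /eqP.
  by rewrite [X in X == _]/(hom_act n (G r) m) addr_eq0 scaleNr => /eqP.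
have g0 m : L 0 (G r m) = ((D.+1%:R : K) - m%:~R - beta) *: G r m.
  have : G (L 0 r - D.+1%:R *: r) = 0.
    apply: IH.
      by rewrite rpredB ?rpredZ //; exact: act_stable.
    by have := deg_le_shift v_sing Dr; rewrite add0r -pmulrn (_ : D.+1%:Z - 1 =
      D) //; lia.
  rewrite (linB Gl) (linZ Gl) Ga vir_rep_L.
  move=> /(congr1 (fun f : int -> M => f m)).
  rewrite [X in X = _ -> _]/(hom_act 0 (G r) m - D.+1%:R *: G r m) /hom_act.
  rewrite addr0 => /eqP; rewrite subr_eq0 => /eqP gE.
  apply: (addIr ((m%:~R + beta + 0%:~R * beta) *: G r m)).
  by rewrite gE; lincomb K; ring.
(* By [gp] the multiples of the values of [G r] are stable under positive modes, so nondegeneracy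
   applies once [e] vanishes on the values. *)
suff gz m : e (G r m) = 0.
  apply: funext => m; have [_ _ _ nd] := M_irr.
  apply: (nd (fun x => exists a k, x = a *: G r k)); last by exists 1, m;
    rewrite scale1r.
    move=> n x n0 [a [k ->]]; rewrite actZ gp // scalerA; by do 2!eexists.
  by move=> x [a [k ->]]; rewrite (linZ el) gz scaler0.
have [_ v_cyc' e_top _] := M_irr.
have scaleE (a b : K) : a *: (b : K^o) = a * b by [].
(* Comparing [g0] with [top_L0] gives (D - m) e (G r m) = 0, which leaves m = D only. *)
have [mD|mD] := eqVneq m D; last first.
  pose x : K := e (G r m).
  have te : ((D.+1%:R : K) - m%:~R - beta) * x = h * x.
    by rewrite -[RHS](top_L0 phi_sing v_cyc' e_top) g0 (linZ el).
  have : ((D.+1%:R : K) - m%:~R - beta - h) * x = 0 by rewrite mulrBl te subrr.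
  move/eqP; rewrite mulf_eq0; case/orP => [|/eqP //].
  rewrite (_ : _ - h = (D%:Z - m)%:~R); last first.
    by rewrite rmorphB /= -natr1 -pmulrn; field.
  by rewrite intr_eq0 subr_eq0 eq_sym (negPf mD).
pose x : K := e (G r m).
have te : ((m%:~R : K) - 2 + beta + beta) * ((m%:~R : K) - 1 + beta + beta) * x
  =
    2 / 5 * - ((m%:~R : K) - 2 + beta + 2 * beta) * x.
  have := level_two_null M_irr (G r (m - 2)).
  rewrite !gp // actZ gp // scalerA !(linZ el) scaleE.
  rewrite (_ : m - 2 + 1 + 1 = m); last by ring.
  rewrite (_ : m - 2 + 2 = m); last by ring.
  rewrite -/x !scaleE => te.
  by apply: etrans (etrans _ te) _; ring.
(* With d = D + 1 the factor is 5 d (d + 1/5), written as a natural number so that it is visibly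
   nonzero. *)
have : (D.+1 * (5 * D + 6))%N%:R * x = 0.
  have -> : (D.+1 * (5 * D + 6))%N%:R = 5 * (((m%:~R : K) - 2 + beta + beta) *
    ((m%:~R : K) - 1 + beta + beta) - 2 / 5 * - ((m%:~R : K) - 2 + beta + 2 *
    beta)) :> K.
    by rewrite mD !natrM natrD natrM -natr1 -!pmulrn; field.
  by rewrite -mulrA mulrBl te subrr mulr0.
by move/eqP; rewrite mulf_eq0 pnatr_eq0 muln_eq0 addn_eq0 andbF => /orP[|/eqP].
Qed.

(** A homomorphism from L(c,0) to Hom(V, M) is the same as a homomorphism from the tensor product to
    [M], by evaluation. *)
Lemma fusion_map :
  exists2 F : lie_tensor (inter 0 beta) (Lirr c 0) -> M, lie_hom F &
    forall m, F (tens (inter_v 0 beta m) (Lirr_hw c 0)) = primary m.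
Proof.
have [G0 G0h G0v] := verma_lift primary_singular.
have [G [Gl Ga] GE] := lie_quot_lift G0h (fusion_kill G0h).
pose f (x : inter 0 beta) (y : Lirr c 0) : M := fglift (G y : int -> M) x.
have fl y : linear (f^~ y) by exact: fglift_linear.
have fE m y : f (inter_v 0 beta m) y = G y m by rewrite /f liftU scale1r.
have fr x : linear (f x).
  move=> a y z; pose g u := a *: f u y + f u z.
  apply: (@freeg_linear_eq K int M (f^~ (a *: y + z)) g).
  - exact: fl.
  - by move=> b u w; rewrite /g !fl; lincomb K; ring.
  - by move=> m; rewrite /g !fE Gl.
have FE := tensor_liftE fl fr; have Fl := tensor_lift_linear fl fr.
exists (tensor_lift f); last first.
  by move=> m; rewrite FE fE /Lirr_hw GE G0v.
split=> // z t; elim/tensor_ind: t => [|a x y t IH];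
  first by rewrite !act0 (lin0 Fl) act0.
rewrite actD actZ Fl IH Fl actD actZ; congr (_ *: _ + _).
rewrite tens_act (linD Fl) !FE.
move: z {IH}; apply: vir_ind => [|b z w hz hw||n].
- by rewrite !(lin0 (act_linl _)) (lin0 (fl _)) (lin0 (fr _)) addr0.
- by rewrite !act_linl fl fr -hz -hw scalerDr addrACA.
- have [Lc _ _] := lie_quot_singular (proper_sum (verma c 0)) (verma_singular c
    (0 : K)).
  rewrite Mc Lc (linZ (fr _)) (_ : act _ x = 0) ?(lin0 (fl _)) ?add0r //.
  elim/freeg_lin_ind: x => [|d m x IHx]; first by rewrite act0.
  by rewrite act_linr IHx addr0 [act _ _]act_interE scaler0.
elim/freeg_lin_ind: x => [|d m x IHx].
  by rewrite act0 !(lin0 (fl _)) act0 addr0.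
rewrite act_linr !fl [RHS]act_linr -IHx addrACA -scalerDr; congr (_ *: _ + _).
rewrite -/(inter_v 0 beta m).
have -> : act (virL K n) (inter_v 0 beta m) =
    - (m%:~R + 0 + beta + n%:~R * beta) *: inter_v 0 beta (m + n).
  exact: (act_interE 0 beta (Some n) m).
rewrite (linZ (fl _)).
by rewrite !fE Ga vir_rep_L /hom_act addr0 scaleNr addrC addrK.
Qed.

End Fusion.

(** * The weight 4 field of the null vector and its commutators with L_(-1) and L_(-2) *)

Section Primary4.
Variable K : numFieldType.
Local Notation Vir := (virasoro K).
Local Notation L n := (act (virL K n)).
Local Notation c := (- (22 / 5) : K).
Variable M : lieModType Vir.
Hypothesis Mc : has_charge c M.

Let adm1 p (y : M) : L (-1) (L p y) = L p (L (-1) y) + (-1 - p)%:~R *: L (p - 1)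
  y.
Proof.
rewrite (act_LL Mc) [-1 + p]addrC /cocycle; case: eqP => [->|_].
  by rewrite (_ : (-1) ^+ 3 - -1 = 0 :> int) // !mul0r scale0r addr0.
by rewrite scale0r addr0.
Qed.

Let kappa (p : int) : K := if p == 2 then 11 / 5 else 0.

Let adm2 p (y : M) : L (-2) (L p y) =
  L p (L (-2) y) + (-2 - p)%:~R *: L (p - 2) y + kappa p *: y.
Proof.
rewrite (act_LL Mc) [-2 + p]addrC /cocycle opprK /kappa; case: eqP => // _.
by rewrite (_ : ((-2) ^+ 3 + 2)%:~R = - 6 :> K) //; congr (_ + _ *: _); field.
Qed.

(** As [A] grows this is mode n of the normally ordered square of the Virasoro field. The vector
    L_(-4) v corresponds to half the second derivative of that field, with modes (n + 2)(n + 3)/2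
    L_n; times 3/5 this is the correction in [null_mode]. *)
Definition quad (A : nat) (n : int) (x : M) : M := \sum_(i < A)
  (L (- 2 - i%:Z) (L (n + 2 + i%:Z) x) + L (n + 1 - i%:Z) (L (i%:Z - 1) x)).

(* The mode [n] of the field of the null vector [L_(-2)^2 - 3/5 L_(-4)], with
   the infinite normally ordered sum truncated at [A]. *)
Definition null_mode (A : nat) (n : int) (x : M) : M :=
  quad A n x - (3 / 10 * (n%:~R + 2) * (n%:~R + 3)) *: L n x.

Let quad0 n x : quad 0 n x = 0. Proof. exact: big_ord0. Qed.

Let quadS A n x : quad A.+1 n x = quad A n x +
  (L (- 2 - A%:Z) (L (n + 2 + A%:Z) x) + L (n + 1 - A%:Z) (L (A%:Z - 1) x)).
Proof. exact: big_ord_recr. Qed.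

Let LE (p q : int) (x : M) : p = q -> L p x = L q x. Proof. by move=> ->. Qed.
Let LLE (p q r s : int) (x : M) : p = q -> r = s -> L p (L r x) = L q (L s x).
Proof. by move=> -> ->. Qed.

(** Bracketing with L_(-1) shifts one factor of each summand; reindexing restores [quad] at n - 1 up
    to two terms at the cutoff [A], which vanish on a given vector for large [A]. *)
Lemma quad_L1 A n x : L (-1) (quad A n x) = quad A n (L (-1) x) -
  (n%:~R + 3) *: quad A (n - 1) x +
  A%:R *: L (- 2 - A%:Z) (L (n + 1 + A%:Z) x) +
  A%:R *: L (n + 1 - A%:Z) (L (A%:Z - 2) x).
Proof.
elim: A => [|A IH].
  by rewrite !quad0 act0 !scale0r scaler0 subrr !addr0.
rewrite !quadS !actD IH !adm1 !actE ?adm1 ?actE.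
rewrite [L (- 2 - A.+1%:Z) _](@LLE _ (- 2 - A%:Z - 1) _ (n + 2 + A%:Z));
  try lia.
rewrite [L (n + 1 - A.+1%:Z) _](@LLE _ (n + 1 - A%:Z - 1) _ (A%:Z - 1));
  try lia.
rewrite [L (- 2 - A%:Z) (L (n - 1 + 2 + A%:Z) x)](@LLE _ (- 2 - A%:Z) _ (n + 1 +
  A%:Z)); try lia.
rewrite [L (n - 1 + 1 - A%:Z) _](@LLE _ (n + 1 - A%:Z - 1) _ (A%:Z - 1));
  try lia.
rewrite [L (- 2 - A%:Z) (L (n + 2 + A%:Z - 1) x)](@LLE _ (- 2 - A%:Z) _ (n + 1 +
  A%:Z)); try lia.
rewrite [L (n + 1 - A%:Z) (L (A%:Z - 1 - 1) x)](@LLE _ (n + 1 - A%:Z) _ (A%:Z -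
  2)); try lia.
rewrite -natr1; lincomb K; ring.
Qed.

Definition central_sum (A : nat) (n : int) (x : M) : M := \sum_(i < A)
  (kappa (n + 2 + i%:Z) *: L (- 2 - i%:Z) x + kappa (n + 1 - i%:Z) *: L (i%:Z -
    1) x
    + kappa (i%:Z - 1) *: L (n + 1 - i%:Z) x).

Let csS A n x : central_sum A.+1 n x = central_sum A n x +
  (kappa (n + 2 + A%:Z) *: L (- 2 - A%:Z) x + kappa (n + 1 - A%:Z) *: L (A%:Z -
    1) x
    + kappa (A%:Z - 1) *: L (n + 1 - A%:Z) x).
Proof. exact: big_ord_recr. Qed.

(** The reindexing is now by two steps: it leaves fixed terms from the start of the sum and more
    terms at the cutoff, and the central terms are collected in [central_sum]. *)
Lemma quad_L2 A n x : L (-2) (quad A n x) = quad A n (L (-2) x) -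
  (n%:~R + 6) *: quad A (n - 2) x + central_sum A n x +
  (2 *: L (-2) (L n x) + L (-3) (L (n + 1) x) - 2 *: L n (L (-2) x)
    - L (n + 1) (L (-3) x)) +
  ((A%:R - 2) *: L (- 2 - A%:Z) (L (n + A%:Z) x) +
   (A%:R - 1) *: L (- 3 - A%:Z) (L (n + 1 + A%:Z) x) +
   (A%:R + 1) *: L (n + 1 - A%:Z) (L (A%:Z - 3) x) +
   (A%:R + 2) *: L (n - A%:Z) (L (A%:Z - 2) x)).
Proof.
elim: A => [|A IH].
  rewrite !quad0 /central_sum big_ord0 act0.
  rewrite [L (- 2 - 0%N%:Z) _](@LLE _ (-2) _ n); try lia.
  rewrite [L (- 3 - 0%N%:Z) _](@LLE _ (-3) _ (n + 1)); try lia.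
  rewrite [L (n + 1 - 0%N%:Z) _](@LLE _ (n + 1) _ (-3)); try lia.
  rewrite [L (n - 0%N%:Z) _](@LLE _ n _ (-2)); try lia.
  by lincomb K; ring.
rewrite !quadS csS !actD IH !adm2 !actE ?adm2 ?actE.
have k0 : kappa (- 2 - A%:Z) = 0 by rewrite /kappa; case: eqP => //; lia.
rewrite k0 scale0r addr0.
rewrite [L (- 2 - A.+1%:Z) _](@LLE _ (- 3 - A%:Z) _ (n + 1 + A%:Z)); try lia.
rewrite [L (- 3 - A.+1%:Z) _](@LLE _ (- 2 - A%:Z - 2) _ (n + 2 + A%:Z));
  try lia.
rewrite [L (n + 1 - A.+1%:Z) _](@LLE _ (n - A%:Z) _ (A%:Z - 2)); try lia.
rewrite [L (n - A.+1%:Z) _](@LLE _ (n + 1 - A%:Z - 2) _ (A%:Z - 1)); try lia.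
rewrite [L (- 2 - A%:Z) (L (n - 2 + 2 + A%:Z) x)](@LLE _ (- 2 - A%:Z) _ (n +
  A%:Z)); try lia.
rewrite [L (n - 2 + 1 - A%:Z) _](@LLE _ (n + 1 - A%:Z - 2) _ (A%:Z - 1));
  try lia.
rewrite [L (- 2 - A%:Z) (L (n + 2 + A%:Z - 2) x)](@LLE _ (- 2 - A%:Z) _ (n +
  A%:Z)); try lia.
rewrite [L (n + 1 - A%:Z) (L (A%:Z - 1 - 2) x)](@LLE _ (n + 1 - A%:Z) _ (A%:Z -
  3)); try lia.
rewrite -natr1; lincomb K; ring.
Qed.

Hypothesis M_res : forall x : M,
  exists N : nat, forall n : int, N%:Z <= n -> L n x = 0.

Lemma null_mode_L1 n x : exists A0, forall A, (A0 <= A)%N ->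
  null_mode A n (L (-1) x) =
  L (-1) (null_mode A n x) + (n%:~R + 3) *: null_mode A (n - 1) x.
Proof.
have [N xN] := M_res x; exists (N + `|n| + 3)%N => A AN.
rewrite /null_mode actB actZ quad_L1 adm1 [L (n + 1 + _) x]xN; last by lia.
rewrite [L (A%:Z - 2) x]xN; last by lia.
by rewrite !act0; lincomb K; field.
Qed.

Let sum_kappa (A i0 : nat) (f : nat -> int) (g : nat -> M) : (i0 < A)%N ->
  f i0 = 2 -> (forall i, i <> i0 -> f i <> 2) ->
  \sum_(i < A) kappa (f i) *: g i = (11 / 5) *: g i0.
Proof.
move=> iA f2 fn; rewrite (bigD1 (Ordinal iA)) //= /kappa f2 eqxx big1 ?addr0 //
  => i ne.
by case: eqP => [/fn|_]; rewrite ?scale0r //; case;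
  apply: contra_neq_not ne => e; exact: val_inj.
Qed.

Let sum_kappa0 (A : nat) (f : nat -> int) (g : nat -> M) :
  (forall i, f i <> 2) -> \sum_(i < A) kappa (f i) *: g i = 0.
Proof.
by move=> fn; rewrite big1 // => i _; rewrite /kappa; case: eqP => [/fn//|_];
  rewrite scale0r.
Qed.

(** Exactly two summands survive, each equal to (11/5) L_(n-2) x: the last kind at i = 3, and either
    the first kind at i = -n or the second at i = n - 1, according to the sign of n. *)
Lemma central_sumE A n x : (`|n| + 4 <= A)%N ->
  central_sum A n x = (22 / 5) *: L (n - 2) x.
Proof.
move=> nA; rewrite /central_sum !big_split /=.
rewrite (@sum_kappa A 3 (fun i => i%:Z - 1) (fun i => L (n + 1 - i%:Z) x));
  try lia.
have -> : n + 1 - 3%N%:Z = n - 2 by lia.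
have [n0|n0] := leP n 0.
  rewrite (@sum_kappa A `|n| (fun i => n + 2 + i%:Z) (fun i =>
    L (- 2 - i%:Z) x)); try lia.
  rewrite (@sum_kappa0 A (fun i => n + 1 - i%:Z) (fun i => L (i%:Z - 1) x));
    last by move=> i; lia.
  have -> : - 2 - `|n|%N%:Z = n - 2 by lia.
  by lincomb K; field.
rewrite (@sum_kappa A `|n|.-1 (fun i => n + 1 - i%:Z) (fun i =>
  L (i%:Z - 1) x)); try lia.
rewrite (@sum_kappa0 A (fun i => n + 2 + i%:Z) (fun i => L (- 2 - i%:Z) x));
  last by move=> i; lia.
have -> : `|n|.-1%:Z - 1 = n - 2 by lia.
by lincomb K; field.
Qed.

Lemma null_mode_L2 n x : exists A0, forall A, (A0 <= A)%N ->
  null_mode A n (L (-2) x) =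
  L (-2) (null_mode A n x) + (n%:~R + 6) *: null_mode A (n - 2) x.
Proof.
have [N xN] := M_res x; exists (N + `|n| + 4)%N => A AN.
rewrite /null_mode actB actZ quad_L2 central_sumE; last by lia.
rewrite [L (n + A%:Z) x]xN; last by lia.
rewrite [L (n + 1 + A%:Z) x]xN; last by lia.
rewrite [L (A%:Z - 3) x]xN; last by lia.
rewrite [L (A%:Z - 2) x]xN; last by lia.
rewrite !act0 (act_LL Mc (-3)) !adm2.
rewrite (LE x (_ : -3 + (n + 1) = n - 2)); last by lia.
(* Only at n = 2 do [L_(-2), L_n] and [L_(-3), L_(n+1)] contribute central terms, 11/5 and 44/5. *)
have [->|n2] := eqVneq n 2.
  rewrite /kappa eqxx (_ : cocycle c (-3) (2 + 1) = 44 / 5); last first.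
    by rewrite /cocycle /= (_ : ((-3) ^+ 3 - -3)%:~R = - 24 :> K) //; field.
  by lincomb K; field.
rewrite cocycle0; last by lia.
by rewrite /kappa (negPf n2); lincomb K; field.
Qed.

(** Vanishing is required for all large cutoffs, so that finitely many such conditions hold at a
    common one. *)
Definition null_mode_zero (n : int) (x : M) : Prop :=
  exists A0, forall A, (A0 <= A)%N -> null_mode A n x = 0.

Let quadD a A n x y : quad A n (a *: x + y) = a *: quad A n x + quad A n y.
Proof.
elim: A => [|A IH]; first by rewrite !quad0 scaler0 addr0.
by rewrite !quadS IH !actE; lincomb K; ring.
Qed.

Lemma null_mode_linear A n : linear (null_mode A n).
Proof. by move=> a x y; rewrite /null_mode quadD !actE; lincomb K; ring. Qed.

Lemma null_mode_zero_subspace n : subspace (null_mode_zero n).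
Proof.
split=> [|a x y [A xA] [B yB]].
  exists 0%N => A _; rewrite /null_mode act0 scaler0 subr0.
  by elim: A => // A IH; rewrite quadS IH !act0 !addr0.
exists (A + B)%N => D DAB.
by rewrite null_mode_linear xA ?yB ?scaler0 ?addr0 //; lia.
Qed.

Lemma null_mode_zero_L1 n x : null_mode_zero n x -> null_mode_zero (n - 1) x ->
  null_mode_zero n (L (-1) x).
Proof.
move=> [A xA] [B xB]; have [D xD] := null_mode_L1 n x.
exists (A + B + D)%N => E EE.
by rewrite xD ?xA ?xB ?act0 ?scaler0 ?addr0 //; lia.
Qed.

Lemma null_mode_zero_L2 n x : null_mode_zero n x -> null_mode_zero (n - 2) x ->
  null_mode_zero n (L (-2) x).
Proof.
move=> [A xA] [B xB]; have [D xD] := null_mode_L2 n x.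
exists (A + B + D)%N => E EE.
by rewrite xD ?xA ?xB ?act0 ?scaler0 ?addr0 //; lia.
Qed.

(** L_(-1) and L_(-2) generate the negative modes, since [L_(-1), L_(-k)] = (k - 1) L_(-k-1). *)
Lemma null_mode_zero_neg a x : (forall n, null_mode_zero n x) ->
  forall n, null_mode_zero n (L (Negz a) x).
Proof.
elim: a x => [|[|a] IH] x xZ n; first exact: null_mode_zero_L1.
  exact: null_mode_zero_L2.
have sZ := null_mode_zero_subspace n.
have := adm1 (Negz a.+1) x.
rewrite (LE x (_ : Negz a.+1 - 1 = Negz a.+2)); last by lia.
move=> e; have -> : L (Negz a.+2) x = (-1 - Negz a.+1)%:~R^-1 *:
    ((-1) *: L (Negz a.+1) (L (-1) x) + L (-1) (L (Negz a.+1) x)).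
  rewrite e scaleN1r addKr scalerA mulVf ?scale1r // intr_eq0; lia.
apply: (subspaceZ sZ); apply: sZ.2.
  by apply: IH => m; exact: null_mode_zero_L1.
by apply: null_mode_zero_L1; exact: IH.
Qed.

End Primary4.

(** * Irreducibility from the null vectors at levels 2 and 3 *)

Section NullModule.
Variable K : numFieldType.
Local Notation Vir := (virasoro K).
Local Notation L n := (act (virL K n)).
Local Notation c := (- (22 / 5) : K).
Local Notation h := (- (1 / 5) : K).

Variables (M : lieModType Vir) (q : M).
Hypotheses (q_sing : singular c h q) (q_cyc : cyclic_vector q).
Hypothesis null2 : L (-1) (L (-1) q) = (2 / 5) *: L (-2) q.
Hypothesis null3 : L (-2) (L (-1) q) = (1 / 5) *: L (-3) q.

Let Mc : has_charge c M. Proof. by case: q_sing. Qed.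
Let q0 : L 0 q = h *: q. Proof. by case: q_sing. Qed.
Let qp (n : int) : 0 < n -> L n q = 0. Proof. by case: q_sing => _ _; apply.
  Qed.

Let M_res (x : M) : exists N : nat, forall n : int, N%:Z <= n -> L n x = 0.
Proof. exact: locally_nilpotent q_sing q_cyc x. Qed.

Let quad_eq2 A n (x t0 t1 : M) :
  L (- 2) (L (n + 2) x) + L (n + 1) (L (- 1) x) = t0 ->
  L (- 2 - 1) (L (n + 2 + 1) x) + L n (L 0 x) = t1 ->
  (forall i : nat, (1 < i)%N ->
     L (- 2 - i%:Z) (L (n + 2 + i%:Z) x) + L (n + 1 - i%:Z) (L (i%:Z - 1) x) =
       0) ->
  quad A.+2 n x = t0 + t1.
Proof.
move=> <- <- t; rewrite /quad !big_ord_recl big1 ?addr0; last first.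
  by move=> i _; apply: t.
by congr (_ + _ + (_ + _)); congr (act (virL K _) (act (virL K _) _));
  rewrite /= /bump /=; lia.
Qed.

(** For n > 0 every term reduces to a positive mode on [q]; for n = 0 the sum is h^2 + 2 h - (9/5) h
    = h (h + 1/5) = 0. *)
Lemma null_mode_q_ge0 n : 0 <= n -> null_mode_zero n q.
Proof.
move=> n0; exists 2%N => -[|[|A]] // _.
have C : L (n + 1) (L (-1) q) = (n + 2)%:~R *: L n q.
  rewrite (act_LL Mc) qp ?act0 ?add0r; last by lia.
  have e1 : n + 1 - -1 = n + 2 by lia.
  have e2 : n + 1 + -1 = n by lia.
  rewrite e1 e2.
  have [->|n1] := eqVneq n 0; last by rewrite cocycle0 ?scale0r ?addr0 //; lia.
  by rewrite /cocycle /= expr1n subrr !mul0r scale0r addr0.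
have t i : (1 < i)%N -> L (- 2 - i%:Z) (L (n + 2 + i%:Z) q) +
    L (n + 1 - i%:Z) (L (i%:Z - 1) q) = 0.
  by move=> i1; rewrite !qp ?act0 ?addr0 //; lia.
rewrite /null_mode (quad_eq2 A erefl erefl t).
rewrite C q0 actZ [L (n + 2) q]qp; last by lia.
rewrite [L (n + 2 + 1) q]qp ?act0 ?add0r; last by lia.
have [->|n1] := eqVneq n 0.
  by rewrite q0; lincomb K; field.
by rewrite !qp ?scaler0 ?addr0 ?subr0 //; lia.
Qed.

(** The linear term has the factor n + 3 = 0, and the quadratic part is 2 (L_(-2) L_(-1) - (1/5)
    L_(-3)) q, which is [null3]. *)
Lemma null_mode_q_m3 : null_mode_zero (-3) q.
Proof.
exists 2%N => -[|[|A]] // _.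
have t i : (1 < i)%N -> L (- 2 - i%:Z) (L (-3 + 2 + i%:Z) q) +
    L (-3 + 1 - i%:Z) (L (i%:Z - 1) q) = 0.
  by move=> i1; rewrite !qp ?act0 ?addr0 //; lia.
rewrite /null_mode (quad_eq2 A erefl erefl t).
rewrite -[-3 + 2 + 1]/(0 : int) -[-3 + 2]/(-1 : int) -[-3 + 1]/(-2 : int).
rewrite -[-2 - 1]/(-3 : int) null3 q0 !actZ.
by lincomb K; field.
Qed.

(** Descending induction: S_(n+2) applied to [null2] gives (n + 5)(n + 4) S_n q = (2/5)(n + 8) S_n
    q. The difference of the coefficients is (5 n + 28)(n + 3)/5, whose only integer root -3 is the
    case of [null_mode_q_m3]. *)
Lemma null_mode_q n : null_mode_zero n q.
Proof.
suff H k : forall n : int, - k%:Z <= n -> null_mode_zero n q.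
  by apply: (H `|n|%N); lia.
elim: k => [|k IH] {}n kn; first by apply: null_mode_q_ge0; lia.
have [n'|n'] := leP (- k%:Z) n; first exact: IH.
have {kn n'}nE : n = - k.+1%:Z by lia.
have [->|n3] := eqVneq n (-3); first exact: null_mode_q_m3.
have [A0 hA0] : null_mode_zero (n + 2) q by apply: IH; lia.
have [A1 hA1] : null_mode_zero (n + 1) q by apply: IH; lia.
have [B0 hB0] := null_mode_L1 Mc M_res (n + 2) (L (-1) q).
have [B1 hB1] := null_mode_L1 Mc M_res (n + 2) q.
have [B2 hB2] := null_mode_L1 Mc M_res (n + 1) q.
have [B3 hB3] := null_mode_L2 Mc M_res (n + 2) q.
exists (A0 + A1 + (B0 + B1 + B2 + B3))%N => A hA.
have e1 : n + 2 - 1 = n + 1 by lia.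
have e2 : n + 1 - 1 = n by lia.
have e3 : n + 2 - 2 = n by lia.
have := hB0 A; rewrite null2 e1 hB1 ?hB2 ?e1 ?e2; try lia.
rewrite (linZ (null_mode_linear A _)) hB3 ?e3 ?hA0 ?hA1 ?act0 ?scaler0; try lia.
rewrite ?addr0 ?add0r ?act0 ?add0r => /(_ ltac:(lia)) /eqP.
rewrite !scalerA -subr_eq0 -scalerBl scaler_eq0 => /orP[|/eqP //].
rewrite (_ : _ - _ = ((5 * n + 28) * - (n + 3))%:~R / 5); last first.
  by rewrite !rmorphM rmorphN !rmorphD rmorphM /=; field.
rewrite mulf_eq0 invr_eq0 intr_eq0 pnatr_eq0 orbF mulf_eq0 oppr_eq0.
by case/orP => /eqP e; exfalso; lia.
Qed.

Lemma null_mode_all (x : M) n : null_mode_zero n x.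
Proof.
move: x n; apply: (neg_word_ind q_sing q_cyc) => [||a x xZ].
- split=> [n|a x y xZ yZ n]; first exact: (null_mode_zero_subspace M n).1.
  exact: (null_mode_zero_subspace M n).2.
- exact: null_mode_q.
- exact: null_mode_zero_neg Mc M_res _ _ xZ.
Qed.

Lemma singular_unique (x : M) : (forall n : int, 0 < n -> L n x = 0) ->
  exists a, x = a *: q.
Proof.
move=> xp; have [A xA] := null_mode_all x 0.
have t i : (1 < i)%N -> L (- 2 - i%:Z) (L (0 + 2 + i%:Z) x) +
    L (0 + 1 - i%:Z) (L (i%:Z - 1) x) = 0.
  by move=> i1; rewrite !xp ?act0 ?addr0 //; lia.
have := xA A.+2 ltac:(lia); rewrite /null_mode (quad_eq2 A erefl erefl t).
rewrite -[0 + 2 + 1]/(3 : int) -[0 + 2]/(2 : int) -[0 + 1]/(1 : int) (xp 2) //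
  (xp 3) // !act0.
have C := act_LLE Mc (n := 1) (m := -1) (k := 0) (a := 2)
  (b := cocycle c 1 (-1)) erefl erefl erefl.
have cE : cocycle c 1 (-1) = 0 by rewrite /cocycle /= expr1n subrr !mul0r.
rewrite C cE xp // act0 => S0.
(* An eigenvalue different from every h + k with k > 0 lowers any degree bound to 0. *)
have eig (mu : K) (y : M) : L 0 y = mu *: y ->
    (forall k : nat, (0 < k)%N -> mu != h + k%:Z%:~R) -> deg_le q 0 y.
  move=> y0 ne; have [D] := deg_le_exhaust q_sing q_cyc y.
  elim: D => // D IH Dy; apply: IH.
  have := deg_le_eigen q_sing y0 (ne D.+1 isT) Dy.
  by rewrite (_ : D.+1%:Z - 1 = D) //; lia.
(* S_0 x = 0 reads L_0 (L_0 + 1/5) x = 0, and -1/5 = h, so L_0 kills [y]; but 0 is not a weight,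
   hence [y] is zero. *)
pose y := L 0 x - h *: x.
have y0 : L 0 y = 0 *: y.
  by rewrite scale0r -[RHS]S0 /y !actE; lincomb K; field.
have h0 k : (0 : K) != h + k%:Z%:~R.
  rewrite (_ : h + _ = (5 * k%:Z - 1)%:~R / 5); last first.
    by rewrite rmorphB rmorphM /=; field.
  by rewrite eq_sym mulf_neq0 ?invr_eq0 ?intr_eq0 ?pnatr_eq0 //; lia.
have yle : deg_le q 0 y by apply: (eig _ _ y0) => k _; exact: h0.
(* The eigenvalue 0 differs from h too, so the bound drops once more, below zero. *)
have {}yle : deg_le q (0 - 1) y.
  by apply: (deg_le_eigen q_sing y0) yle; exact: (h0 0%N).
have yz : y = 0 by apply: deg_le_lt0 yle; lia.
apply: deg_le0; apply: (eig h).
  by apply/eqP; rewrite -subr_eq0 -/y yz.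
by move=> k k0; rewrite -subr_eq0 opprD addNKr oppr_eq0 intr_eq0; lia.
Qed.

Lemma null_module_irreducible : q != 0 -> lie_irreducible M.
Proof.
move=> qn0; split; first by exists q.
move=> S; have [[x xS x0]|nS] := pselect (exists2 x, x \in S & x != 0);
  last first.
  by left=> m mS; apply/eqP; apply: contrapT => /negP m0; apply: nS; exists m.
right; apply: q_cyc (subspace_sub S) _ _ => [|z y]; last exact: act_stable.
have PL (n : int) y : 0 < n -> y \in S -> L n y \in S by move=> _;
  exact: act_stable.
have [{xS x0}x [xS x0] xp] := exists_singular q_sing q_cyc PL xS x0.
have [a xE] := singular_unique xp.
have a0 : a != 0 by apply: contraNneq x0 => a0; rewrite xE a0 scale0r.
by rewrite -[q]scale1r -(mulVf a0) -scalerA -xE rpredZ.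
Qed.

End NullModule.

(** * Tensor products with intermediate series *)

Section Intermediate.
Variable K : numFieldType.
Local Notation Vir := (virasoro K).
Local Notation L n := (act (virL K n)).

(* [v m] is zero off [J], and the [v m] with [m] in [J] form a basis. *)
Definition inter_like (alpha beta : K) (V : lieModType Vir) (v : int -> V)
    (J : pred int) : Prop :=
  [/\ forall m, ~~ J m -> v m = 0,
      forall P : V -> Prop, P 0 -> (forall a m x, P x -> P (a *: v m + x)) ->
        forall x, P x,
      exists2 coef : int -> V -> K^o, forall i, linear (coef i) &
        forall i j, J j -> coef i (v j) = (i == j)%:R,
      forall n m, J m ->
        L n (v m) = - (m%:~R + alpha + beta + n%:~R * beta) *: v (m + n) &
      has_charge (0 : K) V].

Let inter_coef alpha beta (i : int) : inter alpha beta -> K^o :=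
  fglift (fun j => (i == j)%:R : K^o).

Let inter_coef_linear alpha beta i : linear (@inter_coef alpha beta i).
Proof. exact: fglift_linear. Qed.

Let inter_coefE alpha beta i j :
  @inter_coef alpha beta i (inter_v alpha beta j) = (i == j)%:R.
Proof. by rewrite /inter_coef liftU scale1r. Qed.

Let inter_actE alpha beta n m : L n (inter_v alpha beta m) =
  - (m%:~R + alpha + beta + n%:~R * beta) *: inter_v alpha beta (m + n).
Proof. exact: (act_interE alpha beta (Some n) m). Qed.

Let inter_charge (alpha beta : K) : has_charge (0 : K) (inter alpha beta).
Proof.
elim/freeg_lin_ind => [|d m x IH]; first by rewrite act0 scaler0.
rewrite act_linr IH !scale0r addr0 [act _ _](act_interE alpha beta None m).
by rewrite scaler0.
Qed.

Lemma inter_inter_like alpha beta :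
  inter_like alpha beta (inter_v alpha beta) predT.
Proof.
split=> //.
- by move=> P P0 PS; elim/freeg_lin_ind => // a i x; exact: PS.
- by exists (@inter_coef alpha beta) => [i|i j _];
    [exact: inter_coef_linear | exact: inter_coefE].
exact: inter_charge.
Qed.

Lemma inter00_inter_like :
  inter_like (0 : K) 0 (fun m => lie_proj (@inter00_line K) (inter_v 0 0 m))
    (fun m => m != 0).
Proof.
have pl := lie_proj_linear (@inter00_line K).
split.
- move=> m /negPn /eqP ->; apply/lie_proj_eq0; exact: sub_span.
- move=> P P0 PS; apply: lie_quot_ind; elim/freeg_lin_ind => [|a m x Px].
    by rewrite (lin0 pl).
  by rewrite pl; exact: PS.
- have kill i : i != 0 -> forall x, x \in @inter00_line K ->
      @inter_coef 0 0 i x = 0.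
    move=> i0; apply: span_min.
    + exact: lin0 (inter_coef_linear _).
    + by move=> a x y x0 y0; rewrite inter_coef_linear x0 y0 scaler0 addr0.
    + by move=> _ ->; rewrite inter_coefE (negPf i0).
  (* The coefficient of v_0 does not descend to the quotient; the zero functional replaces it, as
     only indices j != 0 are tested. *)
  exists (fun i => if i == 0 then fun=> 0 else lquot_lift (@inter_coef 0 0 i)).
    move=> i; case: ifP => [_ a x y|/negbT i0]; first by rewrite scaler0 addr0.
    exact: lquot_lift_linear (inter_coef_linear i) (kill i i0).
  move=> i j j0; case: ifP => [/eqP ->|/negbT i0].
    by rewrite eq_sym (negPf j0).
  by rewrite [LHS](lquot_liftE (inter_coef_linear i) (kill i i0)) inter_coefE.
- by move=> n m _; rewrite -lie_proj_act inter_actE (linZ pl).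
apply: lie_quot_ind => x; rewrite -lie_proj_act inter_charge.
by rewrite scale0r (lin0 pl) scale0r.
Qed.

Lemma inter01_inter_like :
  inter_like (0 : K) 1 (fun m => insubd (0 : lmod_sub (@inter01_sub K)) (inter_v
    0 1 m)
      : lie_sub (@inter01_sub K))
    (fun m => m != -1).
Proof.
set v := fun m => _.
have vT m : m != -1 -> lie_incl (v m) = inter_v 0 1 m.
  move=> m1; rewrite /lie_incl /lmod_incl /v -[sval _]/(val _) val_insubd.
  by rewrite (_ : inter_v 0 1 m \in _) //; apply: sub_span; exists m.
(* The default value of [insubd] is 0, and v_(-1) is outside the submodule because its coefficient
   functional vanishes there. *)
have vF : v (-1) = 0.
  rewrite /v /insubd insubN //; apply/negP => vS.
  have : @inter_coef 0 1 (-1) (inter_v 0 1 (-1)) = 0.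
    move: (inter_v 0 1 (-1)) vS; apply: span_min.
    - exact: lin0 (inter_coef_linear _).
    - by move=> a x y x0 y0; rewrite inter_coef_linear x0 y0 scaler0 addr0.
    - by move=> _ [m m1 ->]; rewrite inter_coefE eq_sym (negPf m1).
  by rewrite inter_coefE eqxx => /eqP; rewrite oner_eq0.
have il := lie_incl_linear (S := @inter01_sub K).
split.
- by move=> m /negPn /eqP ->.
- move=> P P0 PS x.
  suff [y yx Py] : exists2 y, lie_incl y = lie_incl x & P y.
    by rewrite -(lie_incl_inj yx).
  have [s [sA xE]] := asboolP _ (lie_incl_in x).
  rewrite {}xE; elim: s sA => [|[a u] s IH] sA.
    by exists 0 => //; rewrite big_nil (lin0 il).
  have [m m1 /= uE] : exists2 m : int, m != -1 & u = inter_v 0 1 m.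
    by apply: (sA (a, u)); rewrite inE eqxx.
  have [y yE Py] : exists2 y, lie_incl y = \sum_(p <- s) p.1 *: p.2 & P y.
    by apply: IH => p ps; apply: sA; rewrite inE ps orbT.
  exists (a *: v m + y); last exact: PS.
  by rewrite il big_cons yE vT // uE.
- exists (fun i x => @inter_coef 0 1 i (lie_incl x)).
    by move=> i a x y; rewrite il inter_coef_linear.
  by move=> i j j1; rewrite vT // inter_coefE.
- move=> n m m1; apply: lie_incl_inj.
  rewrite -[LHS]/(L n (lie_incl (v m))) vT // inter_actE (linZ il).
  (* If m + n = -1 the coefficient m + n + 1 is zero, in agreement with the default value at index
     -1. *)
  have [e|ne] := eqVneq (m + n) (-1); last by rewrite vT.
  rewrite e vF (lin0 il) scaler0 (_ : _ + _ = (m + n + 1)%:~R).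
    by rewrite e oppr0 scale0r.
  by rewrite !rmorphD /=; ring.
move=> x; apply: lie_incl_inj.
rewrite -[LHS]/(act (virC K) (lie_incl x)) inter_charge (linZ il).
by rewrite !scale0r.
Qed.

Definition inter_index (alpha beta : K) : pred int := fun m =>
  ~~ [&& alpha == 0, beta == 0 & m == 0] && ~~ [&& alpha == 0,
    beta == 1 & m == -1].

Lemma Vprime_inter_like alpha beta :
  inter_like alpha beta (Vprime_v alpha beta) (inter_index alpha beta).
Proof.
rewrite /Vprime_v /Vprime.
have [/eqP a0|a0] := boolP (alpha == 0); last first.
  have -> : inter_index alpha beta = predT.
    by apply: funext => m; rewrite /inter_index (negPf a0).
  exact: inter_inter_like.
have [/eqP b0|b0] := boolP (beta == 0).
  have -> : inter_index alpha beta = fun m => m != 0.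
    by apply: funext => m; rewrite /inter_index a0 b0 !eqxx [0 == 1 :> K]eq_sym
      oner_eq0 andbT.
  by rewrite a0 b0; exact: inter00_inter_like.
have [/eqP b1|b1] := boolP (beta == 1).
  have -> : inter_index alpha beta = fun m => m != -1.
    by apply: funext => m; rewrite /inter_index a0 b1 !eqxx oner_eq0.
  by rewrite a0 b1; exact: inter01_inter_like.
have -> : inter_index alpha beta = predT.
  by apply: funext => m; rewrite /inter_index (negPf b0) (negPf b1) !andbF.
exact: inter_inter_like.
Qed.

End Intermediate.

(** * Nonzero submodules of the tensor product with L(-22/5,0) *)

Section Tensor.
Variable K : numFieldType.
Local Notation Vir := (virasoro K).
Local Notation L n := (act (virL K n)).
Local Notation c := (- (22 / 5) : K).

(* [tensor_like t] records the properties of the tensor product used here, so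
   that the arguments do not depend on its construction. *)
Definition tensor_like (V N T : lieModType Vir) (t : V -> N -> T) : Prop :=
  [/\ forall y, linear (t^~ y), forall x, linear (t x),
      forall z x y, act z (t x y) = t (act z x) y + t x (act z y),
      forall P : T -> Prop, P 0 -> (forall a x y u, P u ->
        P (a *: t x y + u)) ->
        forall u, P u &
      forall f : V -> K^o, linear f -> exists2 p : T -> N, linear p &
        forall x y, p (t x y) = (f x : K) *: y].

Lemma lie_tensor_like (V N : lieModType Vir) :
  tensor_like (fun x y => tens x y : lie_tensor V N).
Proof.
split.
- exact: tens_linl.
- exact: tens_linr.
- exact: tensor_actE.
- exact: tensor_ind.
move=> f fl; pose b (x : V) (y : N) : N := (f x : K) *: y.
have bl y : linear (b^~ y).
  by move=> a x x'; rewrite /b fl scalerDl -scalerA.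
have br x : linear (b x).
  by move=> a y y'; rewrite /b; lincomb K; ring.
exists (tensor_lift b); first exact: tensor_lift_linear.
by move=> x y; rewrite tensor_liftE.
Qed.

Variables (alpha beta : K) (V : lieModType Vir) (v : int -> V).
Local Notation J := (inter_index alpha beta).
Hypothesis V_inter : inter_like alpha beta v J.
Hypothesis alpha_int : forall k : int, alpha = k%:~R -> alpha = 0.

Variables (N : lieModType Vir) (w : N) (e : N -> K^o).
Hypothesis N_irr : irr_hw c 0 w e.

Variables (T : lieModType Vir) (tns : V -> N -> T).
Hypothesis T_tens : tensor_like tns.

Let v0 m : ~~ J m -> v m = 0. Proof. by case: V_inter => v0 _ _ _ _; exact: v0.
  Qed.
Let v_ind (P : V -> Prop) : P 0 -> (forall a m x, P x -> P (a *: v m + x)) ->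
  forall x, P x.
Proof. by case: V_inter => _ vi _ _ _; exact: vi. Qed.
Let Lv n m : J m ->
  L n (v m) = - (m%:~R + alpha + beta + n%:~R * beta) *: v (m + n).
Proof. by case: V_inter => _ _ _ Lv _; exact: Lv. Qed.
Let VC : has_charge (0 : K) V. Proof. by case: V_inter. Qed.

Let N_sing : singular c 0 w. Proof. by case: N_irr. Qed.
Let N_cyc : cyclic_vector w. Proof. by case: N_irr. Qed.
Let NC : has_charge c N. Proof. by case: N_sing. Qed.
Let w0 : L 0 w = 0. Proof. by case: N_sing => _ -> _; rewrite scale0r. Qed.
Let wp (n : int) : 0 < n -> L n w = 0. Proof. by case: N_sing => _ _; apply.
  Qed.
Let N_nil (y : N) : exists B : nat, forall n : int, B%:Z <= n -> L n y = 0.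
Proof. exact: locally_nilpotent N_sing N_cyc y. Qed.

Let J_gt0 (m : int) : 0 < m -> J m.
Proof.
move=> m0; rewrite /inter_index; have /negPf -> : m != 0 by lia.
have /negPf -> : m != -1 by lia.
by rewrite !andbF.
Qed.

Let Jalpha m : alpha != 0 -> J m.
Proof. by rewrite /inter_index => /negPf ->. Qed.

Let tensl y : linear (tns^~ y). Proof. by case: T_tens. Qed.
Let tensr x : linear (tns x). Proof. by case: T_tens. Qed.
Let tns_act z x y : act z (tns x y) = tns (act z x) y + tns x (act z y).
Proof. by case: T_tens => _ _ ta _ _; exact: ta. Qed.
Let tns_ind (P : T -> Prop) : P 0 ->
  (forall a x y t, P t -> P (a *: tns x y + t)) -> forall t, P t.
Proof. by case: T_tens => _ _ _ ti _; exact: ti. Qed.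

Lemma tensor_charge : has_charge c T.
Proof.
elim/tns_ind => [|a x y t IH]; first by rewrite act0 scaler0.
rewrite actD actZ IH tns_act VC NC (linZ (tensl y)).
rewrite (linZ (tensr x)) scale0r add0r.
by rewrite scalerDr !scalerA mulrC.
Qed.

(** The identity x (x) L_n y = L_n (x (x) y) - L_n x (x) y moves modes off the second factor, down
    to [w]. *)
Lemma tensor_full (P : T -> Prop) : subspace P -> (forall n (t : T), P t ->
  P (L n t)) ->
  (forall m, P (tns (v m) w)) -> forall t, P t.
Proof.
move=> sP PL Pv; have [P0 PD] := sP.
have Pw (x : V) : P (tns x w).
  move: x; apply: v_ind => [|a m x Px]; first by rewrite (lin0 (tensl w)).
  by rewrite tensl; exact: PD.
have Pt (y : N) (x : V) : P (tns x y).
  move: y x; apply: (generates N_sing N_cyc) => //.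
    split=> [x|a y z Py Pz x]; first by rewrite (lin0 (tensr x)).
    by rewrite tensr; exact: PD.
  move=> n y Py x; have -> : tns x (L n y) = (-1) *: tns (L n x) y + L n (tns x
    y).
    by rewrite tns_act scaleN1r addKr.
  by apply: PD; [exact: Py | exact: PL].
by elim/tns_ind => // a x y t Pt'; apply: PD.
Qed.

Lemma tensor_Lw (n m : int) : 0 <= n -> J m -> L n (tns (v m) w) =
  - (m%:~R + alpha + beta + n%:~R * beta) *: tns (v (m + n)) w.
Proof.
move=> n0 Jm; have Ln : L n w = 0.
  by have [->|n1] := eqVneq n 0; [exact: w0 | apply: wp; lia].
by rewrite tns_act Ln (lin0 (tensr _)) addr0 Lv // (linZ (tensl w)).
Qed.

Lemma tensor_Lm1w m : J m -> L (-1) (tns (v m) w) = - (m%:~R + alpha) *: tns (v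
  (m - 1)) w.
Proof.
move=> Jm; rewrite tns_act (vacuum_translation N_irr).
rewrite (lin0 (tensr _)) addr0 Lv // (linZ (tensl w)).
by congr (_ *: _); rewrite mulN1r; ring.
Qed.

(** This is x (x) (L_(-2)^2 - (3/5) L_(-4)) w = 0, rewritten with modes acting either on the whole
    tensor or on the first factor. *)
Lemma tensor_null (x : V) :
  L (-2) (L (-2) (tns x w)) - 2 *: L (-2) (tns (L (-2) x) w) +
    tns (L (-2) (L (-2) x)) w =
  (3 / 5) *: (L (-4) (tns x w) - tns (L (-4) x) w).
Proof.
have E n (z : V) (y : N) : L n (tns z y) = tns (L n z) y + tns z (L n y) by
  exact: tns_act.
rewrite !E !actD !E (vacuum_null N_irr) (linZ (tensr x)).
set A := tns (L (-2) (L (-2) x)) w; set B := tns (L (-2) x) (L (-2) w).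
set C := tns x (L (-4) w); set D := tns (L (-4) x) w.
by rewrite [D + C]addrC addrK scaler_nat mulr2n opprD !addrA; lincomb K; ring.
Qed.

Let act_sum (M : lieModType Vir) z (s : seq int) (F : int -> M) :
  act z (\sum_(i <- s) F i) = \sum_(i <- s) act z (F i).
Proof. exact: (big_morph _ (actD z) (act0 _ z)). Qed.

(** [p i] contracts the first factor with the i-th coefficient. The expansion is claimed over every
    large enough index set, so that expansions of two elements can be added. *)
Lemma tensor_basis : exists2 p : int -> T -> N, forall i, linear (p i) &
  forall t, exists s0 : seq int, forall s, uniq s -> {subset s0 <= s} ->
    t = \sum_(i <- s | J i) tns (v i) (p i t).
Proof.
have [_ _ [coef cl cE] _ _] := V_inter; have [_ _ _ _ lift] := T_tens.
have ex i : exists p : T -> N, linear p /\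
    forall x y, p (tns x y) = (coef i x : K) *: y.
  by have [p pl pE] := lift _ (cl i); exists p.
have [p pP] := choice ex.
have pl i : linear (p i) by case: (pP i).
exists p => //; apply: tns_ind => [|a x y t [s0 tE]].
  exists [::] => s _ _; rewrite big1 // => i _.
  by rewrite (lin0 (pl i)) (lin0 (tensr _)).
have pD u u' s : u = \sum_(i <- s | J i) tns (v i) (p i u) ->
    u' = \sum_(i <- s | J i) tns (v i) (p i u') -> forall b,
    b *: u + u' = \sum_(i <- s | J i) tns (v i) (p i (b *: u + u')).
  move=> uE u'E b; rewrite {1}uE {1}u'E scaler_sumr -big_split.
  by apply: eq_bigr => i _; rewrite pl tensr.
suff [s1 xE] : exists s1 : seq int, forall s, uniq s -> {subset s1 <= s} ->
    tns x y = \sum_(i <- s | J i) tns (v i) (p i (tns x y)).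
  exists (s0 ++ s1) => s us ss; apply: pD; [apply: xE | apply: tE] => // i is_;
    by apply: ss; rewrite mem_cat is_ ?orbT.
move: x; apply: v_ind => [|b m x [s1 xE]].
  exists [::] => s _ _; rewrite big1 ?(lin0 (tensl y)) // => i _.
  by rewrite (lin0 (pl i)) (lin0 (tensr _)).
exists (m :: s1) => s us ss; rewrite tensl; apply: pD; last first.
  by apply: xE => // i is_; apply: ss; rewrite inE is_ orbT.
have [Jm|nJm] := boolP (J m); last first.
  rewrite v0 // (lin0 (tensl y)) big1 // => i _.
  by rewrite (lin0 (pl i)) (lin0 (tensr _)).
rewrite big_mkcond (bigD1_seq m) ?ss ?inE ?eqxx //= Jm (pP m).2 cE // eqxx.
rewrite scale1r big1 ?addr0 // => i im; case: ifP => // _.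
by rewrite (pP i).2 cE // (negPf im) scale0r (lin0 (tensr _)).
Qed.

Lemma tensor_expand t : t != 0 -> exists s : seq int, exists x : int -> N,
  [/\ uniq s, s != [::], forall i, i \in s -> J i /\ x i != 0 &
    t = \sum_(i <- s) tns (v i) (x i)].
Proof.
move=> tn0; have [p pl] := tensor_basis; move=> /(_ t) [s0 tE].
pose s := [seq i <- undup s0 | J i && (p i t != 0)].
have {}tE : t = \sum_(i <- s) tns (v i) (p i t).
  rewrite {1}(tE (undup s0)) ?undup_uniq //; last by move=> i;
    rewrite mem_undup.
  rewrite big_filter (bigID (fun i => p i t != 0)) /= [X in _ + X]big1 ?addr0
    //.
  by move=> i /andP[_ /negPn /eqP ->]; rewrite (lin0 (tensr _)).
exists s, (p^~ t); split=> //; first by rewrite filter_uniq ?undup_uniq.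
  by apply: contraNneq tn0 => s_nil; rewrite tE s_nil big_nil.
by move=> i; rewrite mem_filter => /andP[/andP[]].
Qed.

Let common_bound (s : seq int) (a : int -> N) : exists B : nat,
  forall i, i \in s -> - B%:Z <= i /\ forall n : int, B%:Z <= n ->
    L n (a i) = 0.
Proof.
elim: s => [|i s [B HB]]; first by exists 0%N.
have [C HC] := N_nil (a i); exists (B + C + `|i|)%N => j.
rewrite inE => /predU1P[->|/HB[jB jn]]; split=> [|n nB]; try lia.
  by apply: HC; lia.
by apply: jn; lia.
Qed.

Section Submodule.
Variable U : T -> Prop.
Hypotheses (sU : subspace U) (UL : forall n t, U t -> U (L n t)).

Let act_high (s : seq int) (w' : int -> V) (a : int -> N) (f : int -> K)
    (g : int -> int) (m n : int) :
  (forall i, i \in s -> L n (a i) = 0) ->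
  (forall i, i \in s -> L n (w' (g i)) = f i *: w' (g i + n)) ->
  L n (\sum_(i <- s) tns (w' (g i)) (a i)) =
  \sum_(i <- s) f i *: tns (w' (g i + n)) (a i).
Proof.
move=> a0 wE; rewrite act_sum; apply: eq_big_seq => i is_.
by rewrite tns_act a0 // (lin0 (tensr _)) addr0 wE // (linZ (tensl _)).
Qed.

(** For B large, L_B acts on the first factor alone. A suitable multiple of the sum at shift P
    cancels the term [i1] of L_B applied to the sum at shift P - B, and multiplies each other term
    by i1 - i; induct on the number of terms. *)
Lemma separation (w' : int -> V) (k b : K) (B0 : int) :
  (forall n m, B0 <= m ->
    L n (w' m) = - (m%:~R + k + n%:~R * b) *: w' (m + n)) ->
  forall (s : seq int) (a : int -> N), uniq s -> s != [::] ->
    (forall i, i \in s -> a i != 0) ->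
    (exists M0 : int, forall M, M0 <= M -> U (\sum_(i <- s) tns (w' (i + M)) (a
      i))) ->
  exists2 y, y != 0 & exists M0 : int, forall M, M0 <= M -> U (tns (w' M) y).
Proof.
move=> wE; elim=> // i1 [|i2 s] IH a us _ an0 [M0 aU].
  exists (a i1); first by apply: an0; rewrite inE.
  exists (M0 + i1) => M MM; have := aU (M - i1); rewrite big_seq1.
  by rewrite (_ : i1 + (M - i1) = M); [apply; lia | lia].
apply: (IH (fun i => (i1 - i)%:~R *: a i)) => //; first by case/andP: us.
  move=> i is_; rewrite scaler_eq0 negb_or an0 ?andbT;
    last by rewrite inE is_ orbT.
  by rewrite intr_eq0 subr_eq0; apply: contraTneq us => ->; rewrite /= is_.
have [B HB] := common_bound (i1 :: i2 :: s) a.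
exists (`|M0| + `|B0| + B%:Z + B%:Z) => P PP.
have UP := aU P; have UM := aU (P - B%:Z).
have := UL B (UM ltac:(lia)); rewrite (@act_high _ w' a
  (fun i => - ((i + (P - B%:Z))%:~R + k + B%:Z%:~R * b)) (fun i =>
    i + (P - B%:Z))) //; last 2 first.
- by move=> i /HB [_]; apply.
- by move=> i /HB [iB _]; apply: wE; lia.
move=> UM'; have := sU.2 ((i1 + (P - B%:Z))%:~R + k + B%:Z%:~R * b) _ _ (UP
  ltac:(lia)) UM'.
congr U; rewrite scaler_sumr -big_split big_cons /=.
have iP i : i + (P - B%:Z) + B%:Z = i + P by lia.
rewrite iP -scalerDl subrr scale0r add0r; apply: eq_bigr => i _.
by rewrite iP -scalerDl (linZ (tensr _)) !rmorphB !rmorphD /=; congr (_ *: _);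
  ring.
Qed.

(** For large P, L_P x has coefficients -(i + alpha + beta + P beta). To apply [separation] the
    dependence on P must go: it is absent for beta = 0, absorbed by rescaling for beta = 1, and
    removed by a second difference otherwise. *)
Lemma submod_large x : U x -> x != 0 ->
  exists2 y, y != 0 & exists M0 : int, forall M, M0 <= M -> U (tns (v M) y).
Proof.
move=> Ux /tensor_expand [s [a [us s0 sJ xE]]].
have an0 i : i \in s -> a i != 0 by move=> /sJ [].
have vE n m : 1 <= m -> L n (v m) = - (m%:~R + (alpha + beta) + n%:~R * beta) *:
  v (m + n).
  by move=> m1; rewrite Lv ?addrA //; apply: J_gt0; lia.
have [B HB] := common_bound s a.
have Lx (P : int) : B%:Z <= P -> L P x =
    \sum_(i <- s) (- (i%:~R + alpha + beta + P%:~R * beta)) *: tns (v (i + P))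
      (a i).
  move=> BP; rewrite xE (@act_high s v a
    (fun i => - (i%:~R + alpha + beta + P%:~R * beta)) id) //.
    by move=> i /HB [_]; apply.
  by move=> i /sJ [Ji _]; exact: Lv.
have [b0|b0] := eqVneq beta 0.
  apply: (separation vE (s := s) (a := fun i => (- (i%:~R + alpha)) *: a i)) =>
    //.
    move=> i is_; have [Ji ai] := sJ i is_; rewrite scaler_eq0 negb_or ai andbT
      oppr_eq0.
    apply: contraTneq Ji => ia; have aE : alpha = (- i)%:~R.
      by rewrite rmorphN; apply/eqP; rewrite -addr_eq0 addrC ia.
    have a0 := alpha_int aE; move: ia; rewrite a0 addr0 => /eqP.
    by rewrite intr_eq0 => /eqP ->; rewrite /inter_index b0 !eqxx.
  exists B%:Z => P /[dup] BP /Lx LP; have := UL P Ux; rewrite LP; congr U.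
  by apply: eq_bigr => i _; rewrite (linZ (tensr _)) b0 mulr0 !addr0.
have [b1|b1] := eqVneq beta 1.
  (* For beta = 1 the coefficient depends on i + P only; the rescaled vectors absorb it and satisfy
     the action law with parameter 0. *)
  pose w' m := (m%:~R + alpha + 1) *: v m.
  have w'E n m : 1 <= m -> L n (w' m) = - (m%:~R + (alpha + 1) + n%:~R * 0) *:
    w' (m + n).
    move=> m1; rewrite /w' actZ vE // b1 !scalerA; congr (_ *: _).
    by rewrite rmorphD /=; ring.
  have [|y y0 [M0 yU]] := separation w'E us s0 an0.
    exists B%:Z => P /[dup] BP /Lx LP; have := subspaceZ sU (-1) (UL P Ux).
    rewrite LP scaler_sumr; congr U; apply: eq_bigr => i _.
    by rewrite /w' (linZ (tensl _)) scalerA b1 rmorphD /=; congr (_ *: _); ring.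
  exists y => //; exists (`|M0|) => M MM.
  have cn0 : M%:~R + alpha + 1 != 0.
    apply/eqP => e0; have aE : alpha = (- (M + 1))%:~R.
      by rewrite rmorphN rmorphD /=; apply/eqP; rewrite -addr_eq0 -e0;
        apply/eqP; ring.
    move: e0; rewrite (alpha_int aE) addr0 => /eqP.
    by rewrite (_ : M%:~R + 1 = (M + 1)%:~R) ?intr_eq0 ?rmorphD //; lia.
  have := subspaceZ sU (M%:~R + alpha + 1)^-1 (yU M ltac:(lia)).
  by rewrite /w' (linZ (tensl _)) scalerA mulVf // scale1r.
have Jall m : J m by rewrite /inter_index (negPf b0) (negPf b1) !andbF.
apply: (separation vE us s0 an0).
exists (B%:Z + B%:Z + 2) => P BP.
have LLx n : B%:Z <= n -> B%:Z <= P - n -> L n (L (P - n) x) = \sum_(i <- s)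
    ((i%:~R + alpha + beta + (P - n)%:~R * beta) *
     ((i + (P - n))%:~R + alpha + beta + n%:~R * beta)) *: tns (v (i + P)) (a
       i).
  move=> Bn BPn; rewrite Lx // act_sum; apply: eq_big_seq => i is_.
  rewrite actZ tns_act Lv // (HB i is_).2 // (lin0 (tensr _)) addr0.
  rewrite (linZ (tensl _)) scalerA mulrNN.
  by rewrite (_ : i + (P - n) + n = i + P) //; lia.
have U1 := LLx B%:Z; have U2 := LLx (B%:Z + 1); have U3 := LLx (B%:Z + 2).
have b2 : 2 * beta * (1 - beta) != 0.
  by rewrite !mulf_neq0 ?pnatr_eq0 // subr_eq0 eq_sym.
(* The coefficients of L_n L_(P-n) x are quadratic in n with leading term beta (1 - beta), so their
   second difference is 2 beta (1 - beta), independent of i and P. *)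
pose D := L B%:Z (L (P - B%:Z) x) - 2 *: L (B%:Z + 1) (L (P - (B%:Z + 1)) x) +
  L (B%:Z + 2) (L (P - (B%:Z + 2)) x).
have UD : U D.
  have UU n : U (L n (L (P - n) x)) by exact/UL/UL.
  apply: subspaceD => //; rewrite -scaleNr addrC; apply: sU.2 => //; exact: UU.
have := subspaceZ sU (2 * beta * (1 - beta))^-1 UD; congr U.
rewrite /D U1 ?U2 ?U3; try lia.
rewrite !scaler_sumr -sumrB -big_split scaler_sumr; apply: eq_bigr => i _ /=.
rewrite scalerA -scalerBl -scalerDl scalerA.
rewrite [X in (_ * X) *: _](_ : _ = 2 * beta * (1 - beta)); last by ring.
by rewrite mulVf // scale1r.
Qed.

(** The vectors y with v_M (x) y in [U] for all large M form a subspace stable under positive modes,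
    so [irr_hw_pos] puts [w] in it. *)
Lemma submod_large_hw x : U x -> x != 0 ->
  exists M0 : int, forall M, M0 <= M -> U (tns (v M) w).
Proof.
move=> Ux x0; have [y y0 yU] := submod_large Ux x0.
apply: (irr_hw_pos N_irr (P := fun y => exists M0 : int, forall M, M0 <= M ->
  U (tns (v M) y))) yU y0.
- split=> [|b z z' [M zU] [M' z'U]].
    by exists 0 => M _; rewrite (lin0 (tensr _)); exact: sU.1.
  exists (`|M| + `|M'|) => P PM; rewrite tensr.
  by apply: sU.2; [apply: zU | apply: z'U]; lia.
move=> n z n0 [M zU]; exists (`|M|+ 1) => P PM.
have -> : tns (v P) (L n z) = (P%:~R + alpha + beta + n%:~R * beta) *: tns (v (P
  + n)) z
    + L n (tns (v P) z).
  rewrite tns_act Lv; last by apply: J_gt0; lia.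
  by rewrite (linZ (tensl _)) scaleNr addNKr.
by apply: sU.2; [apply: zU; lia | apply/UL/zU; lia].
Qed.

Let descend (m : int) (k : nat) :
  (forall j : int, m - k%:Z < j <= m -> J j /\ j%:~R + alpha != 0) ->
  U (tns (v m) w) -> U (tns (v (m - k%:Z)) w).
Proof.
elim: k => [|k IH] Hj Um; first by rewrite subr0.
have Uk : U (tns (v (m - k%:Z)) w) by apply: IH => // j jk; apply: Hj; lia.
have [|Jk kn] := Hj (m - k%:Z); first by lia.
have := subspaceZ sU (- ((m - k%:Z)%:~R + alpha))^-1 (UL (-1) Uk).
rewrite tensor_Lm1w // scalerA mulVf ?oppr_eq0 // scale1r.
by rewrite (_ : m - k%:Z - 1 = m - k.+1%:Z) //; lia.
Qed.

Lemma submod_full x : (alpha, beta) <> (0, 6 / 5) -> U x -> x != 0 -> forall t,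
  U t.
Proof.
move=> nab Ux x0; apply: tensor_full => //.
have [M0 MU] := submod_large_hw Ux x0.
have [a0|an0] := eqVneq alpha 0; last first.
  move=> m; pose k := `|M0 - m|%N.
  have [mM|mM] := leP M0 m; first exact: MU.
  have := @descend M0 `|M0 - m|%N; rewrite (_ : M0 - `|M0 - m|%N%:Z = m);
    last by lia.
  apply; last exact: MU.
  move=> j _; split; first exact: Jalpha.
  apply: contra_neq an0 => ja; apply: (alpha_int (k := - j)).
  by rewrite rmorphN; apply/eqP; rewrite -addr_eq0 addrC ja.
(* For alpha = 0, L_(-1) sends v_m (x) w to -m times v_(m-1) (x) w, so the descent stops at index
   0. *)
have U0 m : 0 <= m -> U (tns (v m) w).
  move=> m0; have [mM|mM] := leP M0 m; first exact: MU.
  have := @descend M0 `|M0 - m|%N; rewrite (_ : M0 - `|M0 - m|%N%:Z = m);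
    last by lia.
  apply; last exact: MU.
  move=> j jm; split; first by apply: J_gt0; lia.
  by rewrite a0 addr0 intr_eq0; lia.
have Ulow (m0 : int) : m0 < 0 -> (forall j, j <= m0 -> J j) ->
  U (tns (v m0) w) ->
    forall m, m <= m0 -> U (tns (v m) w).
  move=> m00 Jm Um m mm; have := @descend m0 `|m0 - m|%N.
  rewrite (_ : m0 - `|m0 - m|%N%:Z = m); last by lia.
  apply=> // j jm; split; first by apply: Jm; lia.
  by rewrite a0 addr0 intr_eq0; lia.
(* [tensor_null] expresses this vector through images of v_m (x) w and L_(-2) v_m (x) w, both in
   [U]. *)
have Unull m : 0 <= m -> U (tns (L (-2) (v m)) w) ->
    U (tns (L (-2) (L (-2) (v m)) + (3 / 5) *: L (-4) (v m)) w).
  move=> m0 U2; have E := tensor_null (v m).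
  have -> : tns (L (-2) (L (-2) (v m)) + (3 / 5) *: L (-4) (v m)) w =
      (2 : K) *: L (-2) (tns (L (-2) (v m)) w) + ((3 / 5) *: L (-4) (tns (v m)
        w) +
        (- 1) *: L (-2) (L (-2) (tns (v m) w))).
    rewrite (linD (tensl w)) (linZ (tensl w)).
    move: E; rewrite scalerBr => /eqP; rewrite eq_sym subr_eq => /eqP ->.
    by lincomb K; ring.
  apply: sU.2; first exact: UL.
  by apply: sU.2; [apply/UL/U0 | apply: (subspaceZ sU); do 2!apply: UL;
    exact: U0].
have LvE n m : J m -> L n (v m) = - (m%:~R + beta + n%:~R * beta) *: v (m + n).
  by move=> Jm; rewrite Lv // a0 addr0.
have [b1|b1] := eqVneq beta 1.
  have Jm1 (m : int) : m != -1 -> J m.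
    by move=> m1; rewrite /inter_index b1 oner_eq0 /= andbF (negPf m1) !andbF.
  (* There is no v_(-1) when beta = 1; the null relation at v_2 jumps over it, with coefficient -1 +
     3/5 = -2/5. *)
  have U2 : U (tns (v (-2)) w).
    have v2 : L (-2) (v 2) = (-1) *: v 0.
      by rewrite LvE ?Jm1 // b1; congr (_ *: _); ring.
    have v0' : L (-2) (v 0) = v (-2).
      by rewrite LvE ?Jm1 // b1 -[RHS]scale1r; congr (_ *: _); ring.
    have v4 : L (-4) (v 2) = v (-2).
      by rewrite LvE ?Jm1 // b1 -[RHS]scale1r; congr (_ *: _); ring.
    have := Unull 2 isT; rewrite v2 actZ v0' v4 -scalerDl !(linZ (tensl w)).
    move=> /(_ (subspaceZ sU _ (U0 0 isT))) /(subspaceZ sU (- (5 / 2))).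
    by rewrite scalerA (_ : _ * _ = 1) ?scale1r //; field.
  move=> m; have [m0|m0] := leP 0 m; first exact: U0.
  have [->|m1] := eqVneq m (-1).
    rewrite v0 ?(lin0 (tensl w)); first exact: sU.1.
    by rewrite /inter_index a0 b1 !eqxx andbF.
  by apply: (Ulow (-2)) => // [j j2|]; [apply: Jm1|]; lia.
have b6 : 6 / 5 - beta != 0.
  by rewrite subr_eq0; apply/eqP => b6; apply: nab; rewrite a0 -b6.
have Jm0 (m : int) : m != 0 -> J m.
  by move=> m0; rewrite /inter_index (negPf b1) (negPf m0) !andbF.
(* Starting at v_3, the null relation passes through v_1 and avoids index 0, which is missing when
   beta = 0. The coefficient is (beta - 3)(beta - 1) + (9/5)(beta - 1). *)
have U1 : U (tns (v (-1)) w).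
  have v3 : L (-2) (v 3) = (beta - 3) *: v 1.
    by rewrite LvE ?Jm0 //; congr (_ *: _); ring.
  have v1 : L (-2) (v 1) = (beta - 1) *: v (-1).
    by rewrite LvE ?Jm0 //; congr (_ *: _); ring.
  have v4 : L (-4) (v 3) = (3 * (beta - 1)) *: v (-1).
    by rewrite LvE ?Jm0 //; congr (_ *: _); ring.
  have := Unull 3 isT; rewrite v3 actZ v1 v4 !scalerA -scalerDl !(linZ (tensl
    w)).
  move=> /(_ (subspaceZ sU _ (U0 1 isT))).
  rewrite (_ : _ + _ = (1 - beta) * (6 / 5 - beta)); last by field.
  move/(subspaceZ sU ((1 - beta) * (6 / 5 - beta))^-1).
  by rewrite scalerA mulVf ?scale1r // mulf_neq0 // subr_eq0 eq_sym.
move=> m; have [m0|m0] := leP 0 m; first exact: U0.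
by apply: (Ulow (-1)) => // j j1; apply: Jm0; lia.
Qed.

End Submodule.

Lemma tns_neq0 m : J m -> tns (v m) w != 0.
Proof.
move=> Jm; have [_ _ [coef cl cE] _ _] := V_inter.
have [_ _ _ _ lift] := T_tens; have [p pl pE] := lift _ (cl m).
have := irr_hw_neq0 N_irr; apply: contra_neq => t0.
by have := pE (v m) w; rewrite t0 (lin0 pl) cE ?eqxx ?scale1r.
Qed.

Lemma tensor_irreducible : (alpha, beta) <> (0, 6 / 5) -> lie_irreducible T.
Proof.
move=> nab; split; first by exists (tns (v 1) w); apply/tns_neq0/J_gt0.
move=> S; have [[x xS x0]|nS] := pselect (exists2 x, x \in S & x != 0);
  last first.
  by left=> m mS; apply/eqP; apply: contrapT => /negP m0; apply: nS; exists m.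
right; apply: (@submod_full (fun t => t \in S) (subspace_sub S) _ x) => //.
by move=> n t tS; exact: act_stable.
Qed.

End Tensor.

(** * The exceptional case (alpha, beta) = (0, 6/5) *)

Section Exceptional.
Variable K : numFieldType.
Local Notation Vir := (virasoro K).
Local Notation L n := (act (virL K n)).
Local Notation c := (- (22 / 5) : K).
Local Notation h := (- (1 / 5) : K).
Local Notation beta := (6 / 5 : K).

Section Quotient.
Variables (V : lieModType Vir) (v : int -> V).
Hypothesis V_inter : inter_like 0 beta v (inter_index 0 beta).
Variables (N : lieModType Vir) (w : N) (e : N -> K^o).
Hypothesis N_irr : irr_hw c 0 w e.
Variables (T : lieModType Vir) (tns : V -> N -> T).
Hypothesis T_tens : tensor_like tns.
Variables (M : lieModType Vir) (phi : M) (e' : M -> K^o).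
Hypothesis M_irr : irr_hw c h phi e'.
Variable F : T -> M.
Hypotheses (F_hom : lie_hom F).
Hypotheses (F0 : F (tns (v 0) w) = 0) (F1 : F (tns (v (-1)) w) = phi).

Local Notation W := (submod_gen [set tns (v 0) w]%classic).
Local Notation Q := (lie_quot W).
Let q : Q := lie_proj W (tns (v (-1)) w).
Let p (m : int) : Q := lie_proj W (tns (v m) w).

Let Jall m : inter_index 0 beta m.
Proof.
rewrite /inter_index (_ : (beta == 0) = false); last first.
  by rewrite mulf_eq0 invr_eq0 !pnatr_eq0.
rewrite (_ : (beta == 1) = false) ?andbF //.
rewrite -subr_eq0 (_ : _ - _ = 1 / 5); last by field.
by rewrite mulf_eq0 invr_eq0 oner_eq0 pnatr_eq0.
Qed.

Let Lv n m : L n (v m) = - (m%:~R + 0 + beta + n%:~R * beta) *: v (m + n).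
Proof. by case: V_inter => _ _ _ LE _; exact: LE. Qed.

Let tl y : linear (tns^~ y). Proof. by case: T_tens. Qed.

Let pl := lie_proj_linear W.

Let W_ge0 m : 0 <= m -> tns (v m) w \in W.
Proof.
case: m => [[|m] _|//]; first exact: submod_gen_sub.
have W0 : tns (v 0) w \in W by exact: submod_gen_sub.
have := act_stable (s := W) (virL K m.+1) _ W0.
rewrite (tensor_Lw V_inter N_irr T_tens) //.
rewrite (_ : 0 + m.+1%:Z = m.+1); last by lia.
move=> Wm.
have cn0 : - (0%:~R + 0 + beta + m.+1%:~R * beta) != 0.
  rewrite (_ : _ + _ = 6 / 5 * m.+2%:R); last by rewrite -!natr1 -pmulrn -natr1;
    field.
  by rewrite oppr_eq0 !mulf_neq0 ?invr_eq0 ?pnatr_eq0.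
by rewrite -[tns _ _]scale1r -(mulVf cn0) -scalerA rpredZ.
Qed.

Let p_ge0 m : 0 <= m -> p m = 0.
Proof. by move=> m0; apply/lie_proj_eq0/W_ge0. Qed.

Let Lp m : L (-1) (p m) = (- m)%:~R *: p (m - 1).
Proof.
rewrite /p -lie_proj_act (tensor_Lm1w V_inter N_irr T_tens) // (linZ pl).
by rewrite addr0 rmorphN.
Qed.

Let Q_sing : singular c h q.
Proof.
split.
- apply: lie_quot_ind => t; apply: lie_proj_eigen.
  by rewrite (tensor_charge V_inter N_irr T_tens) subrr rpred0.
- apply: lie_proj_eigen; rewrite (tensor_Lw V_inter N_irr T_tens) // addr0.
  rewrite -scalerBl (_ : _ - _ = 0) ?scale0r ?rpred0 //.
  by rewrite rmorphN /=; field.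
move=> n n0; rewrite /q -lie_proj_act; apply/lie_proj_eq0.
rewrite (tensor_Lw V_inter N_irr T_tens) //; last exact: ltW.
by apply/rpredZ/W_ge0; lia.
Qed.

Let Q_cyc : cyclic_vector q.
Proof.
move=> P [P0 PD] Pq PL; apply: lie_quot_ind.
apply: (tensor_full V_inter N_irr T_tens (P := fun t => P (lie_proj W t))).
- split=> [|a x y Px Py]; first by rewrite (lin0 pl).
  by rewrite pl; exact: PD.
- by move=> n t Pt; rewrite lie_proj_act; exact: PL.
case=> [m|k]; first by rewrite [lie_proj _ _](p_ge0 (m := m)).
elim: k => [|k IH]; first exact: Pq.
have := PL (virL K (-1)) _ IH; rewrite [X in P X](Lp (Negz k)).
have -> : Negz k - 1 = Negz k.+1 by lia.
move=> /(subspaceZ (conj P0 PD) ((- Negz k)%:~R)^-1).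
by rewrite scalerA mulVf ?scale1r // intr_eq0; lia.
Qed.

Let Qc : has_charge c Q. Proof. by case: Q_sing. Qed.

(** [tensor_null] at v_1 becomes L_(-2) q = 5 p_(-3) in the quotient, where p_1 = 0, while L_(-1)^2
    q = 2 p_(-3). *)
Let q_null2 : L (-1) (L (-1) q) = (2 / 5) *: L (-2) q.
Proof.
have p1 : L (-1) q = p (-2) by rewrite [LHS]Lp scale1r.
have p2 : L (-1) (p (-2)) = 2 *: p (-3) by rewrite Lp.
have := congr1 (lie_proj W) (tensor_null N_irr T_tens (v 1)).
have -> : L (-2) (v 1) = (1 / 5) *: v (-1) by rewrite Lv; congr (_ *: _); field.
have E : L (-2) (v (-1)) = (11 / 5) *: v (-3) by rewrite Lv; congr (_ *: _);
  field.
have -> : L (-4) (v 1) = (13 / 5) *: v (-3) by rewrite Lv; congr (_ *: _);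
  field.
rewrite !actZ E !(linZ (tl w)) actZ.
rewrite !(linB pl, linD pl, linZ pl, lie_proj_act) -!/(p _) -/q p_ge0 // !act0.
rewrite p1 p2; move: (L (-2) q) (p (-3)) => x y.
move/eqP; rewrite -subr_eq0 => /eqP E'; apply/eqP; rewrite -subr_eq0; apply/eqP.
by rewrite -[RHS]E'; lincomb K; field.
Qed.

Let q_null3 : L (-2) (L (-1) q) = (1 / 5) *: L (-3) q.
Proof.
(* Here x, y, z stand for L_(-2) L_(-1) q, L_(-3) q and p_(-4). The first equation is
   [L_(-1), L_(-2)] = L_(-3) on [q], the second is [tensor_null] at v_0; z is eliminated. *)
have aux (X : lmodType K) (x y z u : X) :
    5 *: (3 *: z) = x + 1 *: y + 0 *: u ->
    0 - 2 *: ((6 / 5) *: x) + (6 / 5) *: ((16 / 5) *: z) =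
      (3 / 5) *: (0 - (18 / 5) *: z) -> x = (1 / 5) *: y.
  move/eqP; rewrite -subr_eq0 => /eqP E1.
  move/eqP; rewrite -subr_eq0 => /eqP E2.
  apply/eqP; rewrite -subr_eq0; apply/eqP.
  have := congr2 (fun a b => (1 / 5) *: a + (- (1 / 2)) *: b) E1 E2.
  rewrite !scaler0 addr0 => E3; rewrite -[RHS]E3.
  by lincomb K; field.
have p1 : L (-1) q = p (-2) by rewrite [LHS]Lp scale1r.
have p2 : L (-1) (p (-2)) = 2 *: p (-3) by rewrite Lp.
have p3 : L (-1) (p (-3)) = 3 *: p (-4) by rewrite Lp.
have := congr1 (lie_proj W) (tensor_null N_irr T_tens (v 0)).
have -> : L (-2) (v 0) = (6 / 5) *: v (-2) by rewrite Lv; congr (_ *: _); field.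
have E : L (-2) (v (-2)) = (16 / 5) *: v (-4) by rewrite Lv; congr (_ *: _);
  field.
have -> : L (-4) (v 0) = (18 / 5) *: v (-4) by rewrite Lv; congr (_ *: _);
  field.
rewrite !actZ E !(linZ (tl w)) actZ.
rewrite !(linB pl, linD pl, linZ pl, lie_proj_act) -!/(p _) -/q p_ge0 // !act0.
have := act_LLE Qc (n := -1) (m := -2) (k := -3) (a := 1) (b :=
  0) erefl erefl erefl q.
have -> : L (-2) q = 5 *: p (-3).
  have := q_null2; rewrite p1 p2 => /(congr1 ( *:%R (5 / 2))); rewrite !scalerA.
  rewrite (_ : _ * (2 / 5) = 1) ?scale1r => [<-|]; last by field.
  by congr (_ *: _); field.
rewrite p1 actZ p3; exact: aux.
Qed.

Lemma exceptional_quot_irreducible : q != 0 -> lie_irreducible Q.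
Proof. exact: null_module_irreducible Q_sing Q_cyc q_null2 q_null3. Qed.

Let F_kill t : t \in W -> F t = 0.
Proof.
have [Fl Fa] := F_hom; move: t; apply: submod_gen_min.
- exact: lin0 Fl.
- by move=> a x y x0 y0; rewrite Fl x0 y0 scaler0 addr0.
- by move=> z x x0; rewrite Fa x0 act0.
- by move=> _ ->.
Qed.

Let q_neq0 : q != 0.
Proof.
apply/eqP => /lie_proj_eq0 /F_kill; rewrite F1.
by apply/eqP/(irr_hw_neq0 M_irr).
Qed.

(** The map induced by [F] is onto because [phi] generates [M], and its kernel is a submodule of the
    irreducible [Q] missing [q]. *)
Lemma exceptional_iso : lie_iso Q M.
Proof.
have [G [Gl Ga] GE] := lie_quot_lift F_hom F_kill.
have M_cyc : cyclic_vector phi by case: M_irr.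
have Gq : G q = phi by rewrite GE.
have surj x : exists y, G y = x.
  move: x; apply: M_cyc; first split.
  - by exists 0; rewrite (lin0 Gl).
  - by move=> a x y [x' <-] [y' <-]; exists (a *: x' + y'); rewrite Gl.
  - by exists q.
  - by move=> z x [x' <-]; exists (act z x'); rewrite Ga.
have inj x : G x = 0 -> x = 0.
  move=> Gx; pose S := [set y : Q | G y = 0]%classic.
  have SG y : y \in submod_gen S -> G y = 0.
    move: y; apply: submod_gen_min => //.
    - exact: lin0 Gl.
    - by move=> a y z y0 z0; rewrite Gl y0 z0 scaler0 addr0.
    - by move=> z y y0; rewrite Ga y0 act0.
  have [_ /(_ (submod_gen S : lieSubmod Q)) [|full]] :=
    exceptional_quot_irreducible q_neq0.
    by apply; exact: submod_gen_sub.
  have /eqP := SG q (full q); rewrite Gq => /eqP phi0.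
  by have := irr_hw_neq0 M_irr; rewrite phi0 eqxx.
have [G' G'K] := choice surj.
exists G; split=> //; exists G' => // x.
apply/eqP; rewrite -subr_eq0; apply/eqP/inj.
by rewrite (linB Gl) G'K subrr.
Qed.

Lemma exceptional_reducible : ~ lie_irreducible T.
Proof.
move=> [_ /(_ (W : lieSubmod T)) [z|full]].
  have := tns_neq0 V_inter N_irr T_tens (Jall 0).
  by rewrite (z _ (W_ge0 (lexx 0))) eqxx.
by move: q_neq0; rewrite (_ : q = 0) ?eqxx //; apply/lie_proj_eq0/full.
Qed.

End Quotient.


Lemma fusion_map_Vprime (M : lieModType Vir) (phi : M) (e : M -> K^o) :
  irr_hw c h phi e ->
  exists2 F : lie_tensor (Vprime 0 beta) (Lirr c 0) -> M, lie_hom F &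
    forall m, F (tens (Vprime_v 0 beta m) (Lirr_hw c 0)) = primary phi m.
Proof.
move=> M_irr; rewrite /Vprime_v /Vprime.
have -> : (beta == 0) = false by rewrite mulf_eq0 invr_eq0 !pnatr_eq0.
have -> : (beta == 1) = false.
  rewrite -subr_eq0 (_ : _ - _ = 1 / 5); last by field.
  by rewrite mulf_eq0 invr_eq0 oner_eq0 pnatr_eq0.
by rewrite andbF; exact: fusion_map M_irr.
Qed.

End Exceptional.

Theorem proposition5p6 (R : realType) :
  (forall alpha beta : R[i],
     ((exists k : int, alpha = k%:~R) -> alpha = 0) ->
     lie_irreducible (lie_tensor (Vprime alpha beta) (Lirr (- (22 / 5)) 0)) <->
     (alpha, beta) <> (0, 6 / 5)) /\
  (let T := lie_tensor (Vprime 0 (6 / 5 : R[i])) (Lirr (- (22 / 5)) 0) in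
   let w : T := tens (Vprime_v 0 (6 / 5) 0) (Lirr_hw (- (22 / 5)) 0) in
   lie_iso (lie_quot (submod_gen [set w]%classic)) (Lirr (- (22 / 5)) (- (1 / 5)))).
Proof.
have [e0 N_irr] := @Lirr_irr_hw R[i] (- (22 / 5)) 0.
have [e1 M_irr] := @Lirr_irr_hw R[i] (- (22 / 5)) (- (1 / 5)).
have [F Fh FE] := fusion_map_Vprime M_irr.
have V_inter := Vprime_inter_like (0 : R[i]) (6 / 5).
have T_tens := lie_tensor_like (Vprime 0 (6 / 5 : R[i])) (Lirr (- (22 / 5)) 0).
(* By computation [primary] is 0 at index 0 and the highest weight vector at index -1. *)
split; last exact: (exceptional_iso V_inter N_irr T_tens M_irr Fh (FE 0) (FE
  (-1))).
move=> alpha beta alpha_int; split=> [irr [a0 b6]|].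
  move: irr; rewrite a0 b6.
  exact: (exceptional_reducible V_inter N_irr T_tens M_irr Fh (FE 0) (FE (-1))).
apply: (tensor_irreducible (Vprime_inter_like alpha beta) _ N_irr
  (lie_tensor_like _ _)).
by move=> k ak; apply: alpha_int; exists k.
Qed.
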